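(* Assume the setting in the context (domain $\Omega$, mesh $\mathcal{T}_h$, space $V_{hp}$, DG bilinear form $\mathcal{A}$ of SIPG or LDG type with penalty parameter $\alpha\ge1$, chosen large enough for SIPG so that $\mathcal{A}$ is coercive, subspaces $V_{hp}^B,V_{hp}^C$ and the Oswald operator $\mathsf{Q}_h:V_{hp}\to V_{hp}^C$). Then for every $v\in V_{hp}$, $$\mathcal{A}(v-\mathsf{Q}_h v,v-\mathsf{Q}_h v)+\mathcal{A}(\mathsf{Q}_h v,\mathsf{Q}_h v)\lesssim \mathcal{A}(v,v),$$ and consequently the splitting $V_{hp}=V_{hp}^B+V_{hp}^C$ is stable, i.e. $$\inf_{\substack{v^B\in V_{hp}^B,\ v^C\in V_{hp}^C\\ v^B+v^C=v}}\big[\mathcal{A}(v^B,v^B)+\mathcal{A}(v^C,v^C)\big]\lesssim \mathcal{A}(v,v)\qquad\forall v\in V_{hp},$$ where the hidden constants are independent of the mesh size $h$, the polynomial degree $p$ and the penalty coefficient $\alpha$.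
   Context: $\Omega\subset\mathbb{R}^d$, $d\in\{2,3\}$, is a convex polygonal/polyhedral domain; $\mathcal{T}_h$ is a conforming, quasi-uniform, shape-regular partition of $\Omega$ into elements $\kappa$ of diameter $h_\kappa$, each the affine image $\mathsf{F}_\kappa(\hat\kappa)$ of the reference hypercube $\hat\kappa=(-1,1)^d$; $h=\max h_\kappa$. Polynomial degree $p\ge2$; $V_{hp}=\{v\in L^2(\Omega): v\circ\mathsf{F}_\kappa\in\mathbb{Q}^p(\hat\kappa)\ \forall\kappa\}$, with $\mathbb{Q}^p$ the tensor-product polynomials of degree $\le p$ in each variable. Faces: $\mathcal{F}_h^I$ interior faces, $\mathcal{F}_h^B$ boundary faces, $\mathcal{F}_h=\mathcal{F}_h^I\cup\mathcal{F}_h^B$. For $F\in\mathcal{F}_h^I$ shared by $\kappa^\pm$ with outward normals $\mathbf{n}_{F,\kappa^\pm}$: $[\![v]\!]=v^+\mathbf{n}_{F,\kappa^+}+v^-\mathbf{n}_{F,\kappa^-}$, $\{v\}=(v^++v^-)/2$, $[\![\boldsymbol\tau]\!]=\boldsymbol\tau^+\cdot\mathbf{n}_{F,\kappa^+}+\boldsymbol\tau^-\cdot\mathbf{n}_{F,\kappa^-}$, $\{\boldsymbol\tau\}=(\boldsymbol\tau^++\boldsymbol\tau^-)/2$; on $F\in\mathcal{F}_h^B$, $[\![v]\!]=v\mathbf{n}_F$ (outward normal), $\{\boldsymbol\tau\}=\boldsymbol\tau$. Liftings: for $F\in\mathcal{F}_h$, $r_F:[L^2(F)]^d\to[V_{hp}]^d$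 with $\int_\Omega r_F(\boldsymbol\tau)\cdot\boldsymbol\eta\,dx=-\int_F\boldsymbol\tau\cdot\{\boldsymbol\eta\}\,ds$ for all $\boldsymbol\eta\in[V_{hp}]^d$; for $F\in\mathcal{F}_h^I$, $l_F:L^2(F)\to[V_{hp}]^d$ with $\int_\Omega l_F(v)\cdot\boldsymbol\eta\,dx=-\int_F v[\![\boldsymbol\eta]\!]\,ds$; $\mathcal{R}=\sum_{F\in\mathcal{F}_h}r_F$, $\mathcal{L}=\sum_{F\in\mathcal{F}_h^I}l_F$. Penalty: $\sigma|_F=\alpha p^2/\min(h_{\kappa^+},h_{\kappa^-})$ on $F\in\mathcal{F}_h^I$, $\sigma|_F=\alpha p^2/h_\kappa$ on $F\in\mathcal{F}_h^B$, with $\alpha\ge1$. DG form: with $G(u):=\mathcal{R}([\![u]\!])+\mathcal{L}(\boldsymbol\beta\cdot[\![u]\!])$, $\mathcal{A}(u,v)=\sum_\kappa\int_\kappa\nabla u\cdot\nabla v+\sum_\kappa\int_\kappa\nabla u\cdot G(v)+\sum_\kappa\int_\kappa G(u)\cdot\nabla v+\sum_{F\in\mathcal{F}_h}\int_F\sigma[\![u]\!]\cdot[\![v]\!]+\theta\int_\Omega G(u)\cdot G(v)$, where SIPG: $\theta=0$, $\boldsymbol\beta=\mathbf{0}$, with $\alpha$ large enough for coercivity; LDG: $\theta=1$, $\boldsymbol\beta\in\mathbb{R}^d$ uniformly bounded (possibly zero). Nodes: for each $\kappa$, $\mathcal{N}(\kappa)$ is the set of $(p+1)^d$ mapped tensor-product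 Gauss–Legendre–Lobatto nodes, $\mathcal{N}_I(\kappa)$ those in the interior of $\kappa$, $\mathcal{N}_B(\kappa)$ those on $\partial\kappa$. Subspaces: $V_{hp}^B=\{v\in V_{hp}: v|_\kappa(\xi)=0\ \forall\xi\in\mathcal{N}_I(\kappa),\ \forall\kappa\}$; $V_{hp}^C=\{v\in C^0(\overline\Omega): v\circ\mathsf{F}_\kappa\in\mathbb{Q}^p(\hat\kappa)\ \forall\kappa,\ v|_{\partial\Omega}=0\}$. Oswald operator: $\mathsf{Q}_h v\in V_{hp}^C$ is defined by its nodal values: for each node $\xi$, $\mathsf{Q}_hv(\xi)=0$ if $\xi\in\partial\Omega$, and otherwise $\mathsf{Q}_hv(\xi)$ is the average of $v|_{\kappa'}(\xi)$ over all $\kappa'\in\mathcal{T}_h$ with $\xi\in\overline{\kappa'}$. Note $v-\mathsf{Q}_hv\in V_{hp}^B$. *)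

(* Defs.v *)
From HB Require Import structures.
From mathcomp Require Import all_boot all_order all_algebra.
From mathcomp Require Import all_classical all_reals all_analysis.
From Stdlib Require Import ClassicalEpsilon.
Set Implicit Arguments.
Unset Strict Implicit.
Unset Printing Implicit Defensive.
Import Order.TTheory GRing.Theory Num.Theory.
Import numFieldNormedType.Exports.

Local Open Scope classical_set_scope.
Local Open Scope ring_scope.

Section DG.
Variable R : realType.

Fixpoint cint (n : nat) (f : seq R -> R) : R :=
  match n with
  | 0 => f [::]
  | n'.+1 => \int[lebesgue_measure]_(t in `[-1%R, 1%R]) cint n' (fun s => f (t :: s))
  end.

Variable d : nat.
Notation pt := 'rV[R]_d.

Definition refint (f : pt -> R) : R := cint d (fun s => f (\row_i nth 0 s i)).

Definition sgn (s : bool) : R := if s then 1 else -1.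

Definition reffaceint (j : 'I_d) (s : bool) (f : pt -> R) : R :=
  cint d.-1 (fun y => f (\row_i (if (i < j)%N then nth 0 y i
                                 else if i == j then sgn s else nth 0 y i.-1))).

Definition dot (u v : pt) : R := \sum_i u 0 i * v 0 i.
Definition enorm (u : pt) : R := Num.sqrt (dot u u).
Definition ecoord (i : 'I_d) : pt := delta_mx 0 i.

Definition ocube : set pt := [set x | forall i, -1 < x 0 i < 1].
Definition ccube : set pt := [set x | forall i, -1 <= x 0 i <= 1].
Definition rface (sig : 'I_d -> option bool) : set pt :=
  [set x | ccube x /\ forall i, if sig i is Some s then x 0 i = sgn s else True].
Definition facet (j : 'I_d) (s : bool) : 'I_d -> option bool :=
  fun i => if i == j then Some s else None.

(* Meshes: elements are affine images F_k(x) = x B_k + b_k of (-1,1)^d *)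
Record mesh := Mesh { nel : nat; mB : 'I_nel -> 'M[R]_d; mb : 'I_nel -> pt }.
Arguments mB : clear implicits.
Arguments mb : clear implicits.

Variable M : mesh.
Notation N := (nel M).

Definition Fmap (k : 'I_N) (x : pt) : pt := x *m mB M k + mb M k.
Definition Finv (k : 'I_N) (y : pt) : pt := (y - mb M k) *m invmx (mB M k).

Definition elem (k : 'I_N) : set pt := Fmap k @` ocube.
Definition celem (k : 'I_N) : set pt := Fmap k @` ccube.
Definition Omega : set pt := interior [set x | exists k, celem k x].
Definition bdry : set pt := closure Omega `\` Omega.

Definition diam (k : 'I_N) : R :=
  sup [set r | exists x y, ccube x /\ ccube y /\ r = enorm (Fmap k x - Fmap k y)].
Definition hmax : R := \big[Num.max/0]_k diam k.

Definition convex_set (A : set pt) : Prop :=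
  forall x y (t : R), A x -> A y -> 0 <= t <= 1 -> A ((1 - t) *: x + t *: y).

(* conforming, shape-regular (constant Csr), quasi-uniform (constant Cqu)
   partition of a convex polytope Omega into affine images of the cube *)
Definition admissible_mesh (Csr Cqu : R) : Prop :=
  (0 < N)%N /\
      (forall k, mB M k \in unitmx) /\
      convex_set Omega /\
      (forall k l, k != l -> (setI (elem k) (elem l)) = set0) /\
      (forall k l, k != l ->
          ((setI (celem k) (celem l)) = set0 \/
          exists sig tau, (setI (celem k) (celem l)) = Fmap k @` rface sig /\
                          (setI (celem k) (celem l)) = Fmap l @` rface tau)) /\
      (forall k, exists c : pt, forall y, enorm (y - c) < diam k / Csr -> elem k y) /\
      (forall k, hmax <= Cqu * diam k).

Definition nbr (k : 'I_N) (j : 'I_d) (s : bool) (l : 'I_N) : bool :=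
  `[< l != k /\ Fmap k @` rface (facet j s) `<=` celem l >].
Definition isbdry (k : 'I_N) (j : 'I_d) (s : bool) : bool :=
  ~~ [exists l, nbr k j s l].

Definition nvec (k : 'I_N) (j : 'I_d) : pt := ecoord j *m (invmx (mB M k))^T.
Definition nrm (k : 'I_N) (j : 'I_d) (s : bool) : pt :=
  (sgn s / enorm (nvec k j)) *: nvec k j.
Definition faceint (k : 'I_N) (j : 'I_d) (s : bool) (g : pt -> R) : R :=
  `|\det (mB M k)| * enorm (nvec k j) * reffaceint j s (fun xh => g (Fmap k xh)).
Definition elint (k : 'I_N) (g : pt -> R) : R :=
  `|\det (mB M k)| * refint (fun xh => g (Fmap k xh)).

(* The space V_hp: on each element, v o F_k is in Q^p                   *)
Variable p : nat.
Definition midx := {ffun 'I_d -> 'I_p.+1}.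
Definition coef := {ffun midx -> R}.
Definition mono (x : pt) (a : midx) : R := \prod_i x 0 i ^+ a i.
Definition qeval (c : coef) (x : pt) : R := \sum_a c a * mono x a.

Definition dgfun := 'I_N -> coef.
Definition vdg := 'I_d -> dgfun.
Definition dgadd (u v : dgfun) : dgfun := fun k => u k + v k.
Definition dgsub (u v : dgfun) : dgfun := fun k => u k - v k.

Definition vk (v : dgfun) (k : 'I_N) (x : pt) : R := qeval (v k) (Finv k x).
Definition gk (g : vdg) (k : 'I_N) (x : pt) : pt := \row_i vk (g i) k x.
Definition grad (f : pt -> R) (x : pt) : pt :=
  \row_i derive1 (fun t : R => f (x + t *: ecoord i)) 0.
Definition gradk (v : dgfun) (k : 'I_N) (x : pt) : pt := grad (vk v k) x.

Definition L2vv (g h : vdg) : R := \sum_k elint k (fun x => dot (gk g k x) (gk h k x)).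

(* sum over all faces F of F_h: interior faces are seen from both sides,
   hence the weight 1/2 *)
Definition lift_rhs (beta : pt) (u : dgfun) (eta : vdg) : R :=
  - \sum_k \sum_j \sum_(s : bool)
      ((\sum_(l | nbr k j s l)
          (2^-1 * faceint k j s (fun x =>
              (vk u k x - vk u l x) * dot (nrm k j s) (2^-1 *: (gk eta k x + gk eta l x)))
         + 2^-1 * faceint k j s (fun x =>
              (dot beta (nrm k j s) * (vk u k x - vk u l x))
              * dot (gk eta k x - gk eta l x) (nrm k j s))))
       + (if isbdry k j s then
            faceint k j s (fun x => vk u k x * dot (nrm k j s) (gk eta k x)) else 0)).

(* G(u) = R([[u]]) + L(beta.[[u]]) : the unique element of [V_hp]^d with
   (G(u), eta)_Omega = - sum_F int_F [[u]].{eta} - sum_{F int} int_F (beta.[[u]]) [[eta]] *)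
Definition Gop (beta : pt) (u : dgfun) : vdg :=
  epsilon (inhabits (fun _ _ => 0 : coef))
          (fun g : vdg => forall eta : vdg, L2vv g eta = lift_rhs beta u eta).

Definition penalty (alpha : R) (u v : dgfun) : R :=
  \sum_k \sum_j \sum_(s : bool)
     ((\sum_(l | nbr k j s l)
         2^-1 * faceint k j s (fun x =>
            alpha * (p%:R) ^+ 2 / Num.min (diam k) (diam l)
            * (vk u k x - vk u l x) * (vk v k x - vk v l x)))
      + (if isbdry k j s then
           faceint k j s (fun x => alpha * (p%:R) ^+ 2 / diam k * vk u k x * vk v k x)
         else 0)).

(* the DG bilinear form; SIPG: theta = 0, beta = 0; LDG: theta = 1 *)
Definition Aform (alpha : R) (beta : pt) (theta : R) (u v : dgfun) : R :=
  \sum_k elint k (fun x => dot (gradk u k x) (gradk v k x))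
  + \sum_k elint k (fun x => dot (gradk u k x) (gk (Gop beta v) k x))
  + \sum_k elint k (fun x => dot (gk (Gop beta u) k x) (gradk v k x))
  + penalty alpha u v
  + theta * L2vv (Gop beta u) (Gop beta v).

(* (P_n, P_{n+1}) via the three-term recurrence *)
Fixpoint legpair (n : nat) : {poly R} * {poly R} :=
  match n with
  | 0 => (1, 'X)
  | n'.+1 => let: (a, b) := legpair n' in
             (b, (n'.+2%:R)^-1 *: ((2 * n' + 3)%:R *: ('X * b) - (n'.+1%:R) *: a))
  end.
Definition legendre (n : nat) : {poly R} := (legpair n).1.

Definition gll (x : R) : Prop :=
  -1 <= x <= 1 /\ (1 - x ^+ 2) * (legendre p)^`().[x] = 0.
Definition refnode (xh : pt) : Prop := forall i, gll (xh 0 i).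
Definition refinode (xh : pt) : Prop := refnode xh /\ ocube xh.

Definition VB (v : dgfun) : Prop :=
  forall k xh, refinode xh -> vk v k (Fmap k xh) = 0.
Definition VC (v : dgfun) : Prop :=
  exists w : pt -> R, {within closure Omega, continuous w} /\
    (forall x, bdry x -> w x = 0) /\
    (forall k x, celem k x -> w x = vk v k x).

Definition nodeval (v : dgfun) (x : pt) : R :=
  if `[< bdry x >] then 0
  else (\sum_(l | `[< celem l x >]) vk v l x) / (#|[set l | `[< celem l x >]]|)%:R.
Definition Qh (v : dgfun) : dgfun := fun k =>
  epsilon (inhabits (0 : coef))
          (fun c : coef => forall xh, refnode xh -> qeval c xh = nodeval v (Fmap k xh)).

End DG.
Arguments Aform {R d} M p alpha beta theta u v.

(* Main.v *)
Require Import Defs.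
From HB Require Import structures.
From mathcomp Require Import all_boot all_order all_algebra.
From mathcomp Require Import all_classical all_reals all_analysis.
From mathcomp Require Import perm ring lra zify.
Set Implicit Arguments.
Unset Strict Implicit.
Unset Printing Implicit Defensive.
Import Order.TTheory GRing.Theory Num.Theory.
Import numFieldNormedType.Exports.
Local Open Scope classical_set_scope.
Local Open Scope ring_scope.

(* Write [a(v)] for the squared broken gradient norm and [P(v)] for the penalty with
   [alpha = 1]; [A(v,v)] is equivalent to [a(v) + alpha P(v)], since testing the definition
   of [G(v)] with [G(v)] itself and the trace inequality on polynomials give
   [|G(v)|^2 <= C P(v)].  As [Q v] is continuous and vanishes on the boundary,
   [P(v - Q v) = P(v)] and [P(Q v) = 0], so everything reduces to [a(v - Q v) <= C P(v)].
   The inverse inequality bounds [a(v - Q v)] by [p^4 / h^2] times the squared norm, which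
   is equivalent to the Lobatto-weighted sum of the nodal values of [v - Q v].  At a node,
   the elements containing it are linked by boundedly many facet crossings, and when the
   node lies on the boundary some of them has a boundary facet there; hence the nodal error
   is controlled by the jumps on the facets through the node.  The Lobatto weight of an end
   point is [2 / (p (p + 1))], so on a facet the cube weights are of order [p^-2] times the
   facet weights, and the sum of the squared jumps is at most [C h^2 / p^4] times [P(v)].
   Weights match across elements because conforming neighbours are glued by a signed
   permutation of the reference coordinates, which preserves the symmetric rule. *)

(** * Legendre polynomials and Lobatto quadrature *)

Section PolynomialIntegral.
Variable R : realType.
Implicit Types (p q r : {poly R}).

(** Cube and facet integrals are iterated one-dimensional integrals; on tensor polynomials each is
    replaced by a finite sum with non-negative weights, exact for the degrees in play. Linearity,
    monotonicity and the comparison with nodal sums then become statements about finite sums. The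
    powers of [p] cancel: the inverse inequality costs [p ^ 4], and the small Lobatto end weight and
    the penalty each return [p ^ 2]. The geometric obstacle is that conformity only describes
    pairwise intersections. That elements around a point are linked through facets, and that a
    boundary point meets a facet without neighbour, is extracted from convexity of [Omega]: a
    segment avoiding all faces of codimension two can leave the linked elements only through a facet
    without neighbour, so it leaves the covered set, and convexity forbids its return. [Gop] and
    [Qh] are defined by choice, so existence precedes any use of their defining equations. [alpha]
    merely multiplies [P(v)] on both sides; the threshold [4 * Clift] lets the penalty absorb the
    lifting in SIPG. *)

Definition pint (q : {poly R}) : R :=
  \int[lebesgue_measure]_(t in `[-1%R, 1%R]) q.[t].

Lemma horner_integrable q :
  (@lebesgue_measure R).-integrable `[-1, 1] (EFin \o horner q).
Proof.
apply: continuous_compact_integrable; first exact: segment_compact.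
by apply: continuous_subspaceT; exact: continuous_horner.
Qed.

Lemma pintD p q : pint (p + q) = pint p + pint q.
Proof.
rewrite /pint -RintegralD//; try exact: horner_integrable.
by apply: eq_Rintegral => x _; rewrite hornerD.
Qed.

Lemma pintZ c p : pint (c *: p) = c * pint p.
Proof.
rewrite /pint -RintegralZl//; try exact: horner_integrable.
by apply: eq_Rintegral => x _; rewrite hornerZ.
Qed.

Lemma pint0 : pint 0 = 0.
Proof. by rewrite -(scale0r 0) pintZ mul0r. Qed.

Lemma pintN p : pint (- p) = - pint p.
Proof. by rewrite -scaleN1r pintZ mulN1r. Qed.

Lemma pintB p q : pint (p - q) = pint p - pint q.
Proof. by rewrite pintD pintN. Qed.

Lemma pint_sum (I : Type) (s : seq I) (F : I -> {poly R}) :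
  pint (\sum_(i <- s) F i) = \sum_(i <- s) pint (F i).
Proof. by elim/big_ind2: _ => [|x a y b <- <-|//]; [exact: pint0|exact: pintD]. Qed.

Lemma pint_ge0 q : (forall x, -1 <= x <= 1 -> 0 <= q.[x]) -> 0 <= pint q.
Proof. by move=> H; apply: Rintegral_ge0 => x /=; rewrite in_itv/= => /H. Qed.

Lemma pint_deriv q : pint (q^`()) = q.[1] - q.[-1].
Proof.
have lt11 : (-1 : R) < 1 by apply: (@lt_trans _ _ 0); rewrite ?ltrN10 ?ltr01.
have cq r (x : R) : {for x, continuous (horner r)} by exact: continuous_horner.
have E : (\int[lebesgue_measure]_(x in `[(-1)%R, 1%R]) (q^`().[x])%:E =
          (q.[1])%:E - (q.[-1])%:E)%E.
  apply: continuous_FTC2 => //.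
  - by apply: continuous_subspaceT; exact: continuous_horner.
  - split.
    + by move=> x _; exact: derivable_horner.
    + by apply: cvg_at_right_filter; exact: cq.
    + by apply: cvg_at_left_filter; exact: cq.
  - by move=> x _; rewrite -derivE.
by rewrite /pint /Rintegral E -EFinB.
Qed.

Lemma pint_parts p q :
  pint (p^`() * q) = p.[1] * q.[1] - p.[-1] * q.[-1] - pint (p * q^`()).
Proof. by have := pint_deriv (p * q); rewrite derivM pintD !hornerM; lra. Qed.

Definition antideriv q : {poly R} := \poly_(i < (size q).+1) (q`_i.-1 / i%:R *+ (i != 0%N)).

Lemma antiderivK q : (antideriv q)^`() = q.
Proof.
apply/polyP => i; rewrite coef_deriv coef_poly ltnS /=.
case: (ltnP i (size q)) => hi; last by rewrite mul0rn nth_default.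
by rewrite /= mulr1n -[LHS]mulr_natr mulfVK ?pnatr_eq0.
Qed.

Lemma size_antideriv q : (size (antideriv q) <= (size q).+1)%N.
Proof. exact: size_poly. Qed.

Lemma poly_vanish_itv q (a b : R) : a < b ->
  (forall x, a < x < b -> q.[x] = 0) -> q = 0.
Proof.
move=> ab H; apply/eqP/negP => /negP q0.
(* These are [size q] distinct interior points, one more than the number of roots a non-zero [q] can
   have. *)
pose s := [seq a + (b - a) * (i.+1%:R / (size q).+1%:R) | i <- iota 0 (size q)].
have us : uniq s.
  rewrite map_inj_uniq ?iota_uniq// => i j /addrI /mulfI.
  rewrite subr_eq0 gt_eqF// => /(_ isT) /divIf.
  by rewrite pnatr_eq0 => /(_ isT) /eqP; rewrite eqr_nat => /eqP [].
have rs : all (root q) s.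
  apply/allP => x /mapP [i]; rewrite mem_iota => /andP [_]; rewrite add0n => hi ->.
  apply/rootP/H; have h0 : 0 < (size q).+1%:R :> R by rewrite ltr0n.
  have t0 : 0 < i.+1%:R / (size q).+1%:R :> R by rewrite divr_gt0// ltr0n.
  have t1 : i.+1%:R / (size q).+1%:R < 1 :> R.
    by rewrite ltr_pdivrMr// mul1r ltr_nat ltnS.
  set t := _ / _ in t0 t1 *.
  have := mulr_gt0 (_ : 0 < b - a) t0; rewrite subr_gt0 => /(_ ab).
  have := mulr_gt0 (_ : 0 < b - a) (_ : 0 < 1 - t).
  rewrite !subr_gt0 => /(_ ab t1); nra.
have := max_poly_roots q0 rs us.
by rewrite size_map size_iota ltnn.
Qed.

(** The antiderivative is nondecreasing on the interval and has equal end values, so it is constant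
    there, hence constant as a polynomial. *)
Lemma pint_eq0 q : (forall x, -1 < x < 1 -> 0 <= q.[x]) -> pint q = 0 -> q = 0.
Proof.
move=> H; rewrite -{1 2}(antiderivK q) pint_deriv => /eqP.
rewrite subr_eq0 => /eqP E; set Q := antideriv q in E *.
have mono : {in `[-1, 1]%R &, {homo horner Q : x y / x <= y}}.
  apply: ger0_derive1_le_cc.
  - by move=> x _; exact: derivable_horner.
  - by move=> x; rewrite in_itv/= => /H; rewrite -derivE antiderivK.
  - by apply: continuous_subspaceT; exact: continuous_horner.
have Qc : Q - (Q.[1])%:P = 0.
  apply: (@poly_vanish_itv _ (-1) 1); first lra.
  move=> x hx; rewrite !hornerE; apply/eqP; rewrite subr_eq0 eq_le.
  rewrite {1}E; apply/andP; split.
    by rewrite -E; apply: mono; rewrite ?in_itv/=; lra.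
  by rewrite E; apply: mono; rewrite ?in_itv/=; lra.
by rewrite -(subrK (Q.[1])%:P Q) Qc add0r derivC.
Qed.

Lemma pint_CS p q : (pint (p * q)) ^+ 2 <= pint (p ^+ 2) * pint (q ^+ 2).
Proof.
have sq0 r : 0 <= pint (r ^+ 2) by apply: pint_ge0 => x _; rewrite horner_exp sqr_ge0.
have [q0|q0] := eqVneq (pint (q ^+ 2)) 0.
  have : q ^+ 2 = 0 by apply: pint_eq0 => // x _; rewrite horner_exp sqr_ge0.
  by move/eqP; rewrite expf_eq0 /= => /eqP ->; rewrite mulr0 expr0n /= pint0 expr0n /= mulr0.
have qp : 0 < pint (q ^+ 2) by rewrite lt_neqAle eq_sym q0 sq0.
have := sq0 (pint (q ^+ 2) *: p - pint (p * q) *: q).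
rewrite (_ : _ ^+ 2 = (pint (q ^+ 2) ^+ 2) *: p ^+ 2 - (2 * pint (q ^+ 2) * pint (p * q)) *: (p * q)
   + (pint (p * q) ^+ 2) *: q ^+ 2); last by rewrite -!mul_polyC !rmorphM /=; ring.
rewrite pintD pintB !pintZ.
set a := pint (p ^+ 2); set b := pint (p * q); set c := pint (q ^+ 2).
rewrite (_ : _ + _ = c * (a * c - b ^+ 2)); last ring.
by rewrite pmulr_rge0// subr_ge0.
Qed.

Lemma pint_refl q : pint (q \Po - 'X) = pint q.
Proof.
rewrite -{2}(antiderivK q) pint_deriv -{1}(antiderivK q).
set Q := antideriv q.
have -> : Q^`() \Po - 'X = - (Q \Po - 'X)^`().
  by rewrite deriv_comp derivN derivX mulrN1 opprK.
by rewrite pintN pint_deriv !horner_comp !hornerE opprK opprB.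
Qed.

End PolynomialIntegral.

(** * Legendre polynomials: differential equation, orthogonality, inverse inequality *)

Section Legendre.
Variable R : realType.
Implicit Types (q r : {poly R}) (n : nat).
Local Notation L := (legendre R).

Lemma legpairE n : legpair R n = (L n, L n.+1).
Proof.
by rewrite /legendre /=; case: (legpair R n).
Qed.

Lemma legendre0 : L 0 = 1. Proof. by []. Qed.
Lemma legendre1 : L 1 = 'X. Proof. by []. Qed.

Lemma legendre_rec n :
  n.+2%:R * L n.+2 = (2 * n + 3)%:R * ('X * L n.+1) - n.+1%:R * L n.
Proof.
have -> : L n.+2 = (n.+2%:R)^-1 *: ((2 * n + 3)%:R *: ('X * L n.+1) - n.+1%:R *: L n).
  have := legpairE n.+1; rewrite [legpair R n.+1]/= (legpairE n).
  by case=> <-.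
have sc (Z : {poly R}) : n.+2%:R * (n.+2%:R^-1 *: Z) = Z.
  by rewrite mulr_natl -scaler_nat scalerA divff ?pnatr_eq0// scale1r.
by rewrite sc -!mul_polyC !polyC_natr.
Qed.

Lemma natr_poly_neq0 n : n.+1%:R != 0 :> {poly R}.
Proof. by rewrite -polyC_natr polyC_eq0 pnatr_eq0. Qed.

(** The two identities are proved together because each step uses both: differentiating the
    three-term recurrence and eliminating the derivative of [L n] by the second identity yields the
    first one at the next index, from which the second follows. *)
Lemma legendre_deriv_rec n :
  (L n.+1)^`() = 'X * (L n)^`() + n.+1%:R * L n /\
  'X * (L n.+1)^`() = (L n)^`() + n.+1%:R * L n.+1.
Proof.
elim: n => [|n [P Q]].
  rewrite legendre0 legendre1 derivX -polyC1 derivC; split; ring.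
have D := congr1 deriv (legendre_rec n).
rewrite derivB -!polyC_natr !mul_polyC !derivZ derivM derivX mul1r -!mul_polyC !polyC_natr in D.
have P' : (L n.+2)^`() = 'X * (L n.+1)^`() + n.+2%:R * L n.+1.
  apply: (mulfI (natr_poly_neq0 n.+1)); rewrite D.
  have -> : (L n)^`() = 'X * (L n.+1)^`() - n.+1%:R * L n.+1 by rewrite Q; ring.
  ring.
split=> //; rewrite P'.
apply/eqP; rewrite -subr_eq0; apply/eqP.
have E : 'X * ('X * (L n.+1)^`()) = (L n.+1)^`() - n.+1%:R * L n + n.+1%:R * 'X * L n.+1.
  by rewrite Q mulrDr P; ring.
have F : n.+2%:R * L n.+2 = (2 * n + 3)%:R * ('X * L n.+1) - n.+1%:R * L n := legendre_rec n.
rewrite mulrDr E F; ring.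
Qed.

Lemma legendre_deriv_lower n :
  (1 - 'X ^+ 2) * (L n.+1)^`() = n.+1%:R * (L n - 'X * L n.+1).
Proof.
have [P Q] := legendre_deriv_rec n.
have -> : (1 - 'X ^+ 2) * (L n.+1)^`() = (L n.+1)^`() - 'X * ('X * (L n.+1)^`()) by ring.
by rewrite Q {1}P; ring.
Qed.

Lemma legendre_ODE n :
  ((1 - 'X ^+ 2) * (L n)^`())^`() = - ((n * n.+1)%:R *: L n).
Proof.
case: n => [|n]; first by rewrite legendre0 -polyC1 derivC mulr0 mul0n scale0r -polyC0 derivC oppr0.
rewrite legendre_deriv_lower -polyC_natr mul_polyC derivZ derivB derivM derivX mul1r.
have [P Q] := legendre_deriv_rec n.
by rewrite Q -!mul_polyC !polyC_natr; ring.
Qed.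

Lemma horner_legendre1 n : (L n).[1] = 1.
Proof.
suff: (L n).[1] = 1 /\ (L n.+1).[1] = 1 by case.
elim: n => [|n [IH1 IH2]]; first by rewrite legendre0 legendre1 !hornerE.
split=> //; have := congr1 (horner^~ 1) (legendre_rec n).
rewrite /= -!polyC_natr hornerD hornerN !hornerM !hornerC IH1 IH2 hornerX !mulr1.
move=> E; apply: (@mulfI _ n.+2%:R); first by rewrite pnatr_eq0.
by rewrite E; ring.
Qed.

Lemma legendre_refl n : L n \Po - 'X = (-1) ^+ n *: L n.
Proof.
suff: L n \Po - 'X = (-1) ^+ n *: L n /\ L n.+1 \Po - 'X = (-1) ^+ n.+1 *: L n.+1 by case.
elim: n => [|n [IH1 IH2]].
  rewrite legendre0 legendre1 expr0 scale1r -polyC1 comp_polyC comp_polyX expr1.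
  by rewrite scaleN1r.
split=> //; have := congr1 (comp_poly (- 'X)) (legendre_rec n).
rewrite -!polyC_natr /= comp_polyB !comp_polyM !comp_polyC comp_polyX IH1 IH2.
move=> E; apply: (mulfI (natr_poly_neq0 n.+1)); rewrite -polyC_natr E.
have F := legendre_rec n; rewrite -!polyC_natr in F.
rewrite [RHS](_ : _ = (-1) ^+ n.+2 *: ((n.+2%:R)%:P * L n.+2)); last by rewrite scalerAr.
by rewrite F -!mul_polyC !exprS; ring.
Qed.

Lemma horner_legendreN1 n : (L n).[-1] = (-1) ^+ n.
Proof.
have := congr1 (horner^~ 1) (legendre_refl n).
by rewrite /= horner_comp !hornerE horner_legendre1 mulr1.
Qed.

(** At an end point the second-order term of the differential equation vanishes, which leaves an
    equation for the first derivative. *)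
Lemma horner_legendre_deriv1 n : 2 * (L n)^`().[1] = (n * n.+1)%:R.
Proof.
have := congr1 (horner^~ 1) (legendre_ODE n).
rewrite /= derivM !hornerE horner_legendre1 derivB -polyC1 derivC derivXn !hornerE /=.
by rewrite expr1n; lra.
Qed.

Lemma horner_legendre_derivN1 n : 2 * (L n)^`().[-1] = - (n * n.+1)%:R * (-1) ^+ n.
Proof.
have := congr1 (horner^~ (-1)) (legendre_ODE n).
rewrite /= derivM !hornerE horner_legendreN1 derivB -polyC1 derivC derivXn !hornerE /=.
by rewrite sqrrN expr1n; lra.
Qed.

Lemma size_legendre n : size (L n) = n.+1.
Proof.
suff: size (L n) = n.+1 /\ size (L n.+1) = n.+2 by case.
elim: n => [|n [IH1 IH2]]; first by rewrite legendre0 legendre1 size_poly1 size_polyX.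
split=> //; have := congr1 (fun q : {poly R} => size q) (legendre_rec n).
rewrite -!polyC_natr !mul_polyC size_scale ?pnatr_eq0// => ->.
rewrite size_polyDl !size_scale ?pnatr_eq0 ?addn3//.
  by rewrite mulrC size_mulX -?size_poly_eq0 IH2.
by rewrite size_polyN size_scale ?pnatr_eq0// mulrC size_mulX -?size_poly_eq0 IH2 // IH1.
Qed.

Lemma legendre_neq0 n : L n != 0.
Proof. by rewrite -size_poly_eq0 size_legendre. Qed.

Lemma size_legendre_deriv n : (size (L n)^`() <= n)%N.
Proof. by rewrite -ltnS -(size_legendre n) lt_size_deriv// legendre_neq0. Qed.

(* The Sturm-Liouville operator is self-adjoint: there is no boundary term. *)
Lemma pint_legendre_deriv n q :
  pint ((1 - 'X ^+ 2) * (L n)^`() * q^`()) = (n * n.+1)%:R * pint (L n * q).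
Proof.
have := pint_parts ((1 - 'X ^+ 2) * (L n)^`()) q.
rewrite legendre_ODE !hornerE /= sqrrN expr1n subrr !mul0r.
rewrite mulNr -scalerAl pintN pintZ; set a := pint _; set b := pint _; lra.
Qed.

(** Moving the Sturm-Liouville operator from [L n] onto ['X^m] gives back ['X^m] with eigenvalue
    [m (m + 1)] plus a multiple of the monomial of degree [m - 2]. As [n (n + 1)] and [m (m + 1)]
    differ for [m < n], the moments vanish by strong induction. *)
Lemma pint_legendre_lower n q : (size q <= n)%N -> pint (L n * q) = 0.
Proof.
have mono m : (m < n)%N -> pint (L n * 'X^m) = 0.
  elim/ltn_ind: m => m IH mn.
  have E : (n * n.+1)%:R * pint (L n * 'X^m) =
      - pint (L n * ((1 - 'X^2) * ('X^m)^`())^`()).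
    rewrite -pint_legendre_deriv.
    have := pint_parts (L n) ((1 - 'X^2) * ('X^m)^`()).
    have [w1 w2] : (1 - 'X^2 : {poly R}).[1] = 0 /\ (1 - 'X^2 : {poly R}).[-1] = 0.
      by rewrite !hornerE /= sqrrN expr1n subrr.
    rewrite !hornerM w1 w2 !mul0r !mulr0.
    rewrite mulrA [(L n)^`() * _]mulrC; lra.
  have {}E : ((n * n.+1)%:R - (m * m.+1)%:R) * pint (L n * 'X^m) =
      - (m * m.-1)%:R * pint (L n * 'X^(m.-2)).
    rewrite mulrBl E.
    have -> : ((1 - 'X^2) * ('X^m)^`())^`() =
        (m * m.-1)%:R *: 'X^(m.-2) - (m * m.+1)%:R *: 'X^m :> {poly R}.
      case: m {IH mn E} => [|[|m]].
      - by rewrite expr0 -polyC1 derivC mulr0 -polyC0 derivC !mul0n !scale0r subr0.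
      - rewrite expr1 derivX mulr1 derivB derivXn -polyC1 derivC muln0 scale0r /= expr1.
        by rewrite -mul_polyC polyC_natr; ring.
      - rewrite derivXn /= derivM derivMn derivXn derivB -polyC1 derivC derivXn /=.
        by rewrite -!mul_polyC !polyC_natr expr1 !exprS expr0; ring.
    rewrite mulrBr pintB -!scalerAr !pintZ; set a := pint _; set b := pint _; lra.
  have c0 : (n * n.+1)%:R - (m * m.+1)%:R != 0 :> R.
    by rewrite subr_eq0 eqr_nat; apply/eqP; nia.
  apply: (mulfI c0); rewrite E mulr0.
  case: m {E c0} IH mn => [|[|m]] IH mn; rewrite ?mul0n ?muln0 ?oppr0 ?mul0r//=.
  by rewrite IH ?mulr0//; lia.
move=> sq; rewrite -[q](coefK q) poly_def mulr_sumr pint_sum big1// => i _.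
by rewrite -scalerAr pintZ mono ?mulr0// (leq_trans (ltn_ord i)).
Qed.

(** The derivative of [x L_n^2] has integral 2; by [x L_n' = L_(n-1)' + n L_n] and orthogonality its
    cross term is a multiple of the squared norm. *)
Lemma pint_legendre_sqr n : (2 * n + 1)%:R * pint (L n ^+ 2) = 2.
Proof.
have := pint_deriv ('X * L n ^+ 2).
have e2 : (-1) ^+ n * (-1) ^+ n = 1 :> R by rewrite -expr2 sqrr_sign.
rewrite !hornerM !hornerX horner_legendre1 horner_legendreN1 e2 !mulr1.
rewrite derivM derivX mul1r expr2 derivM -expr2.
have lo : pint (L n * ('X * (L n)^`())) = n%:R * pint (L n ^+ 2).
  case: (n) => [|k]; first by rewrite legendre0 -polyC1 derivC !mulr0 pint0 mul0r.
  have [_ ->] := legendre_deriv_rec k.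
  rewrite mulrDr pintD pint_legendre_lower; last first.
    exact: leqW (size_legendre_deriv _).
  rewrite add0r -polyC_natr mul_polyC -scalerAr pintZ expr2; congr (_ * _).
rewrite pintD (_ : 'X * _ = 2 *: (L n * ('X * (L n)^`()))); last first.
  by rewrite -mul_polyC polyC_natr; ring.
by rewrite pintZ lo natrD natrM; set x := pint _; lra.
Qed.

(** After integration by parts the volume term pairs [L n] with its second derivative, of lower
    degree, so only the end values remain. *)
Lemma pint_legendre_deriv_sqr n : pint ((L n)^`() ^+ 2) = (n * n.+1)%:R.
Proof.
rewrite expr2 pint_parts pint_legendre_lower; last first.
  by rewrite (leq_trans (size_poly _ _))// (leq_trans (leq_pred _))// size_legendre_deriv.
rewrite horner_legendre1 horner_legendreN1 subr0 mul1r.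
have := horner_legendre_deriv1 n; have := horner_legendre_derivN1 n.
set a := _.[-1]; set b := _.[1] => Ha Hb.
have e2 : (-1) ^+ n * (-1) ^+ n = 1 :> R by rewrite -expr2 sqrr_sign.
have : (-1) ^+ n * (2 * a) = - (n * n.+1)%:R by rewrite Ha mulrCA e2 mulr1.
by set e := _ ^+ n; lra.
Qed.

Lemma legendre_expansion n q : (size q <= n.+1)%N ->
  exists a r, [/\ (size r <= n)%N, q = r + a *: L n &
                  pint (q ^+ 2) = pint (r ^+ 2) + a ^+ 2 * pint (L n ^+ 2)].
Proof.
move=> sq; pose a := q`_n / (L n)`_n; exists a, (q - a *: L n).
have Ln : (L n)`_n != 0.
  by have := legendre_neq0 n; rewrite -lead_coef_eq0 lead_coefE size_legendre.
have sr : (size (q - a *: L n)%R <= n)%N.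
  apply/leq_sizeP => j nj; rewrite coefB coefZ; case: ltngtP nj => // [nj _|<- _].
    by rewrite !nth_default ?mulr0 ?subrr// ?size_legendre// (leq_trans sq).
  by rewrite /a mulfVK// subrr.
split => //; first by rewrite subrK.
rewrite -{1}(subrK (a *: L n) q) sqrrD !pintD exprZn pintZ -addrA; congr (_ + _).
by rewrite -scalerAr mulrC pintZ pint_legendre_lower// mulr0 addr0 add0r.
Qed.

(* Markov's inequality in the mean, by adding one Legendre mode at a time. *)
Lemma pint_deriv_inverse n q : (size q <= n.+1)%N ->
  pint (q^`() ^+ 2) <= n.+1%:R ^+ 4 * pint (q ^+ 2).
Proof.
have sq0 (r : {poly R}) : 0 <= pint (r ^+ 2).
  by apply: pint_ge0 => x _; rewrite horner_exp sqr_ge0.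
elim: n q => [|n IH] q sq.
  rewrite (size1_polyC sq) derivC expr0n /= pint0 expr1n mul1r; exact: sq0.
have [a [r [sr -> ->]]] := legendre_expansion sq.
rewrite derivD derivZ sqrrD exprZn !pintD pintZ pint_legendre_deriv_sqr.
have X0 := sq0 r; have Y0 := sq0 (r^`()); have IHr := IH _ sr.
have CS := pint_CS (r^`()) (L n.+1)^`(); rewrite pint_legendre_deriv_sqr in CS.
rewrite -scalerAr pintZ; set b := pint (_ * _) in CS *.
have := pint_legendre_sqr n.+1; set N2 := pint (L n.+1 ^+ 2) => HN.
have N0 : 0 <= N2 by exact: sq0.
set X := pint (r ^+ 2) in X0 IHr *; set Y := pint (r^`() ^+ 2) in Y0 CS IHr *.
set m : R := n.+1%:R in IHr *.
have m1 : 1 <= m by rewrite /m ler1n.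
have -> : n.+2%:R = m + 1 :> R by rewrite /m -natr1.
have DE : (n.+1 * n.+2)%:R = m * (m + 1) :> R by rewrite natrM /m -[n.+2%:R]natr1.
rewrite DE in CS *.
have HN' : (2 * m + 1) * N2 = 2.
  by rewrite -[RHS]HN natrD natrM.
have [d1 d2] : 0 < m ^+ 4 /\ 0 < m * (m + 1) * (2 * m + 1) / 2.
  split; first by rewrite exprn_gt0//; lra.
  by rewrite divr_gt0// !mulr_gt0//; lra.
set E := m * (m + 1) * (2 * m + 1) / 2 in d2.
(* Young: 2ab <= (E/K) Y + a^2 D K/E with K = m^4, D = m(m+1), E = D/N2 *)
have yng : 2 * a * b <= E / m ^+ 4 * Y + a ^+ 2 * (m * (m + 1)) * (m ^+ 4 / E).
  have [Y00|Yp] := eqVneq Y 0.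
    have b0 : b = 0.
      apply/eqP; rewrite -sqrf_eq0 eq_le sqr_ge0 andbT.
      by rewrite (le_trans CS)// Y00 mul0r.
    have mm : 0 <= m * (m + 1) by rewrite mulr_ge0//; lra.
    rewrite b0 Y00 !mulr0 add0r.
    exact: mulr_ge0 (mulr_ge0 (sqr_ge0 _) mm) (ltW (divr_gt0 d1 d2)).
  have Y1 : 0 < Y by rewrite lt_neqAle eq_sym Yp.
  have s0 : 0 < E / m ^+ 4 by rewrite divr_gt0.
  set s := E / m ^+ 4 in s0 *.
  have -> : m ^+ 4 / E = s^-1 by rewrite /s (invf_div E).
  have h : a ^+ 2 * b ^+ 2 / Y <= a ^+ 2 * (m * (m + 1)).
    rewrite -mulrA ler_wpM2l ?sqr_ge0// ler_pdivrMr//.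
    by rewrite mulrC.
  have h2 : a ^+ 2 * b ^+ 2 / Y / s <= a ^+ 2 * (m * (m + 1)) / s.
    by rewrite ler_wpM2r// invr_ge0 ltW.
  apply: (@le_trans _ _ (s * Y + a ^+ 2 * b ^+ 2 / Y / s)); last by rewrite lerD2l.
  rewrite -subr_ge0 (_ : _ - _ = (s * Y - a * b) ^+ 2 / (s * Y)).
    by rewrite divr_ge0 ?sqr_ge0// mulr_ge0 ?ltW.
  by field; rewrite Yp gt_eqF.
(* The Young parameter makes both the lower part and the new mode grow by the same factor
   [m ^+ 4 + E]; this inequality closes the induction. *)
have KE : m ^+ 4 + E <= (m + 1) ^+ 4 by rewrite /E; nra.
have EN : E * N2 = m * (m + 1).
  clear yng KE.
  by rewrite /E -[RHS]mulr1 -[X in _ = _ * X](@divff _ 2) ?pnatr_eq0// -{3}HN'; ring.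
have h1 : (1 + E / m ^+ 4) * Y <= (m ^+ 4 + E) * X.
  have : (1 + E / m ^+ 4) * Y <= (1 + E / m ^+ 4) * (m ^+ 4 * X).
    by rewrite ler_wpM2l// addr_ge0 ?ler01// ltW// divr_gt0.
  move=> h; apply: (le_trans h); rewrite le_eqVlt; apply/orP; left; apply/eqP.
  by field; rewrite gt_eqF//; lra.
have h2 : a ^+ 2 * (m * (m + 1)) * (1 + m ^+ 4 / E) = (m ^+ 4 + E) * (a ^+ 2 * N2).
  rewrite -EN; field; rewrite gt_eqF//.
have h3 : (m ^+ 4 + E) * (X + a ^+ 2 * N2) <= (m + 1) ^+ 4 * (X + a ^+ 2 * N2).
  by rewrite ler_wpM2r// addr_ge0// mulr_ge0 ?sqr_ge0.
apply: le_trans h3; rewrite [X in _ <= X]mulrDr -h2; clearbody E.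
move: (E / m ^+ 4) (m ^+ 4 / E) h1 yng => u w h1 yng.
move: (_ * X) h1 => z h1; move: (a ^+ 2 * _) yng => c yng.
lra.
Qed.

End Legendre.

(** * The Gauss-Legendre-Lobatto rule *)

Section Lobatto.
Variable R : realType.
Implicit Types (q r f : {poly R}).
Local Notation L := (legendre R).

(* [s] collects the sign changes of [q]: multiplying by [\prod_(a <- s) ('X - a)]
   makes every zero in the open interval of even order. *)
Lemma sign_changes q : q != 0 -> exists s : seq R,
  [/\ uniq s, all (fun x : R => -1 < x < 1) s, all (root q) s &
   (forall x : R, -1 < x < 1 -> 0 <= (q * \prod_(a <- s) ('X - a%:P)).[x]) \/
   (forall x : R, -1 < x < 1 -> (q * \prod_(a <- s) ('X - a%:P)).[x] <= 0)].
Proof.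
elim: {q}_.+1 {-2}q (ltnSn (size q)) => // n IH q sq q0.
have [[a [ha ra]]|noroot] := pselect (exists a, -1 < a < 1 /\ root q a).
  have [q1 Eq] := factor_theorem q a ra.
  have q10 : q1 != 0 by apply: contraNneq q0; rewrite Eq => ->; rewrite mul0r.
  have sq1 : (size q1 < n)%N by move: sq; rewrite Eq size_Mmonic ?monicXsubC// size_XsubC addn2.
  have [s [us hs rs sgs]] := IH q1 sq1 q10.
  have [as_|nas] := boolP (a \in s).
    exists (rem a s); split.
    - exact: rem_uniq.
    - by apply/allP => x /mem_rem /(allP hs).
    - by apply/allP => x /mem_rem /(allP rs); rewrite Eq rootM => ->.
    have E : q * \prod_(b <- rem a s) ('X - b%:P) = q1 * \prod_(b <- s) ('X - b%:P).
      by rewrite (perm_big _ (perm_to_rem as_)) big_cons Eq mulrA.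
    by rewrite E.
  exists (a :: s); split.
  - by rewrite /= nas us.
  - by rewrite /= ha hs.
  - by rewrite /= ra /=; apply/allP => x /(allP rs); rewrite Eq rootM => ->.
  have E x : (q * \prod_(b <- a :: s) ('X - b%:P)).[x] =
      (x - a) ^+ 2 * (q1 * \prod_(b <- s) ('X - b%:P)).[x].
    by rewrite big_cons Eq !hornerM hornerXsubC; ring.
  case: sgs => sgs; [left|right] => x /sgs H; rewrite E.
    by rewrite mulr_ge0 ?sqr_ge0.
  by rewrite mulr_ge0_le0 ?sqr_ge0.
exists [::]; split=> //.
rewrite big_nil mulr1.
have [neg|nneg] := pselect (exists x, -1 < x < 1 /\ q.[x] < 0); last first.
  by left=> x hx; rewrite leNgt; apply/negP => h; apply: nneg; exists x.
right=> y hy; rewrite leNgt; apply/negP => qy.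
have [x [hx qx]] := neg.
apply: noroot; have [xy|yx] := leP x y.
  have [|z hz rz] := @poly_ivt _ q x y xy; first by rewrite !ltW.
  by exists z; split=> //; lra.
have [|z hz rz] := @poly_ivt _ (- q) y x (ltW yx); first by rewrite !hornerN oppr_le0 oppr_ge0 !ltW.
by exists z; rewrite rootN in rz; split=> //; lra.
Qed.

Definition lagrange_poly (s : seq R) (a : R) : {poly R} :=
  \prod_(b <- s | b != a) ((a - b)^-1 *: ('X - b%:P)).

Lemma size_lagrange_poly s a : uniq s -> a \in s -> (size (lagrange_poly s a) <= size s)%N.
Proof.
move=> us as_; rewrite /lagrange_poly (perm_big _ (perm_to_rem as_)) big_cons eqxx /=.
rewrite big_seq_cond (eq_bigl (fun b => b \in rem a s)); last first.
  move=> b; case bE : (b \in rem a s) => //=; apply: contraTneq bE => ->.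
  by rewrite mem_rem_uniqF.
rewrite -big_seq -[X in (_ <= X)%N](prednK (_ : 0 < size s)%N); last by case: (s) as_.
rewrite -(size_rem as_); elim: (rem a s) => [|b t IH]; first by rewrite big_nil size_poly1.
rewrite big_cons -scalerAl (leq_trans (size_scale_leq _ _))//.
by rewrite (leq_trans (size_polyMleq _ _))// size_XsubC.
Qed.

Lemma lagrange_polyE s a b : b \in s -> (lagrange_poly s a).[b] = (a == b)%:R.
Proof.
move=> bs; rewrite /lagrange_poly horner_prod; have [<-|ab] := eqVneq.
  rewrite big1 ?mulr1n// => c ca; rewrite hornerZ hornerXsubC mulVf//.
  by rewrite subr_eq0 eq_sym.
rewrite (perm_big _ (perm_to_rem bs)) big_cons eq_sym ab /=.
by rewrite hornerZ hornerXsubC subrr mulr0 mul0r.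
Qed.

Lemma lagrange_interpolation s q : uniq s -> (size q <= size s)%N ->
  q = \sum_(a <- s) q.[a] *: lagrange_poly s a.
Proof.
move=> us sq; apply/eqP; rewrite -subr_eq0; apply/negPn/negP => n0.
set d := q - _ in n0.
suff : (size s < size d)%N.
  apply/negP; rewrite -leqNgt (leq_trans (size_polyD _ _))// geq_max sq size_polyN.
  rewrite big_seq (leq_trans (size_sum _ _ _))//.
  apply/bigmax_leqP_seq => a as_ _.
  by rewrite (leq_trans (size_scale_leq _ _))// size_lagrange_poly.
apply: max_poly_roots => //; apply/allP => b bs; apply/rootP.
rewrite /d hornerD hornerN horner_sum (bigD1_seq b)//= hornerZ lagrange_polyE// eqxx mulr1.
rewrite big1_seq ?addr0 ?subrr// => a /andP [ab _].
by rewrite hornerZ lagrange_polyE// (negbTE ab) mulr0.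
Qed.

Lemma gll_opp p (x : R) : gll p (- x) -> gll p x.
Proof.
move=> [h1 h2]; split; first by move: h1; lra.
have := congr1 deriv (legendre_refl R p); rewrite deriv_comp derivN derivX mulrN1.
rewrite derivZ => /(congr1 (horner^~ x)).
rewrite /= hornerN horner_comp hornerN hornerX hornerZ => E.
move/eqP: h2; rewrite sqrrN mulf_eq0 => /orP [/eqP -> |/eqP h2]; first by rewrite mul0r.
move/eqP: E; rewrite h2 oppr0 eq_sym mulf_eq0 signr_eq0 /= => /eqP ->.
by rewrite mulr0.
Qed.

(** Exactness stops at degree [2 p - 1], just short of squares of polynomials of degree [p];
    [lob_lower] and [lob_upper] supply the two-sided replacement. [lob_end] is the source of the
    gain of [p ^ 2] on facets, and [lob_opp] makes the rule invariant under reflections of the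
    cube. *)
Record lobatto_rule (p : nat) (s : seq R) (w : R -> R) : Prop := LobattoRule {
  lob_uniq : uniq s;
  lob_size : size s = p.+1;
  lob_mem : forall x, gll p x <-> x \in s;
  lob_ge0 : forall x, 0 <= w x;
  lob_opp : forall x, w (- x) = w x;
  lob_end : w 1 = 2 / (p * p.+1)%:R;
  lob_exact : forall f, (size f <= 2 * p)%N -> pint f = \sum_(a <- s) w a * f.[a];
  lob_lower : forall q, (size q <= p.+1)%N ->
    pint (q ^+ 2) <= \sum_(a <- s) w a * q.[a] ^+ 2;
  lob_upper : forall q, (size q <= p.+1)%N ->
    \sum_(a <- s) w a * q.[a] ^+ 2 <= 3 * pint (q ^+ 2) }.

Let G p : {poly R} := (1 - 'X ^+ 2) * (L p)^`().

Lemma legendre_deriv_neq0 p : (0 < p)%N -> (L p)^`() != 0.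
Proof.
move=> p0; apply/eqP => E; have := horner_legendre_deriv1 R p.
by rewrite E horner0 mulr0 => /eqP; rewrite eq_sym pnatr_eq0 muln_eq0; case: p p0 {E}.
Qed.

Lemma one_sub_sqrX_neq0 : 1 - 'X ^+ 2 != 0 :> {poly R}.
Proof.
apply/eqP => /(congr1 (horner^~ 0)); rewrite /= !hornerE /= ?expr0n /= ?mulr0 subr0.
by move/eqP; rewrite oner_eq0.
Qed.

(** With an antiderivative of [r] as test function the integral becomes a multiple of the pairing of
    [L p] with a polynomial of degree below [p]. *)
Lemma lobatto_orthogonal p r : (0 < p)%N -> (size r < p)%N -> pint (G p * r) = 0.
Proof.
move=> p0 sr; rewrite -(antiderivK r) /G pint_legendre_deriv pint_legendre_lower ?mulr0//.
exact: leq_trans (size_antideriv _) sr.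
Qed.

Lemma lobatto_nodes p : (0 < p)%N -> exists s : seq R,
  [/\ uniq s, size s = p.-1, all (fun x : R => -1 < x < 1) s & all (root (L p)^`()) s].
Proof.
move=> p0; have d0 := legendre_deriv_neq0 p0.
have [s [us hs rs sg]] := sign_changes d0.
have le : (size s <= p.-1)%N.
  rewrite -ltnS prednK//; apply: (leq_trans (max_poly_roots d0 rs us)).
  exact: size_legendre_deriv.
exists s; split=> //; apply/eqP; rewrite eqn_leq le /= leqNgt; apply/negP => lt.
set S := \prod_(a <- s) ('X - a%:P) in sg.
have sS : size S = (size s).+1 by rewrite size_prod_XsubC.
have S0 : S != 0 by rewrite -size_poly_eq0 sS.
have I0 : pint (G p * S) = 0 by apply: lobatto_orthogonal => //; rewrite sS; lia.
have GS0 : G p * S != 0 by rewrite !mulf_neq0 ?one_sub_sqrX_neq0.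
have x2 (x : R) : -1 < x < 1 -> 0 <= 1 - x ^+ 2 by move=> h; nra.
have E x : (G p * S).[x] = (1 - x ^+ 2) * ((L p)^`() * S).[x].
  by rewrite /G -mulrA hornerM !hornerE.
case: sg => sg.
  move/eqP: GS0; apply; apply: pint_eq0 => // x hx.
  by rewrite E mulr_ge0 ?sg ?x2.
move/eqP: GS0; apply; apply/eqP; rewrite -oppr_eq0; apply/eqP/pint_eq0.
  by move=> x hx; rewrite hornerN oppr_ge0 E mulr_ge0_le0 ?sg ?x2.
by rewrite pintN I0 oppr0.
Qed.

(* [L_p^2 + (1 - x^2) L_p'^2 / p^2] agrees with [L_p^2] at the Lobatto nodes, and its
   degree drops below [2p] because the leading terms cancel. *)
Lemma size_lobatto_defect p : (0 < p)%N ->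
  (size (L p ^+ 2 + (p%:R ^- 2) *: (G p * (L p)^`()))%R <= 2 * p)%N.
Proof.
case: p => // n _; have n0 : n.+1%:R != 0 :> R by rewrite pnatr_eq0.
have [_ Q] := legendre_deriv_rec R n; set f := _ + _.
have -> : f = n.+1%:R^-1 *: (L n * (L n.+1)^`() - L n.+1 * (L n)^`()).
  have E : G n.+1 * (L n.+1)^`() =
      n.+1%:R *: (L n * (L n.+1)^`() - L n.+1 * (L n)^`() - n.+1%:R *: (L n.+1 ^+ 2)).
    rewrite /G legendre_deriv_lower.
    have -> : n.+1%:R * (L n - 'X * L n.+1) * (L n.+1)^`() =
      n.+1%:R * (L n * (L n.+1)^`() - L n.+1 * ('X * (L n.+1)^`())) :> {poly R} by ring.
    by rewrite Q -!mul_polyC !polyC_natr; ring.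
  rewrite /f E scalerA (_ : _ ^- 2 * _ = n.+1%:R^-1); last by field.
  by rewrite scalerBr scalerA mulVf// scale1r addrC subrK.
rewrite (leq_trans (size_scale_leq _ _))// (leq_trans (size_polyD _ _))//.
rewrite size_polyN geq_max; apply/andP; split.
  rewrite (leq_trans (size_polyMleq _ _))// size_legendre.
  by have := size_legendre_deriv R n.+1; clear; move: (size _) => m; lia.
rewrite (leq_trans (size_polyMleq _ _))// size_legendre.
by have := size_legendre_deriv R n; clear; move: (size _) => m; lia.
Qed.

Lemma lobatto_ruleP p : (0 < p)%N -> exists s w, lobatto_rule p s w.
Proof.
move=> p0; have [t [ut st ht rt]] := lobatto_nodes p0.
have t1 : 1 \notin t by apply/negP => /(allP ht); rewrite ltxx andbF.
have tN1 : -1 \notin t by apply/negP => /(allP ht); rewrite ltxx.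
have N11 : (-1 : R) != 1 by rewrite -subr_eq0 -opprD oppr_eq0 (_ : 1 + 1 = 2%:R) ?pnatr_eq0.
pose s := [:: -1, 1 & t].
have us : uniq s by rewrite /s /= inE negb_or N11 tN1 t1 ut.
have ss : size s = p.+1 by rewrite /s /= st prednK.
have G0 : G p != 0 by rewrite mulf_neq0 ?one_sub_sqrX_neq0 ?legendre_deriv_neq0.
have GE x : (G p).[x] = (1 - x ^+ 2) * ((L p)^`()).[x] by rewrite hornerM !hornerE.
have rs : all (root (G p)) s.
  rewrite /s /= !rootE !GE sqrrN expr1n subrr !mul0r eqxx /=.
  by apply/allP => x /(allP rt); rewrite !rootE GE => /eqP ->; rewrite mulr0.
have sG : (size (G p) <= p.+2)%N.
  rewrite (leq_trans (size_polyMleq _ _))//.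
  have := size_legendre_deriv R p.
  have : (size (1 - 'X^2 : {poly R})%R <= 3)%N.
    by rewrite (leq_trans (size_polyD _ _))// size_polyN size_poly1 size_polyXn.
  by move: p0; clear; move: (size _) (size _) => m k; lia.
have mem x : gll p x <-> x \in s.
  split=> [[hx gx]|xs].
    apply/negPn/negP => nx.
    have rx : all (root (G p)) (x :: s).
      by apply/andP; split=> //; rewrite rootE GE gx eqxx.
    have ux : uniq (x :: s) by apply/andP.
    have := max_poly_roots G0 rx ux.
    have -> : size (x :: s) = p.+2 by rewrite -ss.
    by apply/negP; rewrite -leqNgt.
  split; last by rewrite -GE; apply/eqP; exact: (allP rs).
  move: xs; rewrite /s !inE => /or3P [/eqP ->|/eqP ->|/(allP ht)]; lra.
pose w (x : R) := if x \in s then pint (lagrange_poly s x) else 0.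
have interp q : (size q <= p.+1)%N -> pint q = \sum_(a <- s) w a * q.[a].
  move=> sq; rewrite {1}(lagrange_interpolation us (_ : size q <= size s)%N) ?ss//.
  rewrite pint_sum big_seq [RHS]big_seq; apply: eq_bigr => a as_.
  by rewrite pintZ /w as_ mulrC.
(* Divide by [G p]: the quotient has degree below [p - 1], so it contributes nothing to the
   integral; nor does it to the sum, as [G p] vanishes at the nodes. The remainder is interpolated
   exactly. *)
have exact f : (size f <= 2 * p)%N -> pint f = \sum_(a <- s) w a * f.[a].
  move=> sf.
  have [r [g [sr sg ->]]] : exists r g : {poly R}, [/\ (size r < p)%N, (size g <= p.+1)%N & f = G p * r + g].
    exists (f %/ G p), (f %% G p); split; last by rewrite mulrC -divp_eq.
    - rewrite size_divp//.
      have : (p.+1 < size (G p))%N by rewrite -ss max_poly_roots.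
      by move: sf p0; clear; move: (size f) (size (G p)) => m k; lia.
    - by rewrite -ltnS (leq_trans _ sG)// ltn_modpN0.
  rewrite pintD lobatto_orthogonal// add0r interp// big_seq [RHS]big_seq.
  apply: eq_bigr => a as_; congr (_ * _).
  by rewrite hornerD hornerM (eqP (allP rs a as_)) mul0r add0r.
have wopp x : w (- x) = w x.
  have sopp y : (- y \in s) -> y \in s by move=> /mem /gll_opp /mem.
  rewrite /w; case: ifPn => [xs|nx]; last first.
    by case: ifPn => // xs; rewrite sopp ?opprK// in nx.
  have xs' := sopp _ xs; rewrite xs'.
  have sl : (size (lagrange_poly s x) <= p.+1)%N by rewrite -ss size_lagrange_poly.
  rewrite -[RHS]pint_refl [RHS]interp.
    rewrite (bigD1_seq (- x))//= horner_comp hornerN hornerX opprK lagrange_polyE// eqxx mulr1.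
    rewrite big1_seq ?addr0 => [|a /andP [ax as_]]; first by rewrite /w xs.
    rewrite horner_comp hornerN hornerX lagrange_polyE; last by apply: sopp; rewrite opprK.
    by rewrite -eqr_oppLR eq_sym (negbTE ax) mulr0.
  rewrite (leq_trans (size_comp_poly_leq _ _))// size_polyN size_polyX muln1.
  by case: (size _) sl.
have wend : w 1 = 2 / (p * p.+1)%:R.
  have := exact ((1 + 'X) * (L p)^`()).
  have sz : (size ((1 + 'X) * (L p)^`())%R <= 2 * p)%N.
    rewrite (leq_trans (size_polyMleq _ _))//.
    have := size_legendre_deriv R p.
    have : (size (1 + 'X : {poly R})%R <= 2)%N.
      by rewrite (leq_trans (size_polyD _ _))// size_poly1 size_polyX.
    by move: p0; clear; move: (size _) (size _) => m k; lia.
  move/(_ sz); rewrite mulrC pint_parts horner_legendre1 horner_legendreN1.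
  rewrite derivD derivX -polyC1 derivC add0r mulr1 !hornerE.
  have -> : pint (L p) = 0 by rewrite -(mulr1 (L p)) pint_legendre_lower// size_poly1.
  rewrite /s !big_cons big1_seq => [|a /andP [_ /(allP rt) /eqP ra]]; last first.
    by rewrite hornerM ra mul0r mulr0.
  rewrite !hornerM !hornerD !hornerC !hornerX.
  have := horner_legendre_deriv1 R p.
  have pn : (p * p.+1)%:R != 0 :> R by rewrite pnatr_eq0 muln_eq0 negb_or -!lt0n p0.
  move=> Hd E; apply: (mulIf pn); rewrite mulfVK// -Hd.
  by move: E; move: (w 1) (w (-1)) (_.[1]) (_.[-1]) => u v d d'; lra.
have wge0 x : 0 <= w x.
  have [xs|nx] := boolP (x \in s); last by rewrite /w (negbTE nx).
  move: (xs); rewrite /s !inE => /or3P [/eqP ->|/eqP ->|xt].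
  - by rewrite wopp wend divr_ge0.
  - by rewrite wend divr_ge0.
  (* For an interior node, [(1 - x^2) S^2] is non-negative on the interval, lies within the degree
     of exactness, and is non-zero at no node other than the given one. *)
  pose S := \prod_(b <- rem x t) ('X - b%:P).
  pose f := (1 - 'X ^+ 2) * S ^+ 2.
  have sf : (size f <= 2 * p)%N.
    have sS : size S = p.-1 by rewrite size_prod_XsubC size_rem// st; case: (t) xt st => //= ? ? _ <-.
    have : (size (S ^+ 2)%R <= (size S + size S).-1)%N by rewrite expr2 size_polyMleq.
    have : (size (1 - 'X^2 : {poly R})%R <= 3)%N.
      by rewrite (leq_trans (size_polyD _ _))// size_polyN size_poly1 size_polyXn.
    rewrite /f => h1 h2; rewrite (leq_trans (size_polyMleq _ _))//.
    have : (0 < p.-1)%N by rewrite -st; case: (t) xt.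
    by move: h1 h2; rewrite sS; clear; move: (size _) (size _) => m k; lia.
  have fE y : f.[y] = (1 - y ^+ 2) * S.[y] ^+ 2.
    by rewrite /f hornerM horner_exp; congr (_ * _); rewrite !hornerE.
  have fge : 0 <= pint f.
    by apply: pint_ge0 => y hy; rewrite fE mulr_ge0 ?sqr_ge0//; nra.
  have Sx : S.[x] != 0.
    rewrite -rootE /S root_prod_XsubC; apply/negP => h.
    by have := mem_rem_uniqF x ut; rewrite h.
  have fx : 0 < f.[x].
    have := allP ht x xt => hx.
    rewrite fE mulr_gt0//; first by nra.
    by rewrite lt_neqAle sqr_ge0 eq_sym sqrf_eq0 Sx.
  move: fge; rewrite exact// (bigD1_seq x)//= big1_seq ?addr0 ?pmulr_lge0//.
  move=> a /andP [ax]; rewrite /s !inE => /or3P [/eqP ->|/eqP ->|at_].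
  - by rewrite fE sqrrN expr1n subrr mul0r mulr0.
  - by rewrite fE expr1n subrr mul0r mulr0.
  - rewrite fE (_ : S.[a] = 0) ?expr0n ?mulr0//.
    by apply/eqP; rewrite -rootE /S root_prod_XsubC mem_rem_uniq// inE /= ax.
(* Split off the top mode, [q = r + a L_p]. The rule is exact on [r^2] and on [r L_p]; on [L_p^2] it
   returns the integral of the corrected polynomial [f], which is [2 + 1/p] times that of [L_p^2], a
   factor between 1 and 3. *)
have eqv q : (size q <= p.+1)%N -> pint (q ^+ 2) <= \sum_(a <- s) w a * q.[a] ^+ 2 <= 3 * pint (q ^+ 2).
  move=> sq; have [a [r [sr Eq ->]]] := legendre_expansion sq.
  have N0 : 0 <= pint (L p ^+ 2) by apply: pint_ge0 => x _; rewrite horner_exp sqr_ge0.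
  have r0 : 0 <= pint (r ^+ 2) by apply: pint_ge0 => x _; rewrite horner_exp sqr_ge0.
  have p0' : p%:R != 0 :> R by rewrite pnatr_eq0 -lt0n.
  pose f := L p ^+ 2 + (p%:R ^- 2) *: (G p * (L p)^`()).
  have sf : (size f <= 2 * p)%N.
    exact: size_lobatto_defect.
  have fE x : x \in s -> f.[x] = (L p).[x] ^+ 2.
    move=> xs; rewrite /f hornerD hornerZ [(G p * _).[x]]hornerM (eqP (allP rs x xs)) mul0r mulr0 addr0.
    by rewrite horner_exp.
  have If : pint f = (2 + p%:R^-1) * pint (L p ^+ 2).
    rewrite /f pintD pintZ /G pint_legendre_deriv -expr2.
    by rewrite natrM -[p.+1%:R]natr1; field.
  have SL : \sum_(x <- s) w x * (L p).[x] ^+ 2 = (2 + p%:R^-1) * pint (L p ^+ 2).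
    rewrite -If exact// big_seq [RHS]big_seq; apply: eq_bigr => x xs.
    by rewrite fE.
  have Sr : \sum_(x <- s) w x * r.[x] ^+ 2 = pint (r ^+ 2).
    rewrite exact; first by apply: eq_bigr => x _; rewrite horner_exp.
    rewrite expr2 (leq_trans (size_polyMleq _ _))//.
    by move: sr; clear; move: (size _) => m; lia.
  have SrL : \sum_(x <- s) w x * (r.[x] * (L p).[x]) = 0.
    rewrite -[RHS](pint_legendre_lower sr) exact; last first.
      rewrite (leq_trans (size_polyMleq _ _))// size_legendre.
      by move: sr; clear; move: (size _) => m; lia.
    by apply: eq_bigr => x _; rewrite hornerM [r.[x] * _]mulrC.
  have -> : \sum_(x <- s) w x * q.[x] ^+ 2 =
      pint (r ^+ 2) + a ^+ 2 * ((2 + p%:R^-1) * pint (L p ^+ 2)).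
    transitivity (\sum_(x <- s) (w x * r.[x] ^+ 2 + 2 * a * (w x * (r.[x] * (L p).[x]))
        + a ^+ 2 * (w x * (L p).[x] ^+ 2))).
      by apply: eq_bigr => x _; rewrite Eq hornerD hornerZ; ring.
    by rewrite !big_split /= -!mulr_sumr Sr SrL SL mulr0 addr0.
  have p1 : p%:R^-1 <= 1 :> R by rewrite invf_le1 ?ltr0n// ler1n.
  have p2 : 0 <= p%:R^-1 :> R by rewrite invr_ge0.
  have := mulr_ge0 (sqr_ge0 a) N0; set z := _ * pint (L p ^+ 2) => z0.
  have -> : a ^+ 2 * ((2 + p%:R^-1) * pint (L p ^+ 2)) = (2 + p%:R^-1) * z by rewrite /z; ring.
  apply/andP; split; nra.
exists s, w; split=> //.
- by move=> q /eqv /andP [].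
- by move=> q /eqv /andP [].
Qed.

End Lobatto.

(** * Tensor-product polynomials *)

Section TensorIntegral.
Variables (R : realType) (d : nat).
Local Notation pt := 'rV[R]_d.
Implicit Types (f g : pt -> R) (x : pt).

Lemma cint_ext n (f g : seq R -> R) :
  (forall y, size y = n -> (forall i, -1 <= nth 0 y i <= 1) -> f y = g y) ->
  cint n f = cint n g.
Proof.
elim: n f g => [|n IH] f g H /=.
  by apply: H => // i; rewrite nth_nil; apply/andP; split; lra.
apply: eq_Rintegral => t; rewrite inE /= in_itv /= => ht.
by apply: IH => y sy hy; apply: H => [|[|i]]; rewrite /= ?sy.
Qed.

(** Integrating the trailing variables of a sum of monomials leaves a polynomial in the first one,
    so the iterated integral is computed by induction. Exponents are functions on [nat] so that
    dropping a variable is a shift. *)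
Lemma cint_monomials n (s : seq (R * (nat -> nat))) :
  cint n (fun y => \sum_(t <- s) t.1 * \prod_(j < n) nth 0 y j ^+ t.2 j) =
  \sum_(t <- s) t.1 * \prod_(j < n) pint ('X^(t.2 j) : {poly R}).
Proof.
elim: n s => [|n IH] s /=.
  by apply: eq_bigr => t _; rewrite !big_ord0.
pose P : {poly R} := \sum_(t <- s) (t.1 * \prod_(j < n) pint 'X^(t.2 j.+1)) *: 'X^(t.2 0%N).
transitivity (pint P).
  apply: eq_Rintegral => t _.
  pose s' := [seq (z.1 * t ^+ z.2 0%N, fun j => z.2 j.+1) | z <- s].
  transitivity (cint n (fun y => \sum_(z <- s') z.1 * \prod_(j < n) nth 0 y j ^+ z.2 j)).
    congr cint; apply/funext => y; rewrite big_map; apply: eq_bigr => z _ /=.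
    by rewrite big_ord_recl /= mulrA.
  rewrite IH big_map /P horner_sum; apply: eq_bigr => z _ /=.
  by rewrite hornerZ hornerXn; ring.
rewrite /P pint_sum; apply: eq_bigr => z _.
by rewrite pintZ big_ord_recl /=; ring.
Qed.

Definition monomial (e : {ffun 'I_d -> nat}) x : R := \prod_i x 0 i ^+ e i.

Local Notation term := (R * {ffun 'I_d -> nat})%type.

(** The bound is strict and separate in each variable, in analogy with [size]. The list of terms may
    have repetitions, so sums are concatenations. *)
Definition tpoly (n : nat) f := exists s : seq (R * {ffun 'I_d -> nat}),
  all (fun t : term => [forall i, t.2 i < n]%N) s /\
  forall x, f x = \sum_(t <- s) t.1 * monomial t.2 x.

Lemma tpoly_ext n f g : f =1 g -> tpoly n f -> tpoly n g.
Proof. by move=> fg [s [hs E]]; exists s; split=> // x; rewrite -fg E. Qed.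

Lemma tpoly0 n : tpoly n (fun=> 0).
Proof. by exists [::]; split=> // x; rewrite big_nil. Qed.

Lemma tpoly_monomial n c (e : {ffun 'I_d -> nat}) : (forall i, e i < n)%N -> tpoly n (fun x => c * monomial e x).
Proof.
by move=> h; exists [:: (c, e)]; rewrite /= andbT; split=> [|x]; [exact/forallP|rewrite big_seq1].
Qed.

Lemma tpolyD n f g : tpoly n f -> tpoly n g -> tpoly n (fun x => f x + g x).
Proof.
move=> [s [hs E]] [t [ht F]]; exists (s ++ t); rewrite all_cat hs ht.
by split=> // x; rewrite big_cat E F.
Qed.

Lemma tpolyZ n c f : tpoly n f -> tpoly n (fun x => c * f x).
Proof.
move=> [s [hs E]]; exists [seq (c * t.1, t.2) | t : term <- s]; split; first by rewrite all_map.
by move=> x; rewrite big_map E mulr_sumr; apply: eq_bigr => t _; rewrite mulrA.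
Qed.

Lemma tpolyN n f : tpoly n f -> tpoly n (fun x => - f x).
Proof. by move/(@tpolyZ _ (-1)); apply: tpoly_ext => x; rewrite mulN1r. Qed.

Lemma tpolyB n f g : tpoly n f -> tpoly n g -> tpoly n (fun x => f x - g x).
Proof. by move=> hf hg; apply: tpolyD => //; exact: tpolyN. Qed.

Lemma tpoly_sum n (I : Type) (r : seq I) (F : I -> pt -> R) :
  (forall i, tpoly n (F i)) -> tpoly n (fun x => \sum_(i <- r) F i x).
Proof.
move=> h; elim: r => [|i r IH].
  by apply: tpoly_ext (tpoly0 n) => x; rewrite big_nil.
by apply: tpoly_ext (tpolyD (h i) IH) => x; rewrite big_cons.
Qed.

Lemma tpolyM n m f g : tpoly n f -> tpoly m g -> tpoly (n + m) (fun x => f x * g x).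
Proof.
move=> [s [hs E]] [t [ht F]].
apply: (@tpoly_ext _ (fun x => \sum_(a <- s) \sum_(b <- t)
    (a.1 * b.1) * monomial [ffun i => a.2 i + b.2 i]%N x)).
  move=> x; rewrite E F mulr_suml; apply: eq_bigr => a _; rewrite mulr_sumr.
  apply: eq_bigr => b _; rewrite mulrACA /monomial -big_split /=; congr (_ * _).
  by apply: eq_bigr => i _; rewrite ffunE exprD.
have [hs' ht'] := (allP hs, allP ht); clear E F.
elim: s hs hs' => [|a s IH] hs hs'.
  by apply: tpoly_ext (tpoly0 _) => x; rewrite big_nil.
move: hs => /= /andP [/forallP ha hs].
apply: (@tpoly_ext _ (fun x => \sum_(b <- t) (a.1 * b.1) *
    monomial [ffun i => a.2 i + b.2 i]%N x + \sum_(a <- s) \sum_(b <- t)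
    (a.1 * b.1) * monomial [ffun i => a.2 i + b.2 i]%N x)).
  by move=> x; rewrite big_cons.
apply: tpolyD; last by apply: IH => // z zs; apply: hs'; rewrite inE zs orbT.
elim: t ht {ht' IH hs'} => [|b t IH] ht.
  by apply: tpoly_ext (tpoly0 _) => x; rewrite big_nil.
move: ht => /= /andP [/forallP hb ht].
apply: tpoly_ext (tpolyD (@tpoly_monomial _ (a.1 * b.1) [ffun i => a.2 i + b.2 i]%N _) (IH ht)).
  by move=> x; rewrite big_cons.
by move=> i; rewrite ffunE; have := ha i; have := hb i; lia.
Qed.

Lemma refint_monomials (s : seq (R * {ffun 'I_d -> nat})) :
  refint (fun x => \sum_(t <- s) t.1 * monomial t.2 x) =
  \sum_(t <- s) t.1 * \prod_i pint ('X^(t.2 i) : {poly R}).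
Proof.
rewrite /refint.
pose s' := [seq (t.1, fun j => oapp (t.2 : 'I_d -> nat) 0%N (insub j)) | t : term <- s].
transitivity (cint d (fun y => \sum_(z <- s') z.1 * \prod_(j < d) nth 0 y j ^+ z.2 j)).
  congr cint; apply/funext => y; rewrite big_map; apply: eq_bigr => t _ /=.
  by congr (_ * _); apply: eq_bigr => i _; rewrite mxE valK.
rewrite cint_monomials big_map; apply: eq_bigr => t _ /=.
by congr (_ * _); apply: eq_bigr => i _; rewrite valK.
Qed.

Definition upd x (j : 'I_d) (t : R) : pt := \row_i (if i == j then t else x 0 i).

Lemma upd_id x j t : (upd x j t) 0 j = t.
Proof. by rewrite mxE eqxx. Qed.

Lemma upd_upd x j t t' : upd (upd x j t) j t' = upd x j t'.
Proof. by apply/rowP => i; rewrite !mxE; case: eqP. Qed.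

Lemma rface_upd x j s : ccube x -> rface (facet j s) (upd x j (sgn R s)).
Proof.
move=> hx; split=> i; rewrite mxE; first case: eqP => // _.
  by case: s; rewrite /sgn; apply/andP; split; lra.
by rewrite /facet; case: eqP.
Qed.

Lemma tpoly_upd n f j t : (0 < n)%N -> tpoly n f -> tpoly n (fun x => f (upd x j t)).
Proof.
move=> n0 [s [hs E]].
exists [seq (z.1 * t ^+ z.2 j, [ffun i => if i == j then 0%N else z.2 i]) | z : term <- s]; split.
  rewrite all_map; apply: sub_all hs => z /forallP h; apply/forallP => i /=.
  by rewrite ffunE; case: eqP.
move=> x; rewrite E big_map; apply: eq_bigr => z _ /=; rewrite -mulrA; congr (_ * _).
rewrite /monomial (bigD1 j)//= [X in _ = _ * X](bigD1 j)//= !mxE !ffunE eqxx expr0 mul1r.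
by congr (_ * _); apply: eq_bigr => i ij; rewrite mxE ffunE (negbTE ij).
Qed.

Lemma pint1 : pint (1 : {poly R}) = 2.
Proof. by have := pint_deriv ('X : {poly R}); rewrite derivX !hornerX => ->; ring. Qed.

(** With [x_j] frozen the integrand is constant along an interval of length 2, whence the factor
    [2^-1]. Facet integrals thereby inherit every quadrature rule of the cube. Agreement of [f] with
    [g] is asked on the facet only, which suits traces taken from a neighbour. *)
Lemma reffaceint_refint n j s f g : (0 < d)%N ->
  (forall x, rface (facet j s) x -> f x = g x) -> tpoly n g ->
  reffaceint j s f = 2^-1 * refint (fun x => g (upd x j (sgn R s))).
Proof.
move=> d0 fg [z [hz E]].
pose z' := [seq (t.1 * sgn R s ^+ t.2 j, [ffun i => if i == j then 0%N else t.2 i]) | t : term <- z].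
have -> : (fun x => g (upd x j (sgn R s))) = (fun x => \sum_(t <- z') t.1 * monomial t.2 x).
  apply/funext => x; rewrite E big_map; apply: eq_bigr => t _ /=; rewrite -mulrA; congr (_ * _).
  rewrite /monomial (bigD1 j)//= [X in _ = _ * X](bigD1 j)//= !mxE !ffunE eqxx expr0 mul1r.
  by congr (_ * _); apply: eq_bigr => i ij; rewrite mxE ffunE (negbTE ij).
rewrite refint_monomials big_map /reffaceint.
pose z2 := [seq (t.1 * sgn R s ^+ t.2 j,
  fun k => oapp (fun k : 'I_d.-1 => t.2 (lift j k)) 0%N (insub k)) | t : term <- z].
transitivity (cint d.-1 (fun y => \sum_(t <- z2) t.1 * \prod_(k < d.-1) nth 0 y k ^+ t.2 k)).
  apply: cint_ext => y sy hy; rewrite fg; last first.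
    split=> i; rewrite mxE.
      case: ifP => _ //; case: eqP => _ //.
      by case: s {fg z' z2} => /=; apply/andP; split; lra.
    by rewrite /facet; case: eqP => // ->; rewrite ltnn.
  rewrite E big_map; apply: eq_bigr => t _ /=; rewrite -mulrA; congr (_ * _).
  rewrite /monomial (bigD1_ord j)//= mxE ltnn eqxx; congr (_ * _).
  apply: eq_bigr => k _; rewrite mxE valK /=; congr (_ ^+ _).
  rewrite -val_eqE /= /bump; case: (leqP j k) => jk.
    by rewrite add1n ltnNge leqW//= gtn_eqF.
  by rewrite add0n jk.
rewrite cint_monomials big_map mulr_sumr; apply: eq_bigr => t _ /=.
rewrite [X in _ = _ * (_ * X)](bigD1_ord j)//= ffunE eqxx expr0 pint1.
rewrite [X in _ = 2^-1 * X]mulrCA [RHS]mulrA mulVf ?pnatr_eq0// mul1r.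
congr (_ * _); apply: eq_bigr => k _; rewrite valK ffunE /=.
by rewrite eq_sym (negbTE (neq_lift _ _)).
Qed.

Section Rules.
Variable I : finType.
Variable x_ : I -> R.
Implicit Types (u v : 'I_d -> I -> R) (a : {ffun 'I_d -> I}).

Definition tpoint a : pt := \row_j x_ (a j).
(** The weights may depend on the direction, so that one-dimensional rules can be exchanged one
    direction at a time. *)
Definition tsum u f : R := \sum_(a : {ffun 'I_d -> I}) (\prod_j u j (a j)) * f (tpoint a).

Lemma refint_tsum (u : I -> R) n f :
  (forall k, (k < n)%N -> pint ('X^k : {poly R}) = \sum_i u i * x_ i ^+ k) ->
  tpoly n f -> refint f = tsum (fun=> u) f.
Proof.
move=> H [s [hs E]].
rewrite (_ : f = fun x => \sum_(t <- s) t.1 * monomial t.2 x); last exact/funext.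
rewrite refint_monomials /tsum.
under [RHS]eq_bigr do rewrite mulr_sumr.
rewrite exchange_big /= big_seq [RHS]big_seq; apply: eq_bigr => t ts.
have ht := forallP (allP hs t ts).
under [RHS]eq_bigr do rewrite mulrCA; rewrite -mulr_sumr; congr (_ * _).
transitivity (\prod_(j < d) \sum_i u i * x_ i ^+ t.2 j).
  by apply: eq_bigr => j _; rewrite H.
rewrite bigA_distr_bigA; apply: eq_bigr => a _.
rewrite /monomial -big_split /=; apply: eq_bigr => j _.
by rewrite mxE.
Qed.

Definition updf a (j : 'I_d) (i : I) : {ffun 'I_d -> I} :=
  [ffun l => if l == j then i else a l].

Lemma tpoint_updf a j i : tpoint (updf a j i) = upd (tpoint a) j (x_ i).
Proof. by apply/rowP => l; rewrite !mxE ffunE; case: eqP. Qed.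

(** Swapping the [j]-th index with the extra index is an involution on pairs. This replaces a
    decomposition of the multi-index type when a sum is examined along lines in direction [j]. *)
Lemma sum_updf (F : {ffun 'I_d -> I} -> R) j :
  \sum_a \sum_i F (updf a j i) = #|I|%:R * \sum_a F a.
Proof.
rewrite pair_big /= (reindex (fun z : {ffun 'I_d -> I} * I => (updf z.1 j z.2, z.1 j))) /=.
  rewrite -(pair_big xpredT xpredT (fun a i => F (updf (updf a j i) j (a j)))) /= mulr_sumr.
  apply: eq_bigr => a _; rewrite mulr_natl -sumr_const.
  by apply: eq_big => // i _; congr F; apply/ffunP => l; rewrite !ffunE; case: eqP => // ->.
exists (fun z : {ffun 'I_d -> I} * I => (updf z.1 j z.2, z.1 j)) => -[a i] _ /=.
  by rewrite !ffunE eqxx; congr (_, _); apply/ffunP => l; rewrite !ffunE; case: eqP => // ->.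
by rewrite !ffunE eqxx; congr (_, _); apply/ffunP => l; rewrite !ffunE; case: eqP => // ->.
Qed.

Lemma tsum_le_coord u v j f g :
  (forall i l, 0 <= u i l) -> (forall i, i != j -> u i = v i) ->
  (forall x, \sum_i u j i * f (upd x j (x_ i)) <= \sum_i v j i * g (upd x j (x_ i))) ->
  tsum u f <= tsum v g.
Proof.
move=> u0 uv H; have [I0|I0] := eqVneq #|I| 0%N.
  rewrite /tsum !big1// => a _; have := fintype0 (a j); by move/(_ I0).
rewrite -(ler_pM2l (_ : 0 < #|I|%:R)) ?ltr0n ?lt0n// /tsum -!(sum_updf _ j).
apply: ler_sum => a _.
have E (w : 'I_d -> I -> R) i : \prod_l w l (updf a j i l) = (\prod_(l | l != j) w l (a l)) * w j i.
  rewrite (bigD1 j)//= ffunE eqxx mulrC; congr (_ * _).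
  by apply: eq_bigr => l lj; rewrite ffunE (negbTE lj).
under eq_bigr do rewrite E tpoint_updf -mulrA.
under [X in _ <= X]eq_bigr do rewrite E tpoint_updf -mulrA.
rewrite -!mulr_sumr.
have -> : \prod_(l | l != j) v l (a l) = \prod_(l | l != j) u l (a l).
  by apply: eq_bigr => l lj; rewrite uv.
by rewrite ler_wpM2l// prodr_ge0.
Qed.

Lemma tsumZ u c f : tsum u (fun x => c * f x) = c * tsum u f.
Proof. by rewrite /tsum mulr_sumr; apply: eq_bigr => a _; rewrite mulrCA. Qed.

End Rules.

(** Padding with points of weight zero puts two rules with different nodes on one index type, where
    they can be mixed by direction. *)
Lemma tsum_inl (A B : finType) (x_ : A -> R) (y_ : B -> R) (w : A -> R) f :
  let z (i : A + B) := match i with inl a => x_ a | inr b => y_ b end in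
  let u (i : A + B) := match i with inl a => w a | inr b => 0 end in
  tsum z (fun=> u) f = tsum x_ (fun=> w) f.
Proof.
move=> z u; pose h (a : {ffun 'I_d -> A}) : {ffun 'I_d -> A + B} := [ffun j => inl (a j)].
have hi : injective h.
  by move=> a b /ffunP E; apply/ffunP => j; have := E j; rewrite !ffunE => -[].
rewrite /tsum (bigID (mem (h @: [set: {ffun 'I_d -> A}]%SET))) /= [X in _ + X]big1 ?addr0.
  rewrite big_imset; last by move=> a b _ _; exact: hi.
  rewrite (eq_bigl xpredT); last by move=> a; rewrite inE.
  apply: eq_bigr => a _; congr (_ * f _); first by apply: eq_bigr => j _; rewrite ffunE.
  by apply/rowP => j; rewrite !mxE ffunE.
move=> a na; have [j hj] : exists j, if a j is inr _ then true else false.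
  apply: contrapT => nj; move/negP: na; apply.
  have hA j : exists y, a j = inl y.
    by case E: (a j) => [y|b]; [exists y|case: nj; exists j; rewrite E].
  have [b hb] := choice hA.
  apply/imsetP; exists [ffun j => b j]; rewrite ?inE//.
  by apply/ffunP => j; rewrite !ffunE hb.
by rewrite (bigD1 j)//=; case: (a j) hj => // b _; rewrite !mul0r.
Qed.

End TensorIntegral.

(** * Derivatives and line restrictions of tensor polynomials *)

Section TensorPolynomials.
Variables (R : realType) (d : nat).
Local Notation pt := 'rV[R]_d.

Lemma deriv_prod (I : eqType) (r : seq I) (F : I -> {poly R}) : uniq r ->
  (\prod_(i <- r) F i)^`() = \sum_(i <- r) (F i)^`() * \prod_(j <- r | j != i) F j.
Proof.
elim: r => [|x r IH] /=; first by rewrite !big_nil -polyC1 derivC.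
move=> /andP [xr ur]; rewrite !big_cons derivM IH// eqxx /=; congr (_ * _ + _).
  rewrite big_seq [RHS]big_seq_cond; apply: eq_bigl => j.
  by case: (boolP (j \in r)) => //= jr; apply/esym; apply: contraNneq xr => <-.
rewrite mulr_sumr [LHS]big_seq [RHS]big_seq; apply: eq_bigr => i ir.
rewrite big_cons (_ : x != i); first by rewrite mulrCA.
by apply: contraNneq xr => ->.
Qed.

Variable p : nat.
Implicit Types (c : coef R d p) (x : pt).

Definition dqeval c (j : 'I_d) x : R :=
  \sum_a c a * ((a j)%:R * x 0 j ^+ (a j).-1 * \prod_(i | i != j) x 0 i ^+ a i).

Lemma tpoly_qeval c : tpoly p.+1 (qeval c).
Proof.
apply: tpoly_sum => a.
apply: tpoly_ext (@tpoly_monomial _ _ _ (c a) [ffun i => a i : nat] _).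
  by move=> x; congr (_ * _); apply: eq_bigr => i _; rewrite ffunE.
by move=> i; rewrite ffunE.
Qed.

Lemma tpoly_dqeval c j : tpoly p.+1 (dqeval c j).
Proof.
apply: tpoly_sum => a.
pose e := [ffun i => if i == j then (a j).-1 else a i : nat].
apply: tpoly_ext (@tpoly_monomial _ _ _ (c a * (a j)%:R) e _).
  move=> x; rewrite -mulrA -mulrA; congr (_ * (_ * _)).
  rewrite /monomial (bigD1 j)//= ffunE eqxx; congr (_ * _).
  by apply: eq_bigr => i ij; rewrite ffunE (negbTE ij).
move=> i; rewrite ffunE; case: eqP => _ //.
by rewrite (leq_ltn_trans (leq_pred _)).
Qed.

Definition linepoly c (j : 'I_d) x : {poly R} :=
  \sum_a (c a * \prod_(i | i != j) x 0 i ^+ a i) *: 'X^(a j).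

Lemma size_linepoly c j x : (size (linepoly c j x) <= p.+1)%N.
Proof.
rewrite (leq_trans (size_sum _ _ _))//; apply/bigmax_leqP => a _.
by rewrite (leq_trans (size_scale_leq _ _))// size_polyXn.
Qed.

Lemma horner_linepoly c j x t : (linepoly c j x).[t] = qeval c (upd x j t).
Proof.
rewrite horner_sum; apply: eq_bigr => a _; rewrite hornerZ hornerXn -mulrA; congr (_ * _).
rewrite /mono [RHS](bigD1 j)//= upd_id mulrC; congr (_ * _).
by apply: eq_bigr => i ij; rewrite mxE (negbTE ij).
Qed.

Lemma horner_linepoly_deriv c j x t : (linepoly c j x)^`().[t] = dqeval c j (upd x j t).
Proof.
rewrite raddf_sum horner_sum; apply: eq_bigr => a _.
rewrite /= derivZ hornerZ derivXn hornerMn hornerXn -mulr_natl.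
rewrite upd_id (_ : \prod_(i | i != j) upd x j t 0 i ^+ a i = \prod_(i | i != j) x 0 i ^+ a i).
  by ring.
by apply: eq_bigr => i ij; rewrite mxE (negbTE ij).
Qed.

Lemma derive1_qeval_line c x y :
  derive1 (fun t : R => qeval c (x + t *: y)) 0 = \sum_j y 0 j * dqeval c j x.
Proof.
pose F (a : midx d p) (j : 'I_d) : {poly R} := ((x 0 j)%:P + y 0 j *: 'X) ^+ a j.
pose P : {poly R} := \sum_a c a *: \prod_j F a j.
have -> : (fun t : R => qeval c (x + t *: y)) = horner P.
  apply/funext => t; rewrite /P horner_sum; apply: eq_bigr => a _.
  rewrite hornerZ horner_prod; congr (_ * _); apply: eq_bigr => j _.
  by rewrite /F horner_exp !mxE hornerD hornerC hornerZ hornerX [t * _]mulrC.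
have -> : derive1 (horner P) 0 = P^`().[0] by rewrite derivE.
rewrite /P raddf_sum horner_sum.
under [RHS]eq_bigr do rewrite mulr_sumr.
rewrite exchange_big /=; apply: eq_bigr => a _.
rewrite derivZ hornerZ deriv_prod ?index_enum_uniq// horner_sum mulr_sumr.
apply: eq_bigr => j _; rewrite mulrCA; congr (_ * _).
have F0 i : (F a i).[0] = x 0 i ^+ a i.
  by rewrite /F horner_exp hornerD hornerC hornerZ hornerX mulr0 addr0.
rewrite hornerM horner_prod mulrA; congr (_ * _); last by apply: eq_bigr => i _; rewrite F0.
rewrite /F deriv_exp derivD derivC derivZ derivX add0r hornerMn hornerM horner_exp.
rewrite alg_polyC hornerC hornerD hornerC hornerZ hornerX mulr0 addr0.
by rewrite -mulr_natl; ring.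
Qed.

End TensorPolynomials.

(** * Exact rules, inverse inequality and Lobatto equivalence on the cube *)

Section CubeRules.
Variables (R : realType) (d p : nat).
Local Notation pt := 'rV[R]_d.
Hypothesis p0 : (0 < p)%N.
Implicit Types (c : coef R d p) (x : pt).

Lemma big_nodes n (s : seq R) (F : R -> R) : size s = n ->
  \sum_(a <- s) F a = \sum_(i < n) F (nth 0 s i).
Proof. by move=> <-; rewrite (big_nth 0) big_mkord. Qed.

Lemma lob_itv n (s : seq R) w i : lobatto_rule n s w -> (i < n.+1)%N ->
  -1 <= nth 0 s i <= 1.
Proof.
move=> H ni; have : nth 0 s i \in s by rewrite mem_nth// (lob_size H).
by move/(lob_mem H) => [].
Qed.

Lemma lob_moment n (s : seq R) w k : lobatto_rule n s w -> (k < 2 * n)%N ->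
  pint ('X^k : {poly R}) = \sum_(i < n.+1) w (nth 0 s i) * nth 0 s i ^+ k.
Proof.
move=> H kn; rewrite (lob_exact H) ?size_polyXn// (big_nodes _ (lob_size H)).
by apply: eq_bigr => i _; rewrite hornerXn.
Qed.

(** The Lobatto rule of order [p + 1] in place of [p] is exact on products of two polynomials of
    degree [p] per variable. Its non-negative weights make later facts about integrals facts about
    finite sums. *)
Lemma cube_rule : exists (I : finType) (y : I -> pt) (u : I -> R),
  [/\ forall i, 0 <= u i, forall i, ccube (y i) &
      forall f, tpoly (2 * p.+1) f -> refint f = \sum_i u i * f (y i)].
Proof.
have [s [w H]] := lobatto_ruleP R (ltn0Sn p).
pose x_ (i : 'I_p.+2) := nth 0 s i.
exists {ffun 'I_d -> 'I_p.+2}, (tpoint x_), (fun a : {ffun 'I_d -> 'I_p.+2} => \prod_j w (x_ (a j))); split.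
- by move=> a; apply: prodr_ge0 => j _; exact: lob_ge0 H _.
- by move=> a j; rewrite mxE; exact: lob_itv H _.
- move=> f; apply: (@refint_tsum _ _ _ x_ (fun i => w (x_ i))) => k kp.
  exact: lob_moment H kp.
Qed.

Lemma refint_ge0 f : tpoly (2 * p.+1) f -> (forall x, ccube x -> 0 <= f x) -> 0 <= refint f.
Proof.
move=> hf h; have [I [y [u [u0 yc ->]]]] := cube_rule => //.
by apply: sumr_ge0 => i _; rewrite mulr_ge0 ?h.
Qed.

Lemma tpoly_sqr f : tpoly p.+1 f -> tpoly (2 * p.+1) (fun x : pt => f x ^+ 2).
Proof. by move=> hf; rewrite mul2n -addnn; exact: tpolyM. Qed.

(** Written with the exact rule of order [p + 1], the estimate is the one-dimensional inverse
    inequality on each line in direction [j]. *)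
Lemma refint_dqeval c j :
  refint (fun x => dqeval c j x ^+ 2) <= p.+1%:R ^+ 4 * refint (fun x => qeval c x ^+ 2).
Proof.
have [s [w H]] := lobatto_ruleP R (ltn0Sn p).
pose x_ (i : 'I_p.+2) := nth 0 s i.
have mom k : (k < 2 * p.+1)%N -> pint ('X^k : {poly R}) = \sum_i w (x_ i) * x_ i ^+ k.
  exact: lob_moment H.
rewrite !(refint_tsum mom); try by apply: tpoly_sqr; [exact: tpoly_dqeval || exact: tpoly_qeval].
  rewrite -tsumZ; apply: (@tsum_le_coord _ _ _ _ _ _ j) => [i l|//|x].
    exact: lob_ge0 H _.
  have E (q : {poly R}) : (size q <= p.+1)%N -> \sum_i w (x_ i) * q.[x_ i] ^+ 2 = pint (q ^+ 2).
    move=> sq; rewrite (lob_exact H); last first.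
      by rewrite expr2 (leq_trans (size_polyMleq _ _))//; move: sq; clear; move: (size _) => m; lia.
    by rewrite (big_nodes _ (lob_size H)); apply: eq_bigr => i _; rewrite horner_exp.
  under eq_bigr do rewrite -horner_linepoly_deriv.
  under [X in _ <= X]eq_bigr do rewrite -horner_linepoly mulrCA.
  rewrite -mulr_sumr !E ?size_linepoly ?pint_deriv_inverse ?size_linepoly//.
  by rewrite (leq_trans (size_poly _ _))// (leq_trans (leq_pred _))// size_linepoly.
Qed.

Variables (s : seq R) (w : R -> R).
Hypothesis Hs : lobatto_rule p s w.

Definition gnode (a : midx d p) : pt := tpoint (fun i : 'I_p.+1 => nth 0 s i) a.
Definition gweight (a : midx d p) : R := \prod_j w (gnode a 0 j).

(* Both estimates follow by exchanging the exact rule for the Lobatto rule one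
   coordinate after the other. *)
Lemma lobatto_equiv c :
  refint (fun x => qeval c x ^+ 2) <= \sum_a gweight a * qeval c (gnode a) ^+ 2 <=
  3 ^+ d * refint (fun x => qeval c x ^+ 2).
Proof.
have [s' [w' H]] := lobatto_ruleP R (ltn0Sn p).
pose I := ('I_p.+1 + 'I_p.+2)%type.
pose x_ (i : I) := match i with inl i => nth 0 s i | inr i => nth 0 s' i end.
pose uG (i : I) := match i with inl i => w (nth 0 s i) | inr _ => 0 end.
pose uE (i : I) := match i with inl _ => 0 | inr i => w' (nth 0 s' i) end.
have uG0 i : 0 <= uG i by case: i => // i; exact: lob_ge0 Hs _.
have uE0 i : 0 <= uE i by case: i => // i; exact: lob_ge0 H _.
have sumG (F : R -> R) : \sum_i uG i * F (x_ i) = \sum_(a <- s) w a * F a.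
  rewrite big_sumType /= [X in _ + X]big1 ?addr0 => [|i _]; last by rewrite mul0r.
  by rewrite (big_nodes _ (lob_size Hs)).
have sumE (F : R -> R) : \sum_i uE i * F (x_ i) = \sum_(a <- s') w' a * F a.
  rewrite big_sumType /= [X in X + _]big1 ?add0r => [|i _]; last by rewrite mul0r.
  by rewrite (big_nodes _ (lob_size H)).
have mom k : (k < 2 * p.+1)%N -> pint ('X^k : {poly R}) = \sum_i uE i * x_ i ^+ k.
  move=> kp; rewrite (sumE (fun t => t ^+ k)) (lob_exact H) ?size_polyXn//.
  by apply: eq_bigr => a _; rewrite hornerXn.
have EE (q : {poly R}) : (size q <= p.+1)%N -> \sum_i uE i * q.[x_ i] ^+ 2 = pint (q ^+ 2).
  move=> sq; rewrite (sumE (fun t => q.[t] ^+ 2)) (lob_exact H); last first.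
    by rewrite expr2 (leq_trans (size_polyMleq _ _))//; move: sq; clear; move: (size _) => m; lia.
  by apply: eq_bigr => a _; rewrite horner_exp.
set f := fun x => qeval c x ^+ 2.
have -> : \sum_a gweight a * qeval c (gnode a) ^+ 2 = tsum x_ (fun=> uG) f.
  rewrite (tsum_inl (fun i : 'I_p.+1 => nth 0 s i) (fun i : 'I_p.+2 => nth 0 s' i)).
  apply: eq_bigr => a _; congr (_ * _); apply: eq_bigr => j _.
  by rewrite mxE.
rewrite (refint_tsum mom); last by apply: tpoly_sqr; exact: tpoly_qeval.
pose hyb (m : nat) (j : 'I_d) : I -> R := if (j < m)%N then uG else uE.
have hyb0 m j i : 0 <= hyb m j i by rewrite /hyb; case: ifP.
have h0 : tsum x_ (fun=> uE) f = tsum x_ (hyb 0%N) f by [].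
have hd : tsum x_ (fun=> uG) f = tsum x_ (hyb d) f.
  by congr tsum; apply/funext => j; rewrite /hyb ltn_ord.
rewrite h0 hd.
have step m : (m <= d)%N -> tsum x_ (hyb 0%N) f <= tsum x_ (hyb m) f <= 3 ^+ m * tsum x_ (hyb 0%N) f.
  elim: m => [|m IH] md; first by rewrite expr0 mul1r lexx.
  have /andP [lo up] := IH (ltnW md).
  pose j := Ordinal md.
  have hj1 : hyb m j = uE by rewrite /hyb /= ltnn.
  have hj2 : hyb m.+1 j = uG by rewrite /hyb /= ltnSn.
  have hij i : i != j -> hyb m i = hyb m.+1 i.
    by rewrite -val_eqE /= /hyb ltnS [(i <= m)%N]leq_eqVlt => /negbTE ->.
  apply/andP; split.
    apply: (le_trans lo); apply: (@tsum_le_coord _ _ _ _ _ _ j) => // x.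
    rewrite hj1 hj2 /f; under eq_bigr do rewrite -horner_linepoly.
    under [X in _ <= X]eq_bigr do rewrite -horner_linepoly.
    rewrite EE ?size_linepoly// (sumG (fun t => (linepoly c j x).[t] ^+ 2)).
    by rewrite (lob_lower Hs)// size_linepoly.
  rewrite exprS -mulrA; apply: (@le_trans _ _ (3 * tsum x_ (hyb m) f)); last by rewrite ler_wpM2l.
  rewrite -tsumZ; apply: (@tsum_le_coord _ _ _ _ _ _ j) => // [i ij|x]; first by rewrite hij.
  rewrite hj1 hj2 /f; under eq_bigr do rewrite -horner_linepoly.
  under [X in _ <= X]eq_bigr do rewrite -horner_linepoly mulrCA.
  rewrite -mulr_sumr EE ?size_linepoly// (sumG (fun t => (linepoly c j x).[t] ^+ 2)).
  by rewrite (lob_upper Hs)// size_linepoly.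
exact: step.
Qed.

End CubeRules.

(** * Geometry of the mesh *)

Section Geometry.
Variables (R : realType) (d : nat).
Local Notation pt := 'rV[R]_d.

Lemma nbhs_box (x : pt) (A : set pt) : nbhs x A <->
  exists2 e : R, 0 < e & forall y : pt, (forall i, `|x 0 i - y 0 i| < e) -> A y.
Proof.
split=> [/nbhs_ballP [e e0 H]|[e e0 H]].
  by exists e => // y hy; apply: H; split=> // i j; rewrite ord1; exact: hy.
apply/nbhs_ballP; exists e => // y [_ hy]; apply: H => i; exact: (hy 0 i).
Qed.

Lemma near_forall (x : pt) (I : finType) (P : I -> pt -> Prop) :
  (forall i, \forall y \near x, P i y) -> \forall y \near x, forall i, P i y.
Proof. by move=> H; exact: (@filter_forall _ I P (nbhs x) _ H). Qed.

Lemma near_and (x : pt) (A B : set pt) :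
  nbhs x A -> nbhs x B -> nbhs x (fun y => A y /\ B y).
Proof. exact: filterI. Qed.

Lemma near_sub (x : pt) (A B : set pt) : (forall y, A y -> B y) -> nbhs x A -> nbhs x B.
Proof. by move=> AB; apply: filterS. Qed.

Lemma near_lt (f : pt -> R) x c : {for x, continuous f} -> f x < c ->
  \forall y \near x, f y < c.
Proof. move=> cf h; exact: (cvgr_lt (f x) cf c h). Qed.

Lemma near_gt (f : pt -> R) x c : {for x, continuous f} -> c < f x ->
  \forall y \near x, c < f y.
Proof. move=> cf h; exact: (cvgr_gt (f x) cf c h). Qed.

Lemma sum_continuous (I : Type) (r : seq I) (F : I -> pt -> R) :
  (forall i, continuous (F i)) -> continuous (fun x => \sum_(i <- r) F i x).
Proof.
move=> H x; elim: r => [|i r IH].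
  have -> : (fun y => \sum_(i <- [::]) F i y) = (fun=> 0).
    by apply/funext => y; rewrite big_nil.
  exact: cst_continuous.
have -> : (fun y => \sum_(j <- i :: r) F j y) = (fun y => F i y + \sum_(j <- r) F j y).
  by apply/funext => y; rewrite big_cons.
by apply: (@cvgD _ _ _ (nbhs x)); [exact: (H i x)|exact: IH].
Qed.

Lemma affine_row_continuous (A : 'M[R]_d) (i : 'I_d) :
  continuous (fun x : pt => (x *m A) 0 i).
Proof.
rewrite (_ : (fun x : pt => (x *m A) 0 i) = fun x : pt => \sum_j x 0 j * A j i).
  apply: sum_continuous => j x.
  by apply: (@cvgM _ _ (nbhs x)); [exact: (@coord_continuous _ 1 d 0 j x)|exact: cvg_cst].
by apply/funext => y; rewrite mxE.
Qed.

Lemma near_segment (x y : pt) (A : set pt) : nbhs x A ->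
  exists2 e : R, 0 < e <= 1 & forall t, 0 <= t <= e -> A ((1 - t) *: x + t *: y).
Proof.
move/nbhs_box => [e e0 H].
pose m := \sum_i `|x 0 i - y 0 i| + 1.
have m0 : 0 < m by rewrite ltr_wpDl// sumr_ge0.
have em0 : 0 < e / (m * 2) by rewrite divr_gt0// mulr_gt0.
exists (Num.min (e / (m * 2)) 1); first by rewrite lt_min em0 ltr01 ge_min lexx orbT.
move=> t; rewrite le_min => /and3P [t0 te _]; apply: H => i; rewrite !mxE.
rewrite (_ : _ - _ = t * (x 0 i - y 0 i)); last ring.
rewrite normrM (ger0_norm t0); apply: (@le_lt_trans _ _ (t * m)).
  by rewrite ler_wpM2l// /m (bigD1 i)//= -addrA lerDl addr_ge0 ?sumr_ge0.
rewrite -ltr_pdivlMr//; apply: (le_lt_trans te).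
by rewrite invfM mulrA gtr_pMr ?divr_gt0// invf_lt1// (_ : 2 = 1 + 1)// ltrDl ltr01.
Qed.

Lemma convex_ge (c a b t : R) : 0 <= t <= 1 -> c <= a -> c <= b -> c <= (1 - t) * a + t * b.
Proof. by move=> /andP [t0 t1] ha hb; nra. Qed.

Lemma convex_le (c a b t : R) : 0 <= t <= 1 -> a <= c -> b <= c -> (1 - t) * a + t * b <= c.
Proof. by move=> /andP [t0 t1] ha hb; nra. Qed.

Lemma convex_gt (c a b t : R) : 0 < t <= 1 -> c <= a -> c < b -> c < (1 - t) * a + t * b.
Proof. by move=> /andP [t0 t1] ha hb; nra. Qed.

Lemma convex_lt (c a b t : R) : 0 < t <= 1 -> a <= c -> b < c -> (1 - t) * a + t * b < c.
Proof. by move=> /andP [t0 t1] ha hb; nra. Qed.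

Lemma convex_lt2 (c a b t : R) : 0 <= t <= 1 -> a < c -> b < c -> (1 - t) * a + t * b < c.
Proof.
move=> /andP [t0 t1] ha hb; have [->|tn] := eqVneq t 0; first by rewrite mul0r addr0 subr0 mul1r.
by apply: convex_lt => //; [rewrite lt_neqAle eq_sym tn t0 t1|exact: ltW].
Qed.

Lemma convex_gt2 (c a b t : R) : 0 <= t <= 1 -> c < a -> c < b -> c < (1 - t) * a + t * b.
Proof.
move=> ht ha hb; rewrite -ltrN2 opprD -!mulrN.
by apply: convex_lt2 => //; rewrite ltrN2.
Qed.

Variable M : mesh R d.
Local Notation N := (nel M).
Hypothesis unitB : forall k : 'I_N, mB k \in unitmx.
Implicit Types (k l : 'I_N) (i j : 'I_d) (s : bool) (x y z : pt).

Lemma FmapK k x : Finv k (Fmap k x) = x.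
Proof. by rewrite /Finv /Fmap addrK mulmxK. Qed.

Lemma FinvK k y : Fmap k (Finv k y) = y.
Proof. by rewrite /Finv /Fmap mulmxKV// subrK. Qed.

Lemma celemP k y : celem k y <-> ccube (Finv k y).
Proof.
split=> [[x hx <-]|h]; first by rewrite FmapK.
by exists (Finv k y) => //; rewrite FinvK.
Qed.

Lemma elemP k y : elem k y <-> ocube (Finv k y).
Proof.
split=> [[x hx <-]|h]; first by rewrite FmapK.
by exists (Finv k y) => //; rewrite FinvK.
Qed.

Lemma rfaceP k sig y : (Fmap k @` rface sig) y <-> rface sig (Finv k y).
Proof.
split=> [[x hx <-]|h]; first by rewrite FmapK.
by exists (Finv k y) => //; rewrite FinvK.
Qed.

Lemma elem_celem k y : elem k y -> celem k y.
Proof. by move/elemP => h; apply/celemP => i; have /andP [? ?] := h i; rewrite !ltW. Qed.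

Lemma Finv_continuous k i : continuous (fun y => Finv k y 0 i).
Proof.
move=> y; rewrite (_ : (fun y => Finv k y 0 i) =
  fun y => (y *m invmx (mB k)) 0 i - (mb k *m invmx (mB k)) 0 i); last first.
  by apply/funext => z; rewrite /Finv mulmxBl mxE [in X in _ + X]mxE.
by apply: (@cvgB _ _ _ (nbhs y)); [exact: (@affine_row_continuous _ i y)|exact: cvg_cst].
Qed.

Lemma Finv_combo k x y (t : R) :
  Finv k ((1 - t) *: x + t *: y) = (1 - t) *: Finv k x + t *: Finv k y.
Proof.
rewrite /Finv !scalemxAl -mulmxDl; congr (_ *m _).
by rewrite !scalerBr addrACA -opprD -scalerDl subrK scale1r.
Qed.

Lemma Finv_comboE k i x y (t : R) :
  Finv k ((1 - t) *: x + t *: y) 0 i = (1 - t) * Finv k x 0 i + t * Finv k y 0 i.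
Proof. by rewrite Finv_combo; move: (Finv k x) (Finv k y) => u v; rewrite !mxE. Qed.

Lemma Finv_shift k y (v : pt) : Finv k (y + v *m mB k) = Finv k y + v.
Proof. by rewrite /Finv addrAC mulmxDl mulmxK. Qed.

Lemma near_side x : \forall y \near x, forall k i s,
  (Finv k x 0 i < sgn R s -> Finv k y 0 i < sgn R s) /\
  (sgn R s < Finv k x 0 i -> sgn R s < Finv k y 0 i).
Proof.
apply: near_forall => k; apply: near_forall => i; apply: near_forall => s.
have C := @Finv_continuous k i x.
have [h|h|h] := ltgtP (Finv k x 0 i) (sgn R s).
- by apply: near_sub (near_lt C h) => y hy; split.
- by apply: near_sub (near_gt C h) => y hy; split.
- by apply: near_sub filterT => y hy; split.
Qed.

Lemma elem_open k x : elem k x -> nbhs x (elem k).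
Proof.
move/elemP => hx; apply: near_sub (near_side x) => y hy; apply/elemP => i.
have /andP [h1 h2] := hx i; apply/andP; split.
  by have [_] := hy k i false; apply.
by have [+ _] := hy k i true; apply.
Qed.

Lemma celem_closed k x : ~ celem k x -> nbhs x (fun y => ~ celem k y).
Proof.
move=> nx; apply: near_sub (near_side x) => y hy cy; apply: nx; apply/celemP => i.
move/celemP: cy => /(_ i) /andP [h1 h2]; rewrite !leNgt; apply/andP; split; apply/negP => h.
  by have [/(_ h)] := hy k i false; rewrite ltNge h1.
by have [_ /(_ h)] := hy k i true; rewrite ltNge h2.
Qed.

Lemma celem_convex k x y (t : R) : 0 <= t <= 1 -> celem k x -> celem k y ->
  celem k ((1 - t) *: x + t *: y).
Proof.
move=> ht /celemP hx /celemP hy; apply/celemP => i; rewrite Finv_comboE.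
have /andP [h1 h2] := hx i; have /andP [h3 h4] := hy i.
by rewrite convex_ge ?convex_le.
Qed.

Lemma elem_segment k x y (t : R) : 0 < t <= 1 -> celem k x -> elem k y ->
  elem k ((1 - t) *: x + t *: y).
Proof.
move=> ht /celemP hx /elemP hy; apply/elemP => i; rewrite Finv_comboE.
have /andP [h1 h2] := hx i; have /andP [h3 h4] := hy i.
by rewrite convex_gt ?convex_lt.
Qed.

Definition ecenter k : pt := Fmap k 0.

Lemma elem_center k : elem k (ecenter k).
Proof. by exists 0 => // i; rewrite mxE; apply/andP; split; lra. Qed.

Definition covered y := exists k, celem k y.

Lemma elem_Omega k y : elem k y -> Omega M y.
Proof.
move/elem_open; apply: near_sub => z hz; exists k; exact: elem_celem.
Qed.

Lemma Omega_covered y : Omega M y -> covered y.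
Proof. exact: nbhs_singleton. Qed.

Lemma covered_closed x : ~ covered x -> nbhs x (fun y => ~ covered y).
Proof.
move=> nx; have : nbhs x (fun y => forall k, ~ celem k y).
  by apply: near_forall => k; apply: celem_closed => h; apply: nx; exists k.
by apply: near_sub => y hy [k]; exact: hy.
Qed.

Lemma celem_approx k x (A : set pt) : celem k x -> nbhs x A -> exists2 y, elem k y & A y.
Proof.
move=> hx /(near_segment (ecenter k)) [e e0 H].
exists ((1 - e) *: x + e *: ecenter k).
  by apply: elem_segment => //; exact: elem_center.
by apply: H; case/andP: e0 => e0 _; rewrite ltW//=.
Qed.

(** A finite union of closed elements is closed, and each point of a closed element is a limit of
    points of the open one, which lie in [Omega]. *)
Lemma closure_Omega : closure (Omega M) = covered.
Proof.
apply/seteqP; split=> x.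
  move=> hx; apply: contrapT => /covered_closed /hx [y [hy]].
  by apply; exact: Omega_covered.
move=> [k hk] B hB; have [y hy By] := celem_approx hk hB.
by exists y; split=> //; exact: elem_Omega hy.
Qed.

Lemma bdryP x : bdry M x <-> covered x /\ ~ Omega M x.
Proof. by rewrite /bdry closure_Omega. Qed.

Hypothesis convO : Defs.convex_set (Omega M).

Lemma covered_convex x y (t : R) : 0 <= t <= 1 -> covered x -> covered y ->
  covered ((1 - t) *: x + t *: y).
Proof.
move=> ht [k hk] [l hl]; apply: contrapT => /covered_closed /nbhs_box [e e0 H].
have hbox z : nbhs z (fun y => forall i, `|z 0 i - y 0 i| < e).
  by apply/nbhs_box; exists e.
have [x' ex hx] := celem_approx hk (hbox x); have [y' ey hy] := celem_approx hl (hbox y).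
apply: (H ((1 - t) *: x' + t *: y')).
  move=> i; rewrite !mxE.
  rewrite (_ : _ - _ = (1 - t) * (x 0 i - x' 0 i) + t * (y 0 i - y' 0 i)); last ring.
  have := hx i; have := hy i; rewrite !ltr_norml => /andP [h1 h2] /andP [h3 h4].
  by move=> *; rewrite convex_gt2 ?convex_lt2.
exact: (Omega_covered (convO (elem_Omega ex) (elem_Omega ey) ht)).
Qed.

(** A covered neighbourhood of [x], contracted towards [y] by the factor [1 - t], is a neighbourhood
    of the combination and stays covered by convexity. *)
Lemma Omega_segment x y (t : R) : 0 <= t < 1 -> Omega M x -> covered y ->
  Omega M ((1 - t) *: x + t *: y).
Proof.
move=> ht /nbhs_box [e e0 H] hy; apply/nbhs_box; exists (e * (1 - t)).
  by rewrite mulr_gt0//; lra.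
move=> z hz; pose x' := x + (1 - t)^-1 *: (z - ((1 - t) *: x + t *: y)).
have t1 : 0 < 1 - t by lra.
have -> : z = (1 - t) *: x' + t *: y.
  rewrite /x' scalerDr scalerA mulfV ?gt_eqF// scale1r.
  by apply/rowP => i; rewrite !mxE; ring.
apply: covered_convex => //; first by case/andP: ht => -> /ltW.
apply: H => i; have := hz i; rewrite !mxE => h.
rewrite opprD addrA subrr add0r normrN normrM ger0_norm; last by rewrite invr_ge0 ltW.
by rewrite mulrC ltr_pdivrMr// distrC.
Qed.

(** An interior [y] would place [x] strictly inside a segment from [y] to a point of [k] beyond [x],
    making [x] interior too. Consequently all nodes of the smallest face through a boundary point
    are boundary nodes. *)
Lemma bdry_face k x y : bdry M x -> celem k x -> celem k y ->
  (forall i s, Finv k x 0 i = sgn R s -> Finv k y 0 i = sgn R s) -> bdry M y.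
Proof.
move=> /bdryP [_ nx] hx hy same; apply/bdryP; split; first by exists k.
move=> Oy; apply: nx.
have cx : nbhs x (fun z => forall i, (Finv k x 0 i < 1 -> Finv k z 0 i < 1) /\
                                     (-1 < Finv k x 0 i -> -1 < Finv k z 0 i)).
  apply: near_sub (near_side x) => z hz i.
  by have [h1 _] := hz k i true; have [_ h2] := hz k i false.
(* prolong the segment from [y] beyond [x]: it stays in the face *)
have [t /andP [h1 h2] /(_ t)] := near_segment (2 *: x - y) cx.
rewrite lexx (ltW h1) => /(_ isT); set z := _ + _ => H.
have zE i : Finv k z 0 i = Finv k x 0 i + t * (Finv k x 0 i - Finv k y 0 i).
  rewrite /z (_ : _ + _ = (1 - (- t)) *: x + (- t) *: y).
    by rewrite Finv_comboE; ring.
  by apply/rowP => i0; rewrite !mxE; ring.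
have cz : celem k z.
  apply/celemP => i; have /celemP /(_ i) /andP [a1 a2] := hx.
  have [b1 b2] := H i; apply/andP; split.
    have [E|ne] := eqVneq (Finv k x 0 i) (-1).
      by have := same i false E; rewrite zE E => ->; rewrite /= subrr mulr0 addr0.
    by rewrite ltW// b2// lt_neqAle eq_sym ne.
  have [E|ne] := eqVneq (Finv k x 0 i) 1.
    by have := same i true E; rewrite zE E => ->; rewrite /= subrr mulr0 addr0.
  by rewrite ltW// b1// lt_neqAle ne.
have -> : x = (1 - (1 + t)^-1) *: y + (1 + t)^-1 *: z.
  apply/rowP => i; rewrite !mxE; field; lra.
apply: Omega_segment => //; last by exists k.
have t1 : 0 < 1 + t by lra.
by rewrite invr_ge0 ltW//= invf_lt1//; lra.
Qed.

End Geometry.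

(** * Facet connectivity of the elements around a point *)

Section Connectivity.
Variables (R : realType) (d : nat).
Local Notation pt := 'rV[R]_d.

Lemma near_line (z v : pt) (A : set pt) : nbhs z A ->
  exists2 e : R, 0 < e & forall t, `|t| < e -> A (z + t *: v).
Proof.
move/nbhs_box => [e e0 H].
pose m := \sum_i `|v 0 i| + 1.
have m0 : 0 < m by rewrite ltr_wpDl// sumr_ge0.
exists (e / m) => [|t te]; first exact: divr_gt0.
apply: H => i; rewrite !mxE opprD addrA subrr add0r normrN normrM.
apply: (@le_lt_trans _ _ (`|t| * m)).
  by rewrite ler_wpM2l// /m (bigD1 i)//= -addrA lerDl addr_ge0 ?sumr_ge0.
by rewrite -ltr_pdivlMr.
Qed.

(** Non-vanishing of a continuous function is an open condition, so each further perturbation can be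
    kept small enough to preserve what was reached before. *)
Lemma generic_point (I : eqType) (r : seq I) (F : I -> pt -> R) :
  (forall i, continuous (F i)) ->
  (forall i (a : pt) (A : set pt), nbhs a A -> exists2 a', A a' & F i a' != 0) ->
  forall (a : pt) (A : set pt), nbhs a A -> exists2 a', A a' & forall i, i \in r -> F i a' != 0.
Proof.
move=> cF dF a A nA.
suff [a' Ha'] : exists a' : pt, nbhs a' (fun y : pt => A y /\ forall i, i \in r -> F i y != 0).
  by have [h1 h2] := nbhs_singleton Ha'; exists a'.
elim: r => [|i r [a1 IH]].
  by exists a; apply: near_sub nA => y hy; split.
move/nbhs_interior: IH => /(dF i) [a2 IH F2].
exists a2; have : nbhs a2 (fun y => F i y != 0).
  have [h|h|/eqP h] := ltgtP (F i a2) 0; last by rewrite (negbTE F2) in h.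
    by apply: near_sub (near_lt (cF i a2) h) => y hy; rewrite lt_eqF.
  by apply: near_sub (near_gt (cF i a2) h) => y hy; rewrite gt_eqF.
move=> /(near_and IH); apply: near_sub => y [[Ay Hy] Fy]; split=> // l.
by rewrite inE => /orP [/eqP ->|/Hy].
Qed.

Variable M : mesh R d.
Local Notation N := (nel M).
Hypothesis unitB : forall k : 'I_N, mB k \in unitmx.
Hypothesis convO : Defs.convex_set (Omega M).
Hypothesis disj : forall k l : 'I_N, k != l -> setI (elem k) (elem l) = set0.
Hypothesis conf : forall k l : 'I_N, k != l -> setI (celem k) (celem l) = set0 \/
  exists sig tau, setI (celem k) (celem l) = Fmap k @` rface sig /\
                  setI (celem k) (celem l) = Fmap l @` rface tau.
Implicit Types (k l m : 'I_N) (i j : 'I_d) (s : bool) (x y z a b : pt).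

Let celemP k y := celemP unitB k y.
Let elemP k y := elemP unitB k y.

Lemma elem_celem_inj k l y : elem k y -> celem l y -> k = l.
Proof.
move=> hk hl; apply/eqP/negPn/negP => kl.
have [z zl zk] := celem_approx unitB hl (elem_open unitB hk).
by have := disj kl; rewrite -subset0 => /(_ z); apply.
Qed.

Lemma mem_facet k j s y : celem k y -> Finv k y 0 j = sgn R s ->
  (Fmap k @` rface (facet j s)) y.
Proof.
move=> /celemP hy E; apply/(rfaceP unitB); split=> // i.
by rewrite /facet; case: eqP => // ->.
Qed.

Definition generic_for k z := forall i1 i2 s1 s2, i1 != i2 ->
  ~ (Finv k z 0 i1 = sgn R s1 /\ Finv k z 0 i2 = sgn R s2).

(** The common face fixes at most one coordinate, because it contains the generic point [z]; it
    fixes at least one, because otherwise it would contain the centre of [k]. *)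
Lemma shared_facet k m z : k != m -> celem k z -> celem m z -> generic_for k z ->
  exists j s, nbr k j s m /\ Finv k z 0 j = sgn R s.
Proof.
move=> km hk hm gz; have [E|[sig [tau [E _]]]] := conf km.
  by have : (celem k `&` celem m) z by []; rewrite E.
have : (Fmap k @` rface sig) z by rewrite -E.
move/(rfaceP unitB) => [_ hz].
have [[j [s sj]]|nosig] := pselect (exists j s, sig j = Some s); last first.
  have cc : (Fmap k @` rface sig) (ecenter k).
    exists 0 => //; split=> [i|i]; first by rewrite mxE; apply/andP; split; lra.
    by case E' : (sig i) => [s|] //; case: nosig; exists i, s.
  rewrite -E in cc; have := elem_celem_inj (elem_center k) cc.2.
  by move/eqP; rewrite (negbTE km).
have zj : Finv k z 0 j = sgn R s by have := hz j; rewrite sj.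
exists j, s; split=> //; apply/asboolP; split; first by rewrite eq_sym.
have sigE : sig = facet j s.
  apply/funext => i; rewrite /facet; case: eqP => [->//|/eqP ij].
  case E' : (sig i) => [s'|] //; case: (gz i j s' s ij); split=> //.
  by have := hz i; rewrite E'.
by rewrite -sigE -E => y [].
Qed.

Lemma facet_slack k j s x y (t : R) :
  1 - sgn R s * Finv k ((1 - t) *: x + t *: y) 0 j =
  (1 - t) * (1 - sgn R s * Finv k x 0 j) + t * (1 - sgn R s * Finv k y 0 j).
Proof. by rewrite Finv_comboE; ring. Qed.

Lemma sgn_sqr s : sgn R s * sgn R s = 1.
Proof. by case: s; rewrite /sgn; ring. Qed.

Lemma celem_slack k j s y : celem k y -> 0 <= 1 - sgn R s * Finv k y 0 j.
Proof. by move/celemP => /(_ j) /andP [h1 h2]; case: s; rewrite /sgn; lra. Qed.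

(** Near a relative interior point of the facet only the inequality of that facet can fail. Where it
    holds the point is in [k]; where it fails the point lies on a segment from the facet, which is
    part of [l], to the centre of [l]. *)
Lemma facet_cover k j s l z : nbr k j s l -> celem k z -> Finv k z 0 j = sgn R s ->
  (forall i, i != j -> -1 < Finv k z 0 i < 1) -> nbhs z (covered M).
Proof.
move=> /asboolP [lk sub] hz zj zi.
have zl : celem l z by apply: sub; exact: mem_facet.
pose g y := 1 - sgn R s * Finv k y 0 j.
have gz : g z = 0 by rewrite /g zj sgn_sqr subrr.
have cg : continuous g.
  by move=> y; apply: (@cvgB _ _ _ (nbhs y)); [exact: cvg_cst|
    apply: (@cvgM _ _ (nbhs y)); [exact: cvg_cst|exact: (Finv_continuous (M:=M))]].
have others : nbhs z (fun y => forall i, i != j -> -1 < Finv k y 0 i < 1).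
  apply: near_sub (near_side M z) => y hy i /zi /andP [h1 h2]; apply/andP; split.
    by have [_] := hy k i false; apply.
  by have [+ _] := hy k i true; apply.
have opp : nbhs z (fun y => -1 < sgn R s * Finv k y 0 j).
  have : nbhs z (fun y => g y < 2).
    by apply: (near_lt (cg z)); rewrite gz.
  by apply: near_sub => y; rewrite /g; lra.
(* A centre of [l] not strictly beyond the facet could be shifted inside [l] to the strict side of
   [k]; a short way from [z] towards it lies in both open elements. *)
have gc : g (ecenter l) < 0.
  rewrite ltNge; apply/negP => gc0.
  have [c' cl gc'] : exists2 c', elem l c' & 0 < g c'.
    have [e e0 H] := near_line (- sgn R s *: (ecoord R j *m mB k)) (elem_open unitB (elem_center l)).
    exists (ecenter l + (e / 2) *: (- sgn R s *: (ecoord R j *m mB k))).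
      by apply: H; rewrite gtr0_norm ?divr_gt0//; lra.
    rewrite /g scalerA scalemxAl Finv_shift//.
    move: gc0; rewrite /g; move: (Finv k (ecenter l)) => u gc0.
    rewrite !mxE !eqxx /=; have := sgn_sqr s; move: (sgn R s) gc0 => c gc0 cc; nra.
  have [e /andP [e0 e1] /(_ e)] := near_segment c' (near_and others opp).
  rewrite lexx ltW// => /(_ isT) [H1 H2].
  set y := _ + _ in H1 H2.
  have yl : elem l y by apply: elem_segment => //; rewrite e0 e1.
  have gy : 0 < g y by rewrite /g facet_slack -/(g z) -/(g c') gz mulr0 add0r mulr_gt0.
  have yk : elem k y.
    apply/elemP => i; have [->|/H1//] := eqVneq i j.
    by move: gy H2; rewrite /g; case: (s); rewrite /sgn => *; apply/andP; split; lra.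
  by have := disj lk; rewrite -subset0 => /(_ y); apply.
(* For [g x < 0] the line from the centre of [l] through [x] meets the facet at [y x]. *)
pose tau x := g x / g (ecenter l).
have ctau : continuous tau.
  by move=> y; apply: (@cvgM _ _ (nbhs y)); [exact: cg|exact: cvg_cst].
have tz : tau z = 0 by rewrite /tau gz mul0r.
pose h i x := (Finv k x 0 i - tau x * Finv k (ecenter l) 0 i) / (1 - tau x).
have ch i : {for z, continuous (h i)}.
  apply: (@cvgM _ _ (nbhs z)).
    apply: (@cvgB _ _ _ (nbhs z)); first exact: (Finv_continuous (M:=M)).
    by apply: (@cvgM _ _ (nbhs z)); [exact: ctau|exact: cvg_cst].
  apply: (@cvgV _ _ (nbhs z)); first by rewrite tz subr0 oner_neq0.
  by apply: (@cvgB _ _ _ (nbhs z)); [exact: cvg_cst|exact: ctau].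
have hz0 i : h i z = Finv k z 0 i by rewrite /h tz mul0r !subr0 divr1.
have hin : nbhs z (fun x => forall i, i != j -> -1 < h i x < 1).
  apply: near_forall => i; have [->|ij] := eqVneq i j; first by apply: near_sub filterT.
  have /andP [h1 h2] := zi i ij; rewrite -hz0 in h1 h2.
  by apply: near_sub (near_and (near_gt (ch i) h1) (near_lt (ch i) h2)) => x [a1 a2] _; rewrite a1 a2.
have tin : nbhs z (fun x => tau x < 1) by apply: (near_lt (ctau z)); rewrite tz.
apply: near_sub (near_and (near_and others opp) (near_and hin tin)) => x [[x1 x2] [x3 x4]].
have [gx|gx] := leP 0 (g x).
  exists k; apply/celemP => i; have [->|/x1/andP [? ?]] := eqVneq i j; last by rewrite !ltW.
  by move: gx x2; rewrite /g; case: (s); rewrite /sgn => *; apply/andP; split; lra.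
have t0 : 0 < tau x by rewrite /tau -mulrNN -invrN divr_gt0 ?oppr_gt0.
pose y := (1 - tau x)^-1 *: (x - tau x *: ecenter l).
have t1 : 1 - tau x != 0 by rewrite gt_eqF//; lra.
have xE : x = (1 - tau x) *: y + tau x *: ecenter l.
  by rewrite /y scalerA mulfV// scale1r subrK.
have yE i : Finv k y 0 i = h i x.
  have := Finv_comboE k i y (ecenter l) (tau x); rewrite -xE /h => ->.
  by rewrite addrK mulrAC mulfV// mul1r.
have gy : g y = 0.
  have := facet_slack k j s y (ecenter l) (tau x); rewrite -xE -/(g x) -/(g y) -/(g (ecenter l)).
  rewrite /tau mulfVK ?lt_eqF// => /eqP; rewrite -[X in X == _]add0r (inj_eq (addIr _)) eq_sym.
  by rewrite mulf_eq0 (negbTE t1) => /eqP.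
have yj : Finv k y 0 j = sgn R s.
  by move: gy; rewrite /g; case: (s); rewrite /sgn; lra.
exists l; rewrite xE; apply: celem_convex => //.
- by rewrite !ltW.
- apply: sub; apply: mem_facet => //; apply/celemP => i.
  have [->|ij] := eqVneq i j; first by rewrite yj; case: (s); rewrite /sgn; apply/andP; split; lra.
  by rewrite yE; have /andP [? ?] := x3 i ij; rewrite !ltW.
- by apply: elem_celem => //; exact: elem_center.
Qed.

(** If [x] were interior, so would be [z], halfway to the facet centre and in the relative interior
    of the facet. Another element at [z] would be a neighbour across the facet; without one, only
    [k] is near [z], and a step outwards leaves [k] while still in [Omega]. *)
Lemma isbdry_bdry k j s x : isbdry k j s -> celem k x -> Finv k x 0 j = sgn R s -> bdry M x.
Proof.
move=> nb hx xj; apply/(bdryP unitB); split; first by exists k.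
move=> Ox.
pose fc := Fmap k (upd 0 j (sgn R s)).
have fcE i : Finv k fc 0 i = if i == j then sgn R s else 0.
  by rewrite /fc FmapK// !mxE.
have cfc : celem k fc.
  apply/celemP => i; rewrite fcE; case: ifP => _; last by apply/andP; split; lra.
  by case: (s); rewrite /sgn; apply/andP; split; lra.
pose z := (1 - 2^-1) *: x + 2^-1 *: fc.
have [h0 h1] : (0 : R) < 2^-1 /\ (2^-1 : R) < 1 by split; lra.
have Oz : Omega M z by apply: (Omega_segment unitB) => //; [rewrite ltW|exists k].
have hz : celem k z by apply: celem_convex => //; rewrite !ltW.
have zj : Finv k z 0 j = sgn R s by rewrite /z Finv_comboE fcE eqxx xj; lra.
have zi i : i != j -> -1 < Finv k z 0 i < 1.
  move=> ij; rewrite /z Finv_comboE fcE (negbTE ij) mulr0 addr0.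
  by have /celemP/(_ i)/andP [? ?] := hx; apply/andP; split; lra.
have gz : generic_for k z.
  move=> i1 i2 s1 s2 i12 [e1 e2].
  wlog i1j : i1 i2 s1 s2 i12 e1 e2 / i1 != j.
    move=> W; have [i1j|] := eqVneq i1 j; last exact: W e1 e2.
    by apply: (W i2 i1 s2 s1) => //; [rewrite eq_sym|rewrite -i1j eq_sym].
  by have := zi _ i1j; rewrite e1; case: (s1); rewrite /sgn ltxx ?andbF.
have [[m [mk hm]]|nom] := pselect (exists m, k != m /\ celem m z).
  have [j' [s' [nb' zj']]] := shared_facet mk hz hm gz.
  have jj : j' = j.
    apply/eqP/negPn/negP => /zi; rewrite zj'.
    by case: (s'); rewrite /sgn ltxx ?andbF.
  have ss : s' = s.
    by move: zj'; rewrite jj zj; case: (s); case: (s') => //; rewrite /sgn; lra.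
  move/negP: nb; apply; apply/existsP; exists m; by rewrite -jj -ss.
have near_k : nbhs z (fun y => forall m, k != m -> ~ celem m y).
  apply: near_forall => m; have [<-|km] := eqVneq k m; first by apply: near_sub filterT.
  by apply: near_sub (celem_closed unitB (_ : ~ celem m z)) => [y hy _//|hm]; apply: nom; exists m.
have [e e0 H] := near_line (sgn R s *: (ecoord R j *m mB k)) (near_and Oz near_k).
have [] := H (e / 2); first by rewrite gtr0_norm ?divr_gt0//; lra.
move=> [m hm] /(_ m) nm.
have [km|km] := eqVneq k m; last exact: nm km hm.
rewrite -km in hm; have := celem_slack j s hm.
rewrite scalerA scalemxAl Finv_shift//; move: zj; move: (Finv k z) => u uj.
have -> : (u + (e / 2 * sgn R s) *: ecoord R j) 0 j = sgn R s + e / 2 * sgn R s.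
  by rewrite !mxE !eqxx uj mulr1.
by case: (s); rewrite /sgn; lra.
Qed.

Lemma exit_time (S : pred 'I_N) a b : (exists2 k, S k & celem k a) ->
  (forall k, S k -> ~ celem k b) ->
  exists t, [/\ 0 <= t < 1, exists2 k, S k & celem k (a + t *: (b - a)) &
    forall t', t < t' <= 1 -> forall k, S k -> ~ celem k (a + t' *: (b - a))].
Proof.
move=> ha hb.
pose T := [set t : R | 0 <= t <= 1 /\ exists2 k, S k & celem k (a + t *: (b - a))].
have T0 : T 0 by split; [rewrite lexx ler01|rewrite scale0r addr0].
have Tub : ubound T 1 by move=> t [/andP []].
have sT : has_sup T by split; [exists 0|exists 1].
have t0 : 0 <= sup T by apply: ub_le_sup => //; exists 1.
have t1 : sup T <= 1 by apply: ge_sup => //; exists 0.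
have inS : exists2 k, S k & celem k (a + sup T *: (b - a)).
  apply: contrapT => no.
  have : nbhs (a + sup T *: (b - a)) (fun y => forall k, S k -> ~ celem k y).
    apply: near_forall => k; case Sk : (S k); last by apply: near_sub filterT.
    by apply: near_sub (celem_closed unitB (_ : ~ celem k _)) => [y hy _ //|hk]; apply: no; exists k.
  move=> /(near_line (b - a)) [e e0 H].
  have [t [Tt1 [k Sk hk]] te] := sup_adherent e0 sT.
  have tle : t <= sup T by apply: ub_le_sup; [exists 1|split=> //; exists k].
  apply: (H (t - sup T) _ k Sk); first by rewrite ler0_norm ?subr_le0//; lra.
  by rewrite -addrA -scalerDl [sup T + _]addrC subrK.
exists (sup T); split=> //.
- rewrite t0 lt_neqAle t1 andbT; apply/negP => /eqP E.
  have [k Sk] := inS; rewrite E scale1r addrC subrK; exact: hb.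
- move=> t' /andP [tt' t'1] k Sk hk.
  have : t' <= sup T by apply: ub_le_sup; [exists 1|split; [rewrite t'1 andbT; lra|exists k]].
  by rewrite leNgt tt'.
Qed.

Definition adj (xi : pt) k l : bool :=
  `[< [/\ celem k xi, celem l xi & exists j s, nbr k j s l /\ Finv k xi 0 j = sgn R s] >].

Definition exit_face (xi : pt) k :=
  exists j s, isbdry k j s /\ Finv k xi 0 j = sgn R s.

Lemma connect_adj_celem xi k l : celem k xi -> connect (adj xi) k l -> celem l xi.
Proof.
move=> hk /connectP [r hr ->]; elim: r k hk hr => //= l' r IH k hk /andP [/asboolP [_ hl' _]].
exact: IH.
Qed.

Section GenericSegment.
Variable b : pt.

(* For a codimension-two face, an affine function vanishing on the face and at [b]. *)
Let hyper (tau : 'I_N * 'I_d * 'I_d * bool * bool) y : R :=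
  let: (k, i1, i2, s1, s2) := tau in
  if i1 == i2 then 1
  else if Finv k b 0 i1 == sgn R s1 then Finv k y 0 i1 - sgn R s1
  else (Finv k b 0 i2 - sgn R s2) * (Finv k y 0 i1 - sgn R s1)
       - (Finv k b 0 i1 - sgn R s1) * (Finv k y 0 i2 - sgn R s2).

(** If the segment met a face of codimension two at some [t < 1], its starting point would be a zero
    of the corresponding [hyper]. The end [b] stays fixed, which is why [t = 1] is excluded. *)
Lemma generic_segment a (A : set pt) : nbhs a A -> exists2 a', A a' &
  forall k t, 0 <= t < 1 -> generic_for k (a' + t *: (b - a')).
Proof.
move=> nA; have cF k i := @Finv_continuous _ _ M k i.
have [] := @generic_point _ (enum [set: 'I_N * 'I_d * 'I_d * bool * bool]%SET) hyper _ _ a A nA.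
- move=> [[[[k i1] i2] s1] s2] y; rewrite /hyper; case: (i1 == i2); first exact: (@cst_continuous _ _ (1 : R) y).
  have C i s : {for y, continuous (fun y => Finv k y 0 i - sgn R s)}.
    by apply: (@cvgB _ _ _ (nbhs y)); [exact: cF|exact: cvg_cst].
  case: (Finv k b 0 i1 == sgn R s1); first exact: C.
  by apply: (@cvgB _ _ _ (nbhs y)); apply: (@cvgM _ _ (nbhs y)); try exact: cvg_cst; exact: C.
- move=> [[[[k i1] i2] s1] s2] y B nB; rewrite /hyper; case: eqP => [_|/eqP i12].
    by exists y; [exact: nbhs_singleton|exact: oner_neq0].
  have move_ i : exists e : R, 0 < e /\ B (y + e *: (ecoord R i *m mB k)).
    have [e e0 H] := near_line (ecoord R i *m mB k) nB.
    by exists (e / 2); rewrite divr_gt0//; split=> //; apply: H; rewrite gtr0_norm ?divr_gt0//; lra.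
  have shift (e : R) i i' : Finv k (y + e *: (ecoord R i *m mB k)) 0 i' =
      Finv k y 0 i' + e * (i' == i)%:R.
    by rewrite scalemxAl Finv_shift//; move: (Finv k y) => u; rewrite !mxE eqxx.
  case: eqP => [_|/eqP nb].
    have [H|H] := eqVneq (Finv k y 0 i1 - sgn R s1) 0; last by exists y; [exact: nbhs_singleton|].
    have [e [e0 He]] := move_ i1; exists (y + e *: (ecoord R i1 *m mB k)) => //.
    by rewrite shift eqxx mulr1 addrAC H add0r gt_eqF.
  set c1 := Finv k b 0 i2 - _; set c2 := Finv k b 0 i1 - _.
  have c20 : c2 != 0 by rewrite subr_eq0.
  have [H|H] := eqVneq (c1 * (Finv k y 0 i1 - sgn R s1) - c2 * (Finv k y 0 i2 - sgn R s2)) 0;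
    last by exists y; [exact: nbhs_singleton|].
  have [e [e0 He]] := move_ i2; exists (y + e *: (ecoord R i2 *m mB k)) => //.
  rewrite !shift eqxx (negbTE i12) mulr0 mulr1 addr0.
  rewrite (_ : _ - _ = c1 * (Finv k y 0 i1 - sgn R s1) - c2 * (Finv k y 0 i2 - sgn R s2) - c2 * e); last ring.
  by rewrite H add0r oppr_eq0 mulf_neq0// gt_eqF.
move=> a' Aa' Ha'; exists a' => // k t /andP [t0 t1] i1 i2 s1 s2 i12 [e1 e2].
have := Ha' (k, i1, i2, s1, s2); rewrite mem_enum inE => /(_ isT) /=.
rewrite (negbTE i12).
have zE : a' + t *: (b - a') = (1 - t) *: a' + t *: b.
  by apply/rowP => i; rewrite !mxE; ring.
rewrite zE !Finv_comboE in e1 e2.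
have t1' : 1 - t != 0 by rewrite gt_eqF//; lra.
have [eb|_] := eqVneq (Finv k b 0 i1) (sgn R s1).
  rewrite eb in e1; apply/negP; rewrite negbK subr_eq0; apply/eqP.
  by apply: (mulfI t1'); lra.
apply/negP; rewrite negbK; apply/eqP; apply: (mulfI t1'); rewrite mulr0.
move: e1 e2; set f1 := Finv k a' 0 i1; set f2 := Finv k a' 0 i2.
set g1 := Finv k b 0 i1; set g2 := Finv k b 0 i2; set c1 := sgn R s1; set c2 := sgn R s2.
move=> e1 e2; have {}e1 : (1 - t) * (f1 - c1) = - t * (g1 - c1) by rewrite -e1; ring.
have {}e2 : (1 - t) * (f2 - c2) = - t * (g2 - c2) by rewrite -e2; ring.
rewrite mulrBr mulrCA e1 [(1 - t) * (_ * (f2 - _))]mulrCA e2; ring.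
Qed.

End GenericSegment.

(** Follow a generic segment from [k] to [b] up to the last time it is in an element reachable from
    [k]. Any other element there would share a facet and be reachable, so beyond that time the
    segment is uncovered; a relative interior point of a facet with a neighbour has a covered
    neighbourhood, so the facet crossed has none. *)
Lemma star_exit xi k : celem k xi -> exists2 A : set pt, nbhs xi A &
  forall b, A b -> (forall m, connect (adj xi) k m -> ~ celem m b) ->
    ~ covered M b /\ exists2 l, connect (adj xi) k l & exit_face xi l.
Proof.
move=> hk; have /nbhs_box [e e0 He] := near_side M xi.
pose A : set pt := fun y => forall i, `|xi 0 i - y 0 i| < e.
have nA : nbhs xi A by apply/nbhs_box; exists e.
exists A => // b Ab nb.
have [a0 ka0 Aa0] := celem_approx unitB hk nA.
have nA0 : nbhs a0 A.
  apply/nbhs_box; pose e' := \big[Num.min/e]_i (e - `|xi 0 i - a0 0 i|).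
  have e'i i : e' <= e - `|xi 0 i - a0 0 i| by rewrite /e' (bigD1 i)//= ge_min lexx.
  exists e' => [|y hy i].
    by rewrite /e'; elim/big_ind: _ => // [u v *|i _]; [rewrite lt_min; apply/andP|rewrite subr_gt0].
  have := le_lt_trans (ler_distD (a0 0 i) (xi 0 i) (y 0 i)) (_ : _ < e); apply.
  by rewrite -ltrBrDl (lt_le_trans (hy i)).
have [a [ka Aa] gen] := generic_segment b (near_and (elem_open unitB ka0) nA0).
have cka := elem_celem unitB ka.
have [] := @exit_time (connect (adj xi) k) a b; [by exists k|exact: nb|].
move=> t [ht [k' Sk' hk'] out]; set z := a + t *: (b - a) in hk'.
have Az : A z.
  move=> i; rewrite !mxE (_ : _ - _ = (1 - t) * (xi 0 i - a 0 i) + t * (xi 0 i - b 0 i)); last ring.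
  have := Aa i; have := Ab i; rewrite !ltr_norml => /andP [? ?] /andP [? ?].
  have ht' : 0 <= t <= 1 by case/andP: ht => -> /ltW.
  by rewrite convex_gt2 ?convex_lt2.
(* From here on, every facet or element met at the exit point [z] is known to contain [xi] as
   well. *)
have side := He z Az.
have back m i s : Finv m z 0 i = sgn R s -> Finv m xi 0 i = sgn R s.
  move=> E; have [h1 h2] := side m i s.
  by case: (ltgtP (Finv m xi 0 i) (sgn R s)) => // [/h1|/h2]; rewrite E ltxx.
have star m : celem m z -> celem m xi.
  move=> /celemP hm; apply/celemP => i; have /andP [h1 h2] := hm i.
  have [_ h3] := side m i true; have [h4 _] := side m i false.
  rewrite !leNgt; apply/andP; split; apply/negP => h.
    by have := h4 h; rewrite ltNge h1.
  by have := h3 h; rewrite ltNge h2.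
have hk'xi := star _ hk'.
have noS m : ~~ connect (adj xi) k m -> ~ celem m z.
  move=> nm hm; have km : k' != m by apply: contraNneq nm => <-.
  have [j [s [njs zj]]] := shared_facet km hk' hm (gen k' t ht).
  move/negP: nm; apply; apply: connect_trans Sk' (connect1 _); apply/asboolP; split=> //.
    exact: star.
  by exists j, s; split=> //; exact: back.
have : nbhs z (fun y => forall m, ~~ connect (adj xi) k m -> ~ celem m y).
  apply: near_forall => m; case Sm : (connect (adj xi) k m); first by apply: near_sub filterT.
  by apply: near_sub (celem_closed unitB (noS m _)) => [y hy _ //|]; rewrite Sm.
move=> nearS.
(* Just after the exit time the segment is in no reachable element by [out] and in no other one by
   [nearS]. *)
have uncov (B : set pt) : nbhs z B -> exists t', [/\ 0 <= t' <= 1,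
    B (a + t' *: (b - a)) & ~ covered M (a + t' *: (b - a))].
  move=> nB; have [e1 e10 H1] := near_line (b - a) (near_and nB nearS).
  pose u := Num.min (e1 / 2) (1 - t).
  have u0 : 0 < u by rewrite lt_min divr_gt0//=; lra.
  have ue : u < e1.
    by rewrite gt_min; apply/orP; left; lra.
  have u1 : u <= 1 - t by rewrite ge_min lexx orbT.
  have zE : z + u *: (b - a) = a + (t + u) *: (b - a) by rewrite scalerDl addrA.
  have hu : `|u| < e1 by rewrite gtr0_norm.
  have [B1 B2] := H1 u hu; rewrite zE in B1 B2.
  exists (t + u); split=> //; first by apply/andP; split; lra.
  move=> [m hm]; case Sm : (connect (adj xi) k m); last by apply: (B2 m) => //; rewrite Sm.
  by apply: (out (t + u) _ m Sm hm); apply/andP; split; lra.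
(* With [b] covered, convexity would keep the whole segment covered, against [uncov]. *)
have ncb : ~ covered M b.
  move=> cb; have [t' [ht' _]] := uncov setT (@filterT _ (nbhs z) _); apply.
  have -> : a + t' *: (b - a) = (1 - t') *: a + t' *: b.
    by apply/rowP => i; rewrite !mxE; ring.
  by apply: (covered_convex unitB convO) => //; exists k.
split=> //.
have [j [s zj]] : exists j s, Finv k' z 0 j = sgn R s.
  apply: contrapT => nf.
  have ez : elem k' z.
    apply/elemP => i; have /celemP/(_ i)/andP [h1 h2] := hk'.
    rewrite !lt_neqAle h1 h2 !andbT; apply/andP; split; apply/negP => /eqP E; apply: nf.
      by exists i, false; rewrite -E.
    by exists i, true.
  have [t' [_ h1 h2]] := uncov _ (elem_open unitB ez); apply: h2.
  by exists k'; exact: elem_celem.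
exists k' => //; exists j, s; split; last exact: back.
apply/negP => /existsP [l nl].
have zi i : i != j -> -1 < Finv k' z 0 i < 1.
  move=> ij; have /celemP/(_ i)/andP [h1 h2] := hk'.
  rewrite !lt_neqAle h1 h2 !andbT; apply/andP; split; apply/negP => /eqP E.
    by apply: (gen k' t ht i j false s ij); rewrite -/z -E.
  by apply: (gen k' t ht i j true s ij).
have [t' [_ h1 h2]] := uncov _ (facet_cover nl hk' zj zi).
exact: h2.
Qed.

(** A point [b] of the open element [l] near [xi] lies in no other closed element. Were [l]
    unreachable from [k], [star_exit] would make [b] uncovered. *)
Lemma star_connected xi k l : celem k xi -> celem l xi -> connect (adj xi) k l.
Proof.
move=> hk hl; have [A nA H] := star_exit hk.
have [b lb Ab] := celem_approx unitB hl nA.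
apply: contrapT => nl; have [] := H b Ab.
  move=> m hm cm; apply: nl; by rewrite (elem_celem_inj lb cm).
by case; exists l; exact: elem_celem.
Qed.

(** A covered point outside [Omega] has uncovered points arbitrarily close to it; any of them serves
    as [b] in [star_exit]. *)
Lemma bdry_exit xi k : bdry M xi -> celem k xi -> exists2 l, celem l xi & exit_face xi l.
Proof.
move=> /(bdryP unitB) [_ nO] hk; have [A nA H] := star_exit hk.
have [b Ab nb] : exists2 b, A b & ~ covered M b.
  apply: contrapT => nb; apply: nO; apply: near_sub nA => y Ay.
  by apply: contrapT => ny; apply: nb; exists y.
have [|_ [l hl fl]] := H b Ab; first by move=> m _ hm; apply: nb; exists m.
by exists l => //; exact: connect_adj_celem hl.
Qed.

End Connectivity.

(** * Euclidean norm and Cauchy-Schwarz inequality *)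

Section EuclideanNorm.
Variables (R : realType) (d : nat).
Local Notation pt := 'rV[R]_d.
Implicit Types u v : pt.

Lemma sum_CauchySchwarz (I : finType) (w f g : I -> R) : (forall i, 0 <= w i) ->
  (\sum_i w i * (f i * g i)) ^+ 2 <=
  (\sum_i w i * f i ^+ 2) * (\sum_i w i * g i ^+ 2).
Proof.
move=> w0; set B := \sum_i _ * (_ * _); set A := \sum_i w i * f i ^+ 2.
set C := \sum_i _.
have C0 : 0 <= C by apply: sumr_ge0 => i _; rewrite mulr_ge0 ?sqr_ge0.
have H s t : 0 <= s ^+ 2 * A - 2 * s * t * B + t ^+ 2 * C.
  rewrite (_ : _ + _ = \sum_i w i * (s * f i - t * g i) ^+ 2).
    by apply: sumr_ge0 => i _; rewrite mulr_ge0 ?sqr_ge0.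
  rewrite /A /B /C !mulr_sumr -sumrB -big_split /=.
  by apply: eq_bigr => i _; ring.
have [C00|Cn] := eqVneq C 0; last first.
  have Cp : 0 < C by rewrite lt_neqAle eq_sym Cn.
  have := H C B; rewrite (_ : _ + _ = C * (A * C - B ^+ 2)); last ring.
  by rewrite pmulr_rge0// subr_ge0.
have [->|B0] := eqVneq B 0; first by rewrite expr0n mulr_ge0//; apply: sumr_ge0 => i _; rewrite mulr_ge0 ?sqr_ge0.
(* With [C = 0] the form is affine in its second argument; at this value it would be
   [A - (A + 1) = -1]. *)
have := H 1 ((A + 1) / (2 * B)); rewrite C00 mulr0 addr0 expr1n mul1r mulr1.
rewrite (_ : 2 * ((A + 1) / (2 * B)) * B = A + 1); last by field; rewrite B0.
lra.
Qed.

Lemma dot_ge0 u : 0 <= dot u u.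
Proof. by apply: sumr_ge0 => i _; rewrite -expr2 sqr_ge0. Qed.

Lemma enorm_sqr u : enorm u ^+ 2 = dot u u.
Proof. by rewrite sqr_sqrtr// dot_ge0. Qed.

Lemma enorm_ge0 u : 0 <= enorm u. Proof. exact: sqrtr_ge0. Qed.

Lemma dot_sqr_le u v : dot u v ^+ 2 <= dot u u * dot v v.
Proof.
have := @sum_CauchySchwarz _ (fun=> 1) (fun i => u 0 i) (fun i => v 0 i) (fun=> ler01).
by rewrite /dot; under eq_bigr do rewrite mul1r; under [X in _ <= X * _ -> _]eq_bigr do rewrite mul1r expr2;
  under [X in _ <= _ * X -> _]eq_bigr do rewrite mul1r expr2.
Qed.

Lemma dot_le u v : `|dot u v| <= enorm u * enorm v.
Proof.
rewrite -(@ler_pXn2r _ 2)// ?nnegrE ?mulr_ge0 ?enorm_ge0//.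
by rewrite exprMn !enorm_sqr real_normK ?num_real// dot_sqr_le.
Qed.

Lemma coord_le_enorm u i : `|u 0 i| <= enorm u.
Proof.
rewrite -(@ler_pXn2r _ 2)// ?nnegrE ?enorm_ge0// enorm_sqr real_normK ?num_real//.
rewrite /dot (bigD1 i)//= -expr2 lerDl; apply: sumr_ge0 => j _.
by rewrite -expr2 sqr_ge0.
Qed.

Lemma enorm_le_sum u : enorm u <= \sum_i `|u 0 i|.
Proof.
have s0 : 0 <= \sum_i `|u 0 i| by exact: sumr_ge0.
rewrite -(@ler_pXn2r _ 2)// ?nnegrE ?enorm_ge0// enorm_sqr /dot expr2 mulr_suml.
apply: ler_sum => i _; apply: (le_trans (ler_norm _)).
rewrite normrM ler_wpM2l// (bigD1 i)//= lerDl; exact: sumr_ge0.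
Qed.

Lemma enormZ (c : R) u : enorm (c *: u) = `|c| * enorm u.
Proof.
rewrite /enorm -sqrtr_sqr -sqrtrM ?sqr_ge0//; congr Num.sqrt.
by rewrite /dot mulr_sumr; apply: eq_bigr => i _; rewrite !mxE; ring.
Qed.

End EuclideanNorm.

(** * Quantitative consequences of shape regularity and quasi-uniformity *)

Section ShapeRegularity.
Variables (R : realType) (d : nat).
Local Notation pt := 'rV[R]_d.
Hypothesis d0 : (0 < d)%N.
Variables (M : mesh R d) (Csr Cqu : R).
Local Notation N := (nel M).
Hypotheses (Csr1 : 1 <= Csr) (Cqu1 : 1 <= Cqu).
Hypothesis unitB : forall k : 'I_N, mB k \in unitmx.
Hypothesis disj : forall k l : 'I_N, k != l -> setI (elem k) (elem l) = set0.
Hypothesis inball : forall k : 'I_N, exists c : pt, forall y, enorm (y - c) < diam k / Csr -> elem k y.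
Hypothesis quasi : forall k : 'I_N, hmax M <= Cqu * diam k.
Implicit Types (k l m : 'I_N) (i j : 'I_d) (s : bool) (x y z : pt).
Local Notation h := (hmax M).

Lemma diam_bound k x y : celem k x -> celem k y -> enorm (x - y) <= diam k.
Proof.
move=> [x' hx <-] [y' hy <-]; apply: ub_le_sup; last by exists x', y'.
exists (\sum_i \sum_j 2 * `|mB k j i|) => _ [u [v [hu [hv ->]]]].
apply: (le_trans (enorm_le_sum _)); apply: ler_sum => i _.
rewrite /Fmap opprD addrACA subrr addr0 -mulmxBl mxE.
apply: (le_trans (ler_norm_sum _ _ _)); apply: ler_sum => j _.
rewrite normrM ler_wpM2r// !mxE ler_norml.
by have /andP [? ?] := hu j; have /andP [? ?] := hv j; apply/andP; split; lra.
Qed.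

Lemma row_le_diam k i : enorm (row i (mB k)) <= diam k.
Proof.
have cc (t : R) : -1 <= t <= 1 -> ccube (t *: delta_mx 0 i : pt).
  move=> ht j; rewrite !mxE eqxx /=; case: eqP => _; rewrite ?mulr1 ?mulr0//.
  by apply/andP; split; lra.
have := @diam_bound k (Fmap k (delta_mx 0 i)) (Fmap k 0).
rewrite /Fmap opprD addrACA subrr addr0 -mulmxBl subr0 -rowE; apply.
  exists (delta_mx 0 i); last by rewrite /Fmap rowE.
  have H := cc 1; rewrite scale1r in H; apply: (H _).
  by apply/andP; split; lra.
by exists 0 => // j; rewrite mxE; apply/andP; split; lra.
Qed.

Lemma diam_gt0 k : 0 < diam k.
Proof.
pose i := Ordinal d0; rewrite lt_neqAle (le_trans (enorm_ge0 _) (row_le_diam k i)) andbT.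
apply/negP => /eqP D0.
have r0 : row i (mB k) = 0.
  apply/rowP => j; apply/eqP; rewrite [X in _ == X]mxE -normr_le0.
  by rewrite (le_trans (coord_le_enorm _ _))// D0 row_le_diam.
have := mulmxV (unitB k) => /(congr1 (row i)); rewrite row_mul r0 mul0mx row1.
by move/rowP/(_ i); rewrite !mxE !eqxx => /eqP; rewrite eq_sym oner_eq0.
Qed.

Lemma diam_le_hmax k : diam k <= h.
Proof. by rewrite /hmax (bigD1 k)//= le_max lexx. Qed.

Lemma hmax_gt0 k : 0 < h.
Proof. exact: lt_le_trans (diam_gt0 k) (diam_le_hmax k). Qed.

Definition Kinv : R := 4 * Csr * Cqu.

Lemma Kinv_ge1 : 1 <= Kinv.
Proof. by have := Csr1; have := Cqu1; rewrite /Kinv; nra. Qed.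

Lemma mB_le k i j : `|mB k i j| <= h.
Proof.
have := coord_le_enorm (row i (mB k)) j; rewrite mxE => H.
exact: le_trans H (le_trans (row_le_diam k i) (diam_le_hmax k)).
Qed.

(** With [rho = diam k / Csr], the ball contains [c] and [c + (rho / 2) e_i]. Their reference
    coordinates differ by less than 2, so the entry is at most [4 / rho], and quasi-uniformity turns
    [rho] into [h / (Csr * Cqu)]. *)
Lemma invB_le k i j : `|invmx (mB k) i j| <= Kinv / h.
Proof.
have [c hc] := inball k; have D0 := diam_gt0 k; have h0 := hmax_gt0 k.
pose rho := diam k / Csr; have Cs0 : 0 < Csr by exact: lt_le_trans Csr1.
have r0 : 0 < rho by rewrite divr_gt0.
have ec : elem k c by apply: hc; rewrite subrr /enorm /dot big1 ?sqrtr0// => ? _; rewrite mxE mul0r.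
have ey : elem k (c + (rho / 2) *: delta_mx 0 i).
  apply: hc; rewrite addrC addKr enormZ gtr0_norm ?divr_gt0//.
  rewrite (_ : enorm _ = 1) ?mulr1; first by rewrite ltr_pdivrMr// ltr_pMr// ltr1n.
  rewrite /enorm /dot (bigD1 i)//= big1 ?addr0 ?mxE ?eqxx ?mulr1 ?sqrtr1//.
  by move=> j' /negbTE ij; rewrite mxE ij andbF mul0r.
move/(elemP unitB): ec => /(_ j) /andP [c1 c2].
move/(elemP unitB): ey => /(_ j); rewrite /Finv addrAC mulmxDl -scalemxAl -rowE.
rewrite [X in _ < X < _]mxE -/(Finv k c) => /andP [e1 e2].
rewrite [X in _ + X]mxE [X in _ + _ * X]mxE in e1 e2.
set q := invmx _ i j in e1 e2 *; set f := Finv _ _ _ _ in c1 c2 e1 e2.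
have qb : `|q| <= 4 / rho.
  rewrite ler_pdivlMr// -[X in _ * X](gtr0_norm r0) -normrM ler_norml.
  by apply/andP; split; lra.
apply: (le_trans qb); rewrite ler_pdivrMr// mulrAC ler_pdivlMr// /rho /Kinv.
have := quasi k; have E : diam k = rho * Csr by rewrite /rho divfK// gt_eqF.
rewrite mulrAC (_ : 4 * Csr * (diam k / Csr) = 4 * diam k); last by field; rewrite gt_eqF.
by move=> hq; nra.
Qed.

Lemma det_le (A : 'M[R]_d) c : (forall i j, `|A i j| <= c) -> `|\det A| <= #|{perm 'I_d}|%:R * c ^+ d.
Proof.
move=> H; rewrite /determinant; apply: (le_trans (ler_norm_sum _ _ _)).
rewrite mulr_natl -sumr_const; apply: ler_sum => s _.
rewrite normrM normr_sign mul1r normr_prod -[X in _ <= _ ^+ X](card_ord d) -prodr_const.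
by apply: ler_prod => i _; rewrite normr_ge0 H.
Qed.

Definition Kdet : R := #|{perm 'I_d}|%:R ^+ 2 * Kinv ^+ d.

Lemma det_gt0 k : 0 < `|\det (mB k)|.
Proof. by rewrite normr_gt0 -unitfE -unitmxE. Qed.

Lemma Kdet_ge0 : 0 <= Kdet.
Proof. by rewrite mulr_ge0 ?sqr_ge0// exprn_ge0// (le_trans ler01 Kinv_ge1). Qed.

(** The Leibniz formula bounds the determinant of [mB k] by [d! h^d] and that of the inverse of
    [mB l] by [d! (Kinv / h)^d]; the powers of [h] cancel. *)
Lemma det_compare k l : `|\det (mB k)| <= Kdet * `|\det (mB l)|.
Proof.
have h0 := hmax_gt0 k.
have H1 := det_le (mB_le k); have H2 := det_le (invB_le l).
have E : `|\det (mB l)| * `|\det (invmx (mB l))| = 1.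
  by rewrite -normrM -det_mulmx mulmxV// det1 normr1.
set c := #|_|%:R in H1 H2 *.
apply: (le_trans H1); rewrite /Kdet -/c -[X in X <= _]mulr1 -E.
rewrite mulrCA [X in _ <= X]mulrC ler_pM2l ?det_gt0//.
have c0 : 0 <= c * h ^+ d by rewrite mulr_ge0// exprn_ge0// ltW.
apply: (le_trans (ler_wpM2l c0 H2)); rewrite le_eqVlt; apply/orP; left; apply/eqP.
by rewrite expr_div_n; field; rewrite expf_neq0// gt_eqF.
Qed.

Lemma nvecE k j i : nvec k j 0 i = invmx (mB k) i j.
Proof. by rewrite /nvec /ecoord -rowE !mxE. Qed.

Lemma nvec_le k j : enorm (nvec k j) <= d%:R * Kinv / h.
Proof.
apply: (le_trans (enorm_le_sum _)).
apply: (@le_trans _ _ (\sum_(i < d) Kinv / h)).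
  by apply: ler_sum => i _; rewrite nvecE invB_le.
by rewrite sumr_const card_ord -mulrA mulr_natl.
Qed.

(** [nvec k j] has inner product 1 with row [j] of [mB k], an edge vector of length at most [h].
    Together with [nvec_le], this makes the facet scale comparable to the element determinant
    divided by [h]. *)
Lemma nvec_ge k j : h^-1 <= enorm (nvec k j).
Proof.
have h0 := hmax_gt0 k.
have E : dot (row j (mB k)) (nvec k j) = 1.
  have /matrixP /(_ j j) E1 := mulmxV (unitB k); rewrite !mxE eqxx in E1.
  rewrite -[RHS]E1.
  by apply: eq_bigr => i _; rewrite nvecE mxE.
have := dot_le (row j (mB k)) (nvec k j); rewrite E normr1 => H.
rewrite -[X in X <= _]mul1r ler_pdivrMr// mulrC; apply: (le_trans H).
by rewrite ler_wpM2r ?enorm_ge0// (le_trans (row_le_diam _ _))// diam_le_hmax.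
Qed.

Lemma nvec_gt0 k j : 0 < enorm (nvec k j).
Proof. by apply: lt_le_trans (nvec_ge k j); rewrite invr_gt0 (hmax_gt0 k). Qed.

Lemma enorm_nrm k j s : enorm (nrm k j s) = 1.
Proof.
have n0 := nvec_gt0 k j; rewrite /nrm enormZ normrM normfV (gtr0_norm n0).
by rewrite divfK ?gt_eqF//; case: s; rewrite /sgn ?normrN normr1.
Qed.

Definition maxstar : nat := (Num.truncn (2 * d%:R * (Csr * Cqu))).+1 ^ d.

(* Inscribed balls of the elements around [xi] have comparable radii and are disjoint;
   a grid of mesh smaller than their radius separates their centres. *)
Lemma card_star (xi : pt) : (#|[set l : 'I_N | `[< celem l xi >]]%SET| <= maxstar)%N.
Proof.
set S := [set l : 'I_N | _]%SET.
have [->|[k0 _]] := set_0Vmem S; first by rewrite cards0.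
have h0 := hmax_gt0 k0.
have [c hc] := choice inball.
pose K := Num.truncn (2 * d%:R * (Csr * Cqu)).
have [Cs0 Cq0] : 0 < Csr /\ 0 < Cqu by split; [exact: lt_le_trans Csr1|exact: lt_le_trans Cqu1].
have C0 : 0 < Csr * Cqu by rewrite mulr_gt0.
pose r := h / (Csr * Cqu); have r0 : 0 < r by rewrite divr_gt0.
have rle l : r <= diam l / Csr.
  rewrite /r ler_pdivrMr// mulrA divfK; last by rewrite gt_eqF.
  by rewrite mulrC.
have ec l : elem l (c l).
  apply: hc; rewrite subrr (_ : enorm 0 = 0) ?divr_gt0 ?diam_gt0//.
  by rewrite /enorm /dot big1 ?sqrtr0// => ? _; rewrite mxE mul0r.
pose delta := r / d%:R; have dR : 0 < d%:R :> R by rewrite ltr0n.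
have de0 : 0 < delta by rewrite divr_gt0.
pose t l i := (c l 0 i - xi 0 i + h) / delta.
have tb l i : l \in S -> 0 <= t l i <= 2 * d%:R * (Csr * Cqu).
  rewrite inE => /asboolP hl.
  have H := diam_bound (elem_celem unitB (ec l)) hl.
  have := le_trans (coord_le_enorm _ i) (le_trans H (diam_le_hmax l)).
  rewrite !mxE ler_norml => /andP [h1 h2].
  rewrite /t divr_ge0 ?(ltW de0)//=; last lra.
  rewrite ler_pdivrMr// /delta /r.
  rewrite (_ : _ * (_ / d%:R) = 2 * h); first lra.
  by field; rewrite !gt_eqF.
pose cell l : {ffun 'I_d -> 'I_K.+1} := [ffun i => inord (Num.truncn (t l i))].
suff inj : {in S &, injective cell}.
  by have := @leq_card_in _ _ cell _ inj; rewrite card_ffun !card_ord.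
move=> l m lS mS /ffunP E; apply/eqP/negPn/negP => lm.
have close i : `|c m 0 i - c l 0 i| < delta.
  have /andP [a1 a2] := tb l i lS; have /andP [b1 b2] := tb m i mS.
  have := congr1 (@nat_of_ord _) (E i); rewrite !ffunE !inordK ?ltnS ?le_truncn// => Et.
  have /andP [u1 u2] := truncn_itv a1; have /andP [v1 v2] := truncn_itv b1.
  rewrite -Et -natr1 in v1 v2; rewrite -natr1 in u2.
  have : `|t m i - t l i| < 1 by rewrite ltr_norml; apply/andP; split; lra.
  rewrite /t -mulrBl normrM [`|delta^-1|]gtr0_norm ?invr_gt0// ltr_pdivrMr// mul1r.
  by rewrite (_ : _ - _ = c m 0 i - c l 0 i)//; ring.
have : enorm (c m - c l) < r.
  apply: (le_lt_trans (enorm_le_sum _)).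
  apply: (@lt_le_trans _ _ (\sum_(i < d) delta)); last first.
    by rewrite sumr_const card_ord -mulr_natl /delta mulrCA mulfV ?mulr1// gt_eqF.
  apply: ltr_sum => [|i _]; last by rewrite !mxE close.
  by apply/hasP; exists (Ordinal d0); rewrite ?mem_index_enum.
move=> /lt_le_trans /(_ (rle l)) /hc em.
by have := disj lm; rewrite -subset0 => /(_ (c m)); apply; split; last exact: ec.
Qed.

End ShapeRegularity.

(** * Matching of neighbouring elements *)

Section SignedPermutation.
Variables (R : realType) (d : nat).
Local Notation pt := 'rV[R]_d.
Implicit Types (x y : pt) (i j : 'I_d) (s : bool).

Lemma updE x j t i : upd x j t 0 i = if i == j then t else x 0 i.
Proof. exact: mxE. Qed.

Let itv1 (u : R) : u = 1 -> (-1 : R) <= u <= 1.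
Proof. by move=> ->; rewrite lexx (le_trans (lerN10 R) ler01). Qed.

Let itvN1 (u : R) : u = -1 -> (-1 : R) <= u <= 1.
Proof. by move=> ->; rewrite lexx (le_trans (lerN10 R) ler01). Qed.

Let itv0 (u : R) : u = 0 -> (-1 : R) <= u <= 1.
Proof. by move=> ->; rewrite lerN10 ler01. Qed.

Lemma ccube_sgn x : (forall j, exists s, x 0 j = sgn R s) -> ccube x.
Proof.
move=> H j; have [s ->] := H j.
by case: s; rewrite /sgn; apply/andP; split; lra.
Qed.

Section AffineFaces.
Variables (A : 'M[R]_d) (t : pt) (sig tau : 'I_d -> option bool).
Hypothesis unitA : A \in unitmx.
Let T x := x *m A + t.
Hypothesis into : forall x, rface sig x -> rface tau (T x).
Hypothesis onto : forall y, rface tau y -> exists2 x, rface sig x & T x = y.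

Let TE x i : T x 0 i = \sum_j x 0 j * A j i + t 0 i.
Proof. by rewrite /T mxE [X in X + _]mxE. Qed.

Let vertex x := rface sig x /\ forall j, exists s, x 0 j = sgn R s.

Let rface_upd_free x j (u : R) : rface sig x -> sig j = None -> -1 <= u <= 1 ->
  rface sig (upd x j u).
Proof.
move=> [hx fx] sj hu; split=> i; rewrite mxE; case: eqP => // [->|_].
  by rewrite sj.
exact: fx.
Qed.

Let T_upd x j u i : T (upd x j u) 0 i = T x 0 i + (u - x 0 j) * A j i.
Proof.
rewrite !TE (bigD1 j)//= [X in _ = X + _ + _](bigD1 j)//= upd_id.
rewrite (eq_bigr (fun l => x 0 l * A l i)); last by move=> l lj; rewrite mxE (negbTE lj).
by ring.
Qed.

Let vertex_upd x j s : vertex x -> sig j = None -> vertex (upd x j (sgn R s)).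
Proof.
move=> [fx vx] sj; split.
  by apply: rface_upd_free => //; case: s; rewrite /sgn; apply/andP; split; lra.
by move=> l; rewrite mxE; case: eqP => _; [exists s|].
Qed.

Let x0 : pt := \row_j (if sig j is Some s then sgn R s else 1).

Let vertex_x0 : vertex x0.
Proof.
have v : forall j, exists s, x0 0 j = sgn R s.
  by move=> j; rewrite mxE; case: (sig j) => [s|]; [exists s|exists true].
split=> //; split; first exact: ccube_sgn.
by move=> j; case E : (sig j) => [s|] //; rewrite mxE E.
Qed.

(* Extreme points are mapped to extreme points. *)
Let vertex_image x i : vertex x -> exists s, T x 0 i = sgn R s.
Proof.
move=> [fx vx]; have [cT fT] := into fx.
case E : (tau i) => [s|]; first by exists s; have := fT i; rewrite E.
have /andP [h1 h2] := cT i.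
have [e1|n1] := eqVneq (T x 0 i) 1; first by exists true.
have [e2|n2] := eqVneq (T x 0 i) (-1); first by exists false.
have l1 : T x 0 i < 1 by rewrite lt_neqAle n1.
have l2 : -1 < T x 0 i by rewrite lt_neqAle eq_sym n2.
pose e := Num.min (1 - T x 0 i) (T x 0 i + 1).
have e0 : 0 < e by rewrite lt_min; apply/andP; split; lra.
have [ea eb] : e <= 1 - T x 0 i /\ e <= T x 0 i + 1.
  by split; rewrite ge_min lexx ?orbT.
have fu (u : R) : -1 <= u <= 1 -> rface tau (upd (T x) i u).
  move=> hu; split=> l; rewrite mxE; case: eqP => // [->|_]; first by rewrite E.
  exact: fT.
have hp : -1 <= T x 0 i + e <= 1 by apply/andP; split; lra.
have hm : -1 <= T x 0 i - e <= 1 by apply/andP; split; lra.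
have [y1 [c1 _] T1] := onto (fu _ hp); have [y2 [c2 _] T2] := onto (fu _ hm).
have sum2 : y1 + y2 = 2 *: x.
  have : (y1 + y2 - 2 *: x) *m A = 0.
    have E1 : (y1 + y2 - 2 *: x) *m A = T y1 + T y2 - 2 *: T x.
      rewrite /T mulmxBl mulmxDl -scalemxAl scalerDr.
      by apply/rowP => l; rewrite !mxE; ring.
    rewrite E1 T1 T2; apply/rowP => l; rewrite !mxE.
    by case: eqP => [->|_]; rewrite ?TE; ring.
  move/(congr1 (mulmx^~ (invmx A))); rewrite mulmxK// mul0mx.
  by move/eqP; rewrite subr_eq0 => /eqP.
have y1x : y1 = x.
  apply/rowP => l; have /rowP /(_ l) := sum2; rewrite !mxE.
  have /andP [? ?] := c1 l; have /andP [? ?] := c2 l.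
  by have [s ->] := vx l; case: s; rewrite /sgn; lra.
have := congr1 (fun z : pt => z 0 i) T1; rewrite /= y1x upd_id; lra.
Qed.

Let T_bound x i : rface sig x -> -1 <= T x 0 i <= 1.
Proof. by move/into => [/(_ i)]. Qed.

Let slope i j : sig j = None -> A j i = 0 \/ A j i = 1 \/ A j i = -1.
Proof.
move=> sj; have v1 := vertex_upd true vertex_x0 sj; have v2 := vertex_upd false vertex_x0 sj.
have [s1] := vertex_image i v1; have [s2] := vertex_image i v2.
rewrite !T_upd /=; case: s1; case: s2; rewrite /sgn => *;
  [left|right; left|right; right|left]; lra.
Qed.

Let slope_uniq i j1 j2 : sig j1 = None -> sig j2 = None -> A j1 i != 0 -> A j2 i != 0 -> j1 = j2.
Proof.
move=> f1 f2 n1 n2; apply/eqP/negPn/negP => j12.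
have bnd (u1 u2 : R) : -1 <= u1 <= 1 -> -1 <= u2 <= 1 ->
    -1 <= T x0 0 i + (u1 - x0 0 j1) * A j1 i + (u2 - x0 0 j2) * A j2 i <= 1.
  move=> h1 h2; have := T_bound i (rface_upd_free (rface_upd_free vertex_x0.1 f1 h1) f2 h2).
  by rewrite !T_upd updE eq_sym (negbTE j12).
move: {bnd} (T x0 0 i) (x0 0 j1) (x0 0 j2) (A j1 i) (A j2 i) n1 n2 (slope i f1) (slope i f2) (bnd _ _ (itv1 erefl) (itv1 erefl)) (bnd _ _ (itv1 erefl) (itvN1 erefl)) (bnd _ _ (itvN1 erefl) (itv1 erefl)) (bnd _ _ (itvN1 erefl) (itvN1 erefl)).
move: j12 => _; clear f1 f2 => T0 y1 y2 A1 A2 n1 n2 [e|[e|e]]; first by rewrite e eqxx in n1.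
  by move=> [e'|[e'|e']]; [by rewrite e' eqxx in n2| |]; rewrite e' e => /andP [? ?] /andP [? ?] /andP [? ?] /andP [? ?]; lra.
by move=> [e'|[e'|e']]; [by rewrite e' eqxx in n2| |]; rewrite e' e => /andP [? ?] /andP [? ?] /andP [? ?] /andP [? ?]; lra.
Qed.

Let T_face x i : rface sig x -> T x 0 i = T x0 0 i + \sum_(j | sig j == None) (x 0 j - x0 0 j) * A j i.
Proof.
move=> [_ fx]; rewrite !TE addrAC; congr (_ + _).
rewrite [X in X = _](bigID (fun j => sig j == None)) [X in _ = X + _](bigID (fun j => sig j == None)) /=.
rewrite addrAC -big_split /=; congr (_ + _).
  by apply: eq_bigr => j _; ring.
apply: eq_bigr => j; case E : (sig j) => [s|] // _; have := fx j; rewrite E => ->.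
by rewrite mxE E.
Qed.

(** Vertices are sent to values 1 or -1, so the slope along a free direction is 0, 1 or -1. Two
    non-zero slopes would sweep an interval of length 4, exceeding the range; a single one sweeps
    the whole range, which forces the offset to vanish. *)
Lemma face_coordinate i :
  (exists2 s, forall x, rface sig x -> T x 0 i = sgn R s & True) \/
  (exists j s, sig j = None /\ forall x, rface sig x -> T x 0 i = sgn R s * x 0 j).
Proof.
have [[j [fj nj]]|no] := pselect (exists j, sig j = None /\ A j i != 0); last first.
  have [s hs] := vertex_image i vertex_x0; left; exists s => // x fx.
  rewrite (T_face i fx) hs big1 ?addr0// => j /eqP fj.
  have [->|n] := eqVneq (A j i) 0; first by rewrite mulr0.
  by case: no; exists j.
have E x : rface sig x -> T x 0 i = T x0 0 i + (x 0 j - x0 0 j) * A j i.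
  move=> fx; rewrite (T_face i fx) (bigD1 j) ?fj//= big1 ?addr0// => l /andP [/eqP fl lj].
  have [->|n] := eqVneq (A l i) 0; first by rewrite mulr0.
  by rewrite (slope_uniq fl fj n nj) eqxx in lj.
right; have bnd (u : R) : -1 <= u <= 1 -> -1 <= T x0 0 i + (u - x0 0 j) * A j i <= 1.
  move=> hu; have := T_bound i (rface_upd_free vertex_x0.1 fj hu).
  by rewrite T_upd.
have b1 := bnd _ (itv1 erefl); have b2 := bnd _ (itvN1 erefl).
have [e|[e|e]] := slope i fj; first by rewrite e eqxx in nj.
  exists j, true; split=> // x fx; rewrite E// e /sgn.
  by move: b1 b2; rewrite e; lra.
exists j, false; split=> // x fx; rewrite E// e /sgn.
by move: b1 b2; rewrite e; lra.
Qed.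

Let free_values i1 i2 u1 u2 : tau i1 = None -> tau i2 = None -> i1 != i2 ->
  -1 <= u1 <= 1 -> -1 <= u2 <= 1 ->
  exists x, [/\ rface sig x, T x 0 i1 = u1 & T x 0 i2 = u2].
Proof.
move=> f1 f2 i12 h1 h2.
have fy : rface tau (upd (upd (T x0) i1 u1) i2 u2).
  have [c f] := into vertex_x0.1; split=> l; rewrite !updE.
    by case: eqP => // _; case: eqP.
  case: eqP => [->|_]; first by rewrite f2.
  by case: eqP => [->|_]; [rewrite f1|exact: f].
have [x fx Tx] := onto fy; exists x; split=> //; rewrite Tx ?upd_id//.
by rewrite mxE (negbTE i12) upd_id.
Qed.

Definition free (rho : 'I_d -> option bool) : {set 'I_d} := [set j | rho j == None]%SET.

Let free_value i u : tau i = None -> -1 <= u <= 1 -> exists2 x, rface sig x & T x 0 i = u.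
Proof.
move=> fi hu.
have fy : rface tau (upd (T x0) i u).
  have [c f] := into vertex_x0.1; split=> l; rewrite updE; first by case: eqP.
  by case: eqP => [->|_]; [rewrite fi|exact: f].
by have [x fx Tx] := onto fy; exists x => //; rewrite Tx upd_id.
Qed.

(** A free coordinate of the image attains 0 and so is not constant. Two of them can be prescribed
    as 0 and 1 at once, so they do not depend on the same variable. *)
Lemma free_coordinate : exists f : 'I_d -> 'I_d,
  [/\ forall i, i \in free tau -> f i \in free sig,
      {in free tau &, injective f} &
      forall i, i \in free tau -> exists s, forall x, rface sig x -> T x 0 i = sgn R s * x 0 (f i)].
Proof.
have H i : exists j, i \in free tau -> j \in free sig /\
    exists s, forall x, rface sig x -> T x 0 i = sgn R s * x 0 j.
  case: (boolP (i \in free tau)) => [|_]; last by exists i.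
  rewrite inE => /eqP fi; have [[s Hs _]|[j [s [fj Hj]]]] := face_coordinate i.
    have [x fx Tx] := free_value fi (itv0 erefl).
    by have := Hs x fx; rewrite Tx; case: s {Hs}; rewrite /sgn; lra.
  by exists j => _; split; [rewrite inE fj|exists s].
have [f Hf] := choice H; exists f; split.
- by move=> i /Hf [].
- move=> i1 i2 f1 f2 E; apply/eqP/negPn/negP => i12.
  have [_ [s1 H1]] := Hf i1 f1; have [_ [s2 H2]] := Hf i2 f2.
  rewrite inE in f1; rewrite inE in f2.
  have [x [fx e1 e2]] := free_values (eqP f1) (eqP f2) i12 (itv0 erefl) (itv1 erefl).
  have := H1 x fx; have := H2 x fx; rewrite e1 e2 E.
  by case: s1 {H1}; case: s2 {H2}; rewrite /sgn; lra.
- by move=> i /Hf [].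
Qed.

End AffineFaces.

Lemma extend_injection (I J : {set 'I_d}) (f : 'I_d -> 'I_d) : #|I| = #|J| ->
  (forall i, i \in I -> f i \in J) -> {in I &, injective f} ->
  exists2 g : 'I_d -> 'I_d, injective g &
    forall i, (i \in I -> g i = f i) /\ (i \notin I -> g i \notin J).
Proof.
move=> IJ fJ fi.
have cIJ : size (enum (~: I)) = size (enum (~: J)).
  by rewrite -!cardE; apply/eqP; rewrite -(eqn_add2l #|I|) cardsC {1}IJ cardsC.
pose g i := if i \in I then f i else nth i (enum (~: J)) (index i (enum (~: I))).
have ix i : i \notin I -> (index i (enum (~: I)) < size (enum (~: J)))%N.
  by move=> ni; rewrite -cIJ index_mem mem_enum inE.
have gJ i : i \notin I -> g i \notin J.
  move=> ni; rewrite /g (negbTE ni).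
  by have := mem_nth i (ix i ni); rewrite mem_enum inE.
exists g; last by move=> i; split=> [ii|/gJ//]; rewrite /g ii.
move=> i1 i2; case: (boolP (i1 \in I)) => h1; case: (boolP (i2 \in I)) => h2 E.
- by apply: fi => //; move: E; rewrite /g h1 h2.
- by have := gJ _ h2; rewrite -E /g h1 fJ.
- by have := gJ _ h1; rewrite E /g h2 fJ.
- move: E; rewrite /g (negbTE h1) (negbTE h2) (set_nth_default i1 i2 (ix i2 h2)) => /eqP.
  rewrite nth_uniq ?ix ?enum_uniq// => /eqP E.
  have m1 : i1 \in enum (~: I) by rewrite mem_enum inE.
  have m2 : i2 \in enum (~: I) by rewrite mem_enum inE.
  by rewrite -(nth_index i1 m1) E nth_index.
Qed.

(** Applied in both directions, [free_coordinate] shows that the two faces have equal dimension. The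
    remaining coordinates are constants of modulus one; they are paired by any bijection, with the
    sign that converts one constant into the other. The result acts on the whole cube, which is what
    the Lobatto grid requires. *)
Lemma signed_permutation (A : 'M[R]_d) (t : pt) (sig tau : 'I_d -> option bool) :
  A \in unitmx ->
  (forall x, rface sig x -> rface tau (x *m A + t)) ->
  (forall y, rface tau y -> exists2 x, rface sig x & x *m A + t = y) ->
  exists g e, injective g /\
    forall x, rface sig x -> forall i, (x *m A + t) 0 i = sgn R (e i) * x 0 (g i).
Proof.
move=> uA into onto; have [f [fJ fi fE]] := free_coordinate uA into onto.
have uA' : invmx A \in unitmx by rewrite unitmx_inv.
have inv x : (x *m A + t) *m invmx A + - (t *m invmx A) = x.
  by rewrite mulmxDl mulmxK// addrK.
have [f' [fJ' fi' _]] : exists f' : 'I_d -> 'I_d,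
  [/\ forall i, i \in free sig -> f' i \in free tau, {in free sig &, injective f'} & True].
  have [||f' [h1 h2 _]] := @free_coordinate (invmx A) (- (t *m invmx A)) tau sig uA'.
  - by move=> y /onto [x fx <-]; rewrite inv.
  - by move=> x fx; exists (x *m A + t); [exact: into|exact: inv].
  - by exists f'.
have IJ : #|free tau| = #|free sig|.
  apply/eqP; rewrite eqn_leq; apply/andP; split.
    rewrite -(card_in_imset fi); apply: subset_leq_card; apply/fintype.subsetP => _ /imsetP [i ii ->].
    exact: fJ.
  rewrite -(card_in_imset fi'); apply: subset_leq_card; apply/fintype.subsetP => _ /imsetP [i ii ->].
  exact: fJ'.
have [g gi gE] := extend_injection IJ fJ fi.
have H i : exists s, forall x, rface sig x -> (x *m A + t) 0 i = sgn R s * x 0 (g i).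
  have [g1 g2] := gE i; case: (boolP (i \in free tau)) => [ii|ni].
    by rewrite g1//; exact: fE.
  have := g2 ni; rewrite inE; case E1 : (sig (g i)) => [s1|] // _.
  move: ni; rewrite inE; case E2 : (tau i) => [s2|] // _.
  exists (s1 == s2) => x fx; have [_ /(_ i)] := into x fx; rewrite E2 => ->.
  have [_ /(_ (g i))] := fx; rewrite E1 => ->.
  by case: (s1); case: (s2); rewrite /sgn /=; ring.
by have [e He] := choice H; exists g, e; split=> // x fx i; exact: He.
Qed.

End SignedPermutation.

Section Matching.
Variables (R : realType) (d : nat) (M : mesh R d).
Local Notation pt := 'rV[R]_d.
Local Notation N := (nel M).
Hypothesis unitB : forall k : 'I_N, mB k \in unitmx.
Hypothesis conf : forall k l : 'I_N, k != l -> setI (celem k) (celem l) = set0 \/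
  exists sig tau, setI (celem k) (celem l) = Fmap k @` rface sig /\
                  setI (celem k) (celem l) = Fmap l @` rface tau.

(* Common points have the same reference coordinates up to a signed permutation
   that depends on the two elements only. *)
Lemma match_elems (k l : 'I_N) : exists g e, injective g /\
  forall x : pt, ccube x -> celem l (Fmap k x) ->
    forall i, Finv l (Fmap k x) 0 i = sgn R (e i) * x 0 (g i).
Proof.
have [<-|kl] := eqVneq k l.
  by exists id, (fun=> true); split=> // x _ _ i; rewrite FmapK// mul1r.
have [E|[sig [tau [E1 E2]]]] := conf kl.
  exists id, (fun=> true); split=> // x hx hl.
  have : (celem k `&` celem l) (Fmap k x) by split=> //; exists x.
  by rewrite E.
pose A := mB k *m invmx (mB l); pose t := (mb k - mb l) *m invmx (mB l).
have TE x : Finv l (Fmap k x) = x *m A + t.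
  by rewrite /Finv /Fmap -addrA mulmxDl mulmxA.
have uA : A \in unitmx by rewrite unitmx_mul unitB unitmx_inv unitB.
have [] := @signed_permutation R d A t sig tau uA.
- move=> x fx; rewrite -TE; apply/(rfaceP unitB); rewrite -E2 E1.
  by exists x.
- move=> y fy; have : (Fmap l @` rface tau) (Fmap l y) by exists y.
  rewrite -E2 E1 => -[x fx Fx]; exists x => //.
  by rewrite -TE Fx FmapK.
move=> g [e [gi H]]; exists g, e; split=> // x hx hl i.
have fx : rface sig x.
  have : (celem k `&` celem l) (Fmap k x) by split=> //; exists x.
  by rewrite E1 => /(rfaceP unitB); rewrite FmapK.
by rewrite TE H.
Qed.

End Matching.

(** * Lobatto interpolation and the Oswald operator *)

Section Interpolation.
Variables (R : realType) (d p : nat).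
Local Notation pt := 'rV[R]_d.
Local Notation coef := (coef R d p).
Local Notation midx := (midx d p).
Implicit Types (c : coef) (x y : pt) (a : midx).

Lemma qevalB c c' x : qeval (c - c') x = qeval c x - qeval c' x.
Proof. by rewrite /qeval -sumrB; apply: eq_bigr => a _; rewrite !ffunE mulrBl. Qed.

Lemma qevalD c c' x : qeval (c + c') x = qeval c x + qeval c' x.
Proof. by rewrite /qeval -big_split; apply: eq_bigr => a _; rewrite !ffunE mulrDl. Qed.

Lemma qeval0 x : qeval (0 : coef) x = 0.
Proof. by rewrite /qeval big1// => a _; rewrite ffunE mul0r. Qed.

Lemma qeval_sum (I : finType) (t : I -> R) (C : I -> coef) x :
  qeval [ffun b => \sum_i t i * C i b] x = \sum_i t i * qeval (C i) x.
Proof.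
rewrite /qeval; under eq_bigr => b _ do rewrite ffunE mulr_suml.
rewrite exchange_big; apply: eq_bigr => i _; rewrite mulr_sumr.
by apply: eq_bigr => b _; rewrite mulrA.
Qed.

Lemma tpoly_coef f : tpoly p.+1 f -> exists c, forall x, f x = qeval c x.
Proof.
case=> S [hS fE]; elim: S f hS fE => [|[t e] S IH] f.
  by move=> _ fE; exists 0 => x; rewrite fE big_nil qeval0.
move=> /= /andP [/forallP he hS] fE.
have [c cE] := IH _ hS (fun x => erefl).
pose a : midx := [ffun i => Ordinal (he i)].
exists ([ffun b => t * (b == a)%:R] + c) => x.
rewrite fE big_cons cE qevalD; congr (_ + _); rewrite /= /qeval (bigD1 a)//= ffunE eqxx mulr1.
rewrite big1 ?addr0 => [|b ba]; last by rewrite ffunE (negbTE ba) mulr0 mul0r.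
by congr (_ * _); apply: eq_bigr => i _; rewrite ffunE.
Qed.

Variables (s : seq R) (w : R -> R).
Hypothesis Hs : lobatto_rule p s w.
Local Notation node := (@gnode R d p s).

Let nth_s (i : 'I_p.+1) : nth 0 s i \in s.
Proof. by rewrite mem_nth// (lob_size Hs). Qed.

Lemma gnodeE a i : node a 0 i = nth 0 s (a i).
Proof. exact: mxE. Qed.

Lemma refnode_gnode a : refnode p (node a).
Proof. by move=> i; apply/(lob_mem Hs); rewrite gnodeE. Qed.

Lemma refnodeP x : refnode p x -> exists a, x = node a.
Proof.
move=> hx; have ix i : (index (x 0%R i) s < p.+1)%N.
  by rewrite -(lob_size Hs) index_mem; apply/(lob_mem Hs).
exists [ffun i => Ordinal (ix i)]; apply/rowP => i; rewrite gnodeE ffunE /= nth_index//.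
by apply/(lob_mem Hs).
Qed.

Lemma gnode_inj : injective node.
Proof.
move=> a b /rowP E; apply/ffunP => i; apply/val_inj/eqP.
by have := E i; rewrite !gnodeE => /eqP; rewrite nth_uniq ?(lob_size Hs) ?(lob_uniq Hs).
Qed.

Lemma ccube_gnode a : ccube (node a).
Proof. by move=> i; have [] := refnode_gnode a i. Qed.

Lemma lob_signs (b : bool) : sgn R b \in s.
Proof.
apply/(lob_mem Hs); split; case: b; rewrite /sgn.
- by apply/andP; split; lra.
- by apply/andP; split; lra.
- by rewrite expr1n subrr mul0r.
- by rewrite sqrrN expr1n subrr mul0r.
Qed.

Lemma gweight_ge0 a : 0 <= gweight s w a.
Proof. by apply: prodr_ge0 => i _; exact: lob_ge0 Hs _. Qed.

Definition cardinal a x : R := \prod_i (lagrange_poly s (nth 0 s (a i))).[x 0 i].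

Lemma cardinal_node a b : cardinal a (node b) = (a == b)%:R.
Proof.
rewrite /cardinal; have [<-|ab] := eqVneq a b.
  by apply: big1 => i _; rewrite gnodeE lagrange_polyE ?nth_s// eqxx.
have [i ni] : exists i, a i != b i.
  apply/existsP; apply: contra_neqT ab => /existsPn H.
  by apply/ffunP => i; have := H i; rewrite negbK => /eqP.
rewrite (bigD1 i)//= gnodeE lagrange_polyE ?nth_s// nth_uniq ?(lob_size Hs) ?(lob_uniq Hs)//.
by rewrite (negbTE ni : (a i == b i :> nat) = false) mul0r.
Qed.

Lemma cardinal_coef a : exists c, forall x, cardinal a x = qeval c x.
Proof.
pose l i := lagrange_poly s (nth 0 s (a i)).
exists [ffun b : midx => \prod_i (l i)`_(b i)] => x.
rewrite /cardinal (eq_bigr (fun i => \sum_(m < p.+1) (l i)`_m * x 0 i ^+ m)).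
  rewrite bigA_distr_bigA; apply: eq_bigr => b _.
  by rewrite ffunE -big_split.
move=> i _; apply: horner_coef_wide.
by rewrite (leq_trans (size_lagrange_poly (lob_uniq Hs) (nth_s _)))// (lob_size Hs).
Qed.

Lemma qeval_interp c x : qeval c x = \sum_a qeval c (node a) * cardinal a x.
Proof.
have E (t : R) (m : 'I_p.+1) : t ^+ m = \sum_(i < p.+1) nth 0 s i ^+ m * (lagrange_poly s (nth 0 s i)).[t].
  have h : (size ('X^m : {poly R}) <= size s)%N by rewrite size_polyXn (lob_size Hs).
  rewrite -[LHS]hornerXn [in LHS](lagrange_interpolation (lob_uniq Hs) h) horner_sum.
  rewrite (big_nodes _ (lob_size Hs)); apply: eq_bigr => i _.
  by rewrite hornerZ hornerXn.
rewrite {1}/qeval; under [RHS]eq_bigr => a _ do rewrite /qeval mulr_suml.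
rewrite [RHS]exchange_big; apply: eq_bigr => b _.
rewrite /mono; under eq_bigr => i _ do rewrite E.
rewrite bigA_distr_bigA mulr_sumr; apply: eq_bigr => a _.
rewrite -mulrA -big_split; congr (_ * _); apply: eq_bigr => i _.
by rewrite gnodeE.
Qed.

Lemma interp_exists (f : pt -> R) : exists c, forall x, refnode p x -> qeval c x = f x.
Proof.
have [C CE] := choice cardinal_coef.
exists [ffun b => \sum_a f (node a) * C a b] => x /refnodeP [b ->].
rewrite qeval_sum (bigD1 b)//= -CE cardinal_node eqxx mulr1 big1 ?addr0// => a ab.
by rewrite -CE cardinal_node (negbTE ab) mulr0.
Qed.

(** The cardinal function of a node off the face has a factor that vanishes identically on the
    face. *)
Lemma face_determined c c' sig x : rface sig x ->
  (forall y, refnode p y -> rface sig y -> qeval c y = qeval c' y) -> qeval c x = qeval c' x.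
Proof.
move=> [hx fx] H; rewrite !(qeval_interp _ x); apply: eq_bigr => a _.
have [fa|na] := pselect (rface sig (node a)).
  by rewrite (H _ (refnode_gnode a) fa).
suff -> : cardinal a x = 0 by rewrite !mulr0.
have [i [b [si ni]]] : exists i b, sig i = Some b /\ node a 0 i != sgn R b.
  apply: contrapT => no; apply: na; split; first exact: ccube_gnode.
  move=> i; case E : (sig i) => [b|] //; apply/eqP/negPn/negP => n; apply: no.
  by exists i, b.
rewrite /cardinal (bigD1 i)//=; have := fx i; rewrite si => ->.
by rewrite lagrange_polyE ?lob_signs// -gnodeE (negbTE ni) mul0r.
Qed.

(** Once [x_j] is frozen, the weights of direction [j] sum to 2, whereas the nodes on the facet
    carry the single weight [w 1]. The ratio [2 / w 1 = p (p + 1)] is where facet and cube weights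
    part. *)
Lemma facet_sum (p0 : (0 < p)%N) (f : pt -> R) j (b : bool) :
  \sum_a gweight s w a * f (upd (node a) j (sgn R b)) =
  2 / w 1 * \sum_(a | node a 0 j == sgn R b) gweight s w a * f (node a).
Proof.
have [e /= eE] : exists e : 'I_p.+1, nth 0 s e = sgn R b.
  have ix : (index (sgn R b) s < p.+1)%N by rewrite -(lob_size Hs) index_mem lob_signs.
  by exists (Ordinal ix); rewrite /= nth_index ?lob_signs.
have we : w (sgn R b) = w 1 by case: (b); rewrite /sgn// (lob_opp Hs).
have w0 : w 1 != 0.
  rewrite (lob_end Hs) mulf_neq0// invr_eq0 pnatr_eq0 -lt0n muln_gt0 p0//.
have sw : \sum_(i < p.+1) w (nth 0 s i) = 2.
  have h1 : (size (1 : {poly R})%R <= 2 * p)%N by rewrite size_poly1; lia.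
  rewrite -(pint1 R) (lob_exact Hs h1) (big_nodes _ (lob_size Hs)).
  by apply: eq_bigr => i _; rewrite hornerC mulr1.
pose G a := \prod_(l | l != j) w (node a 0 l) * f (upd (node a) j (sgn R b)).
have upE a i : node (updf a j i) = upd (node a) j (nth 0 s i) := tpoint_updf _ a j i.
have GW a i : gweight s w (updf a j i) = w (nth 0 s i) * \prod_(l | l != j) w (node a 0 l).
  rewrite /gweight (bigD1 j)//= upE upd_id; congr (_ * _).
  by apply: eq_bigr => l lj; rewrite mxE (negbTE lj).
have p1 : p.+1%:R != 0 :> R by rewrite pnatr_eq0.
apply: (mulfI p1); rewrite [RHS]mulrCA.
have := sum_updf (fun a => gweight s w a * f (upd (node a) j (sgn R b))) j.
have := sum_updf (fun a => if node a 0 j == sgn R b then gweight s w a * f (node a) else 0) j.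
rewrite card_ord -big_mkcond /= => <- <-.
rewrite mulr_sumr; apply: eq_bigr => a _.
rewrite [in RHS](bigD1 e)//= [in RHS]upE upd_id eE eqxx [X in _ = _ * (_ + X)]big1 => [|i ie]; last first.
  rewrite upE upd_id -eE nth_uniq ?(lob_size Hs) ?(lob_uniq Hs)//.
  by rewrite (negbTE ie : (i == e :> nat) = false).
rewrite addr0 GW eE we.
under eq_bigr => i _ do rewrite GW upE upd_upd -mulrA.
by rewrite -mulr_suml sw; field.
Qed.

End Interpolation.

(** * Facet integrals against nodal sums *)

Section NodalTraces.
Variables (R : realType) (d p : nat).
Local Notation pt := 'rV[R]_d.
Local Notation coef := (coef R d p).
Hypotheses (d0 : (0 < d)%N) (p0 : (0 < p)%N).
Variables (s : seq R) (w : R -> R).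
Hypothesis Hs : lobatto_rule p s w.
Local Notation node := (@gnode R d p s).
Implicit Types (c : coef) (j : 'I_d) (b : bool) (f : pt -> R).

Lemma reffaceint_sqr c j b f : (forall x, rface (facet j b) x -> f x = qeval c x ^+ 2) ->
  exists2 c' : coef, (forall x, qeval c' x = qeval c (upd x j (sgn R b))) &
  reffaceint j b f = 2^-1 * refint (fun x : pt => qeval c' x ^+ 2).
Proof.
move=> fE; have [c' c'E] := tpoly_coef (tpoly_upd j (sgn R b) (ltn0Sn p) (tpoly_qeval c)).
exists c' => [x|]; first by rewrite c'E.
rewrite (reffaceint_refint d0 fE (tpoly_sqr (tpoly_qeval c))).
by congr (_ * refint _); apply/funext => x; rewrite c'E.
Qed.

Lemma nodal_trace c j b f : (forall x, rface (facet j b) x -> f x = qeval c x ^+ 2) ->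
  reffaceint j b f <=
  (p * p.+1)%:R / 2 * \sum_(a | node a 0 j == sgn R b) gweight s w a * qeval c (node a) ^+ 2.
Proof.
move=> /reffaceint_sqr [c' c'E ->].
have /andP [h _] := lobatto_equiv Hs c'.
have p1 : (p * p.+1)%:R != 0 :> R by rewrite pnatr_eq0 -lt0n muln_gt0 p0.
apply: le_trans (ler_wpM2l _ h) _; first by rewrite invr_ge0.
under eq_bigr => a _ do rewrite c'E.
rewrite (facet_sum Hs p0 (fun x => qeval c x ^+ 2)) (lob_end Hs).
move: {h} ((p * p.+1)%:R : R) p1 => q q0.
by rewrite mulrA le_eqVlt; apply/orP; left; apply/eqP; congr (_ * _); field.
Qed.

Lemma trace_nodes c j b f : (forall x, rface (facet j b) x -> f x = qeval c x ^+ 2) ->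
  \sum_(a | node a 0 j == sgn R b) gweight s w a * qeval c (node a) ^+ 2 <=
  2 * 3 ^+ d / (p * p.+1)%:R * reffaceint j b f.
Proof.
move=> /reffaceint_sqr [c' c'E ->].
have /andP [_ h] := lobatto_equiv Hs c'.
have p1 : 0 < (p * p.+1)%:R :> R by rewrite ltr0n muln_gt0 p0.
have p2 := lt0r_neq0 p1.
move: h; under eq_bigr => a _ do rewrite c'E.
rewrite (facet_sum Hs p0 (fun x => qeval c x ^+ 2)) (lob_end Hs).
set S := \sum_(a | _) _; set T := refint _ => h.
move: ((p * p.+1)%:R : R) p1 p2 h => q q1 q0 h.
have -> : S = q^-1 * (2 / (2 / q) * S) by field.
rewrite [leRHS](_ : _ = q^-1 * (3 ^+ d * T)); last by field.
by apply: ler_wpM2l => //; rewrite invr_ge0 ltW.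
Qed.

Lemma refint_nodes c : refint (fun x => qeval c x ^+ 2) <=
  \sum_a gweight s w a * qeval c (node a) ^+ 2.
Proof. by have /andP [] := lobatto_equiv Hs c. Qed.

Lemma nodes_refint c : \sum_a gweight s w a * qeval c (node a) ^+ 2 <=
  3 ^+ d * refint (fun x => qeval c x ^+ 2).
Proof. by have /andP [] := lobatto_equiv Hs c. Qed.

(** The facet nodes are among all nodes, and the weight ratio of [facet_sum] provides the factor of
    order [p ^ 2] of the polynomial trace inequality. *)
Lemma trace_refint c j b f : (forall x, rface (facet j b) x -> f x = qeval c x ^+ 2) ->
  reffaceint j b f <= (p * p.+1)%:R / 2 * (3 ^+ d * refint (fun x => qeval c x ^+ 2)).
Proof.
move=> /nodal_trace /le_trans; apply; apply: ler_wpM2l; first by rewrite divr_ge0.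
apply: le_trans (nodes_refint c); rewrite big_mkcond; apply: ler_sum => a _.
by case: ifP => // _; rewrite mulr_ge0 ?sqr_ge0// (gweight_ge0 Hs).
Qed.

End NodalTraces.

(** * Matching of nodes and weights across elements *)

Section NodeMatching.
Variables (R : realType) (d p : nat) (M : mesh R d).
Local Notation pt := 'rV[R]_d.
Local Notation N := (nel M).
Local Notation coef := (coef R d p).
Hypothesis p0 : (0 < p)%N.
Hypothesis unitB : forall k : 'I_N, mB k \in unitmx.
Hypothesis conf : forall k l : 'I_N, k != l -> setI (celem k) (celem l) = set0 \/
  exists sig tau, setI (celem k) (celem l) = Fmap k @` rface sig /\
                  setI (celem k) (celem l) = Fmap l @` rface tau.
Variables (s : seq R) (w : R -> R).
Hypothesis Hs : lobatto_rule p s w.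
Local Notation node := (@gnode R d p s).
Implicit Types (k l : 'I_N).

(** [T] extends the signed permutation of [match_elems] to all of space, so it preserves the degree
    in each variable. The node set is symmetric and the weight even, hence [T] permutes the nodes
    and keeps their weights. *)
Lemma match_nodes k l : exists (T : pt -> pt) (h : midx d p -> midx d p),
  [/\ forall x : pt, ccube x -> celem l (Fmap k x) -> Finv l (Fmap k x) = T x,
      forall c : coef, exists c' : coef, forall x, qeval c (T x) = qeval c' x,
      injective h, forall a, node (h a) = T (node a) &
      forall a, gweight s w (h a) = gweight s w a].
Proof.
have [g [e [gi H]]] := match_elems unitB conf k l.
pose T (x : pt) : pt := \row_i (sgn R (e i) * x 0 (g i)).
have [g' gK g'K] := injF_bij gi.
have Tr a : refnode p (T (node a)).
  move=> i; rewrite mxE; case: (e i); rewrite /sgn ?mul1r ?mulN1r.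
    exact: (refnode_gnode Hs).
  by apply: gll_opp; rewrite opprK; exact: (refnode_gnode Hs).
have [h hE] := choice (fun a => refnodeP Hs (Tr a)).
exists T, h; split=> //.
- by move=> x hx hl; apply/rowP => i; rewrite (H _ hx hl) /T [RHS]mxE.
- move=> c; apply: tpoly_coef.
  apply: tpoly_sum => a.
  pose m : {ffun 'I_d -> nat} := [ffun j => a (g' j) : nat].
  apply: tpoly_ext (@tpoly_monomial _ _ _ (c a * \prod_i sgn R (e i) ^+ a i) m _).
    move=> x; rewrite -mulrA /mono; congr (_ * _).
    under [RHS]eq_bigr => i _ do rewrite mxE exprMn.
    rewrite big_split; congr (_ * _); rewrite /monomial (reindex g) /=.
      by apply: eq_bigr => i _; rewrite ffunE gK.
    by exists g' => i _; rewrite ?gK ?g'K.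
  by move=> j; rewrite ffunE.
- move=> a b E; apply: (gnode_inj Hs).
  have : T (node a) = T (node b) by rewrite !hE E.
  move/rowP => E'; apply/rowP => j; have := E' (g' j); rewrite !mxE g'K.
  by case: (e _); rewrite /sgn ?mul1r ?mulN1r// => /oppr_inj.
- move=> a; rewrite /gweight [RHS](reindex g) /=; last first.
    by exists g' => i _; rewrite ?gK ?g'K.
  apply: eq_bigr => i _; rewrite -hE mxE.
  by case: (e i); rewrite /sgn ?mul1r// mulN1r (lob_opp Hs).
Qed.

End NodeMatching.

(** * Conformity of the averaged function *)

Section OswaldOperator.
Variables (R : realType) (d p : nat) (M : mesh R d).
Local Notation pt := 'rV[R]_d.
Local Notation N := (nel M).
Local Notation coef := (coef R d p).
Local Notation dgfun := (dgfun M p).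
Hypothesis unitB : forall k : 'I_N, mB k \in unitmx.
Hypothesis convO : Defs.convex_set (Omega M).
Hypothesis disj : forall k l : 'I_N, k != l -> setI (elem k) (elem l) = set0.
Hypothesis conf : forall k l : 'I_N, k != l -> setI (celem k) (celem l) = set0 \/
  exists sig tau, setI (celem k) (celem l) = Fmap k @` rface sig /\
                  setI (celem k) (celem l) = Fmap l @` rface tau.
Variables (s : seq R) (w : R -> R).
Hypothesis Hs : lobatto_rule p s w.
Implicit Types (k l : 'I_N) (v : dgfun) (x y : pt).

Lemma vk_Fmap v k x : vk v k (Fmap k x) = qeval (v k) x.
Proof. by rewrite /vk FmapK. Qed.

Lemma vkB u v k x : vk (dgsub u v) k x = vk u k x - vk v k x.
Proof. exact: qevalB. Qed.

Lemma Qh_spec v k x : refnode p x -> vk (Qh v) k (Fmap k x) = nodeval v (Fmap k x).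
Proof.
move=> hx; rewrite vk_Fmap; move: x hx; rewrite /Qh; exact: (ClassicalEpsilon.epsilon_spec (inhabits (0 : coef)) _ (interp_exists Hs (fun x => nodeval v (Fmap k x)))).
Qed.

Lemma card_starE y : #|[set l : 'I_N | `[< celem l y >]]| = #|[set l : 'I_N | `[< celem l y >]]%SET|.
Proof. by apply: eq_card => l; apply/idP/idP; rewrite in_setE finset.inE. Qed.

(** A node in the open element belongs to no other closed element, so the average there is the value
    itself. *)
Lemma VB_Oswald v : VB (dgsub v (Qh v)).
Proof.
move=> k x [hx ox]; rewrite vkB Qh_spec//.
have ek : elem k (Fmap k x) by exists x.
have nb : ~ bdry M (Fmap k x) by case=> _; apply; exact: elem_Omega ek.
rewrite /nodeval ifF; last by apply/negbTE/negP => /asboolP.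
have star l : `[< celem l (Fmap k x) >] = (l == k).
  apply/asboolP/eqP => [cl|->]; last exact: elem_celem.
  exact/esym/(elem_celem_inj unitB disj ek cl).
rewrite (eq_bigl _ _ star) big_pred1_eq.
rewrite card_starE (_ : [set l | _]%SET = [set k]%SET) ?cards1 ?divr1 ?subrr//.
by apply/setP => l; rewrite !inE star.
Qed.

(** Pulled back to [k], both traces are determined by the nodes of the common face, where the values
    come from [nodeval], a function of the point alone. *)
Lemma Qh_continuous v k l x : celem k x -> celem l x -> vk (Qh v) k x = vk (Qh v) l x.
Proof.
have [<-//|kl] := eqVneq k l => ck cl.
have [E|[sig [tau [E _]]]] := conf kl.
  have : (celem k `&` celem l) x by split.
  by rewrite E.
have [T [h [TE Tc _ hE _]]] := match_nodes unitB conf Hs k l.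
have [c' c'E] := Tc (Qh v l).
have face y : rface sig y -> ccube y /\ celem l (Fmap k y).
  move=> fy; split; first by case: fy.
  have : (Fmap k @` rface sig) (Fmap k y) by exists y.
  by rewrite -E => -[].
have lE y : rface sig y -> vk (Qh v) l (Fmap k y) = qeval c' y.
  by move=> /face [h1 h2]; rewrite /vk TE.
have fx : rface sig (Finv k x).
  by apply/(rfaceP unitB); rewrite -E.
rewrite -(FinvK unitB k x) vk_Fmap lE//.
apply: (face_determined Hs fx) => y ry fy.
have [h1 h2] := face y fy.
rewrite -lE// -vk_Fmap Qh_spec//.
rewrite -[in RHS](FinvK unitB l (Fmap k y)) Qh_spec ?FinvK//.
have [a E'] := refnodeP Hs ry; rewrite TE// E' -hE.
exact: (refnode_gnode Hs).
Qed.

(** [sig] describes the smallest face of [k] through [x]. By [bdry_face] all its nodes are boundary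
    nodes, where the nodal values are zero. *)
Lemma Qh_bdry v k x : bdry M x -> celem k x -> vk (Qh v) k x = 0.
Proof.
move=> bx cx; pose z := Finv k x.
have hz : ccube z by apply/(celemP unitB).
pose sig i := if z 0 i == 1 then Some true else if z 0 i == -1 then Some false else None.
have fz : rface sig z.
  by split=> // i; rewrite /sig; case: eqP => // _; case: eqP.
rewrite /vk -/z -[RHS](@qeval0 R d p z).
apply: (face_determined Hs fz) => y ry [hy fy]; rewrite qeval0.
have cy : celem k (Fmap k y) by exists y.
rewrite -vk_Fmap Qh_spec// /nodeval ifT//; apply/asboolP.
apply: (bdry_face unitB convO bx cx cy) => i b; rewrite FmapK// => E.
have := fy i; rewrite /sig -/z; rewrite -/z in E; rewrite E.
have n11 : (-1 : R) == 1 = false.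
  by apply/negbTE; rewrite -subr_eq0 -opprD oppr_eq0 (_ : 1 + 1 = 2%:R) ?pnatr_eq0.
by case: (b); rewrite /sgn ?eqxx// n11.
Qed.

Lemma vk_continuous v k : continuous (vk v k).
Proof.
apply: sum_continuous => a x.
apply: (@cvgM _ _ (nbhs x)); first exact: cst_continuous.
rewrite /mono.
suff H (r : seq 'I_d) : {for x, continuous (fun y => \prod_(i <- r) Finv k y 0 i ^+ a i)} by exact: H.
have X (f : pt -> R) n : {for x, continuous f} -> {for x, continuous (fun y => f y ^+ n)}.
  move=> cf; elim: n => [|n IH].
    rewrite (_ : (fun y => _) = fun=> 1); first exact: cst_continuous.
    by apply/funext => y; rewrite expr0.
  rewrite (_ : (fun y => _) = fun y => f y * f y ^+ n); first exact: (@cvgM _ _ (nbhs x)).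
  by apply/funext => y; rewrite exprS.
elim: r => [|i r IH].
  rewrite (_ : (fun y => _) = fun=> 1); first exact: cst_continuous.
  by apply/funext => y; rewrite big_nil.
rewrite (_ : (fun y => _) = fun y => Finv k y 0 i ^+ a i * \prod_(i <- r) Finv k y 0 i ^+ a i).
  by apply: (@cvgM _ _ (nbhs x)) => //; apply: X; exact: Finv_continuous.
by apply/funext => y; rewrite big_cons.
Qed.

(** The elementwise polynomials glue to one function. Near [x] only closed elements containing [x]
    occur, and on each of these the function is a continuous polynomial with the common value at
    [x]. *)
Lemma VC_Oswald v : VC (Qh v).
Proof.
have /choice [f fE] : forall x, exists r, forall k, celem k x -> r = vk (Qh v) k x.
  move=> x; have [[k ck]|nk] := pselect (covered M x).
    by exists (vk (Qh v) k x) => l cl; exact: Qh_continuous.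
  by exists 0 => k ck; case: nk; exists k.
exists f; split; last first.
  split=> [x bx|k x]; last by move=> /fE.
  have [[k ck] _] := (bdryP unitB x).1 bx.
  by rewrite (fE x k ck) (Qh_bdry _ bx ck).
rewrite (closure_Omega unitB); apply/subspace_continuousP => x cx.
apply/cvgrPdist_lt => e e0; rewrite near_withinE.
have H : \forall y \near x, forall k, celem k y ->
    celem k x /\ `|vk (Qh v) k x - vk (Qh v) k y| < e.
  apply: near_forall => k; have [ck|nk] := pselect (celem k x).
    have /cvgrPdist_lt /(_ e e0) := @vk_continuous (Qh v) k x.
    by apply: near_sub.
  by apply: near_sub (celem_closed unitB nk).
apply: near_sub H => y H [k ck].
by have [cx' h] := H k ck; rewrite /from_subspace (fE _ k)// (fE _ k).
Qed.

End OswaldOperator.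

(** * The averaging error in terms of the jumps *)

Lemma ler_sum_term (R : realType) (I : finType) (P : pred I) (F : I -> R) i :
  P i -> (forall i, P i -> 0 <= F i) -> F i <= \sum_(i | P i) F i.
Proof. by move=> Pi F0; rewrite (bigD1 i)//= lerDl sumr_ge0// => j /andP [/F0]. Qed.

Lemma ler_sum_inj (R : realType) (I J : finType) (h : I -> J) (F : I -> R) (G : J -> R) :
  injective h -> (forall j, 0 <= G j) -> (forall i, F i <= G (h i)) ->
  \sum_i F i <= \sum_j G j.
Proof.
move=> hi G0 FG; apply: le_trans (ler_sum _ (fun i _ => FG i)) _.
rewrite [leRHS](bigID (mem (codom h))) /= -[leLHS]addr0; apply: lerD; last exact: sumr_ge0.
rewrite (eq_bigl (mem [set h x | x in [set: I]%SET]%SET)); last first.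
  by move=> j; apply/codomP/imsetP => [[i ->]|[i _ ->]]; exists i; rewrite ?inE.
rewrite big_imset /=; last by move=> i j _ _; exact: hi.
by rewrite le_eqVlt; apply/orP; left; apply/eqP/eq_bigl => i; rewrite inE.
Qed.

Section NodalEstimate.
Variables (R : realType) (d p : nat) (M : mesh R d) (Csr Cqu : R).
Local Notation pt := 'rV[R]_d.
Local Notation N := (nel M).
Local Notation coef := (coef R d p).
Local Notation dgfun := (dgfun M p).
Hypotheses (d0 : (0 < d)%N) (p0 : (0 < p)%N).
Hypotheses (Csr1 : 1 <= Csr) (Cqu1 : 1 <= Cqu).
Hypothesis unitB : forall k : 'I_N, mB k \in unitmx.
Hypothesis convO : Defs.convex_set (Omega M).
Hypothesis disj : forall k l : 'I_N, k != l -> setI (elem k) (elem l) = set0.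
Hypothesis conf : forall k l : 'I_N, k != l -> setI (celem k) (celem l) = set0 \/
  exists sig tau, setI (celem k) (celem l) = Fmap k @` rface sig /\
                  setI (celem k) (celem l) = Fmap l @` rface tau.
Hypothesis inball : forall k : 'I_N, exists c : pt, forall y, enorm (y - c) < diam k / Csr -> elem k y.
Hypothesis quasi : forall k : 'I_N, hmax M <= Cqu * diam k.
Implicit Types (k l : 'I_N) (v : dgfun) (x y : pt) (j : 'I_d) (b : bool).
Local Notation n := (maxstar d Csr Cqu).
Local Notation Kd := (Kdet d Csr Cqu).
Local Notation det k := (`|\det (mB k)|).

Definition facejumps v k j b x : R :=
  \sum_(l | nbr k j b l) (vk v k x - vk v l x) ^+ 2 +
  (if isbdry k j b then vk v k x ^+ 2 else 0).

Definition pointjumps v k x : R := \sum_j \sum_(b : bool)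
  (if `[< celem k x /\ Finv k x 0 j = sgn R b >] then facejumps v k j b x else 0).

Lemma facejumps_ge0 v k j b x : 0 <= facejumps v k j b x.
Proof.
by rewrite addr_ge0 ?sumr_ge0//; [move=> l _; exact: sqr_ge0|case: ifP => // _; exact: sqr_ge0].
Qed.

Lemma pointjumps_ge0 v k x : 0 <= pointjumps v k x.
Proof.
by apply: sumr_ge0 => j _; apply: sumr_ge0 => b _; case: ifP => // _; exact: facejumps_ge0.
Qed.

Let rho v x := Num.sqrt (\sum_k pointjumps v k x).

Let rho_ge v x k j b r : celem k x -> Finv k x 0 j = sgn R b -> r ^+ 2 <= facejumps v k j b x ->
  `|r| <= rho v x.
Proof.
move=> ck fx h; rewrite -sqrtr_sqr ler_sqrt; last first.
  by apply: sumr_ge0 => m _; exact: pointjumps_ge0.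
apply: le_trans (ler_sum_term (i := k) _ _) => //; last by move=> m _; exact: pointjumps_ge0.
have g0 i c : 0 <= (if `[< celem k x /\ Finv k x 0 i = sgn R c >] then facejumps v k i c x else 0).
  by case: ifP => // _; exact: facejumps_ge0.
apply: le_trans (ler_sum_term (i := j) _ _) => //; last by move=> i _; exact: sumr_ge0.
apply: le_trans (ler_sum_term (i := b) _ _) => //.
by rewrite ifT//; apply/asboolP.
Qed.

Let adj_diff v x k l : adj x k l -> `|vk v k x - vk v l x| <= rho v x.
Proof.
move=> /asboolP [ck cl [j [b [nl fx]]]]; apply: (rho_ge ck fx).
rewrite /facejumps -[leLHS]addr0; apply: lerD; last by case: ifP => // _; exact: sqr_ge0.
by apply: (ler_sum_term (F := fun l => (vk v k x - vk v l x) ^+ 2)) => // m _; exact: sqr_ge0.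
Qed.

Let path_diff v x k q : path (adj x) k q ->
  `|vk v k x - vk v (last k q) x| <= (size q)%:R * rho v x.
Proof.
elim: q k => [|l q IH] k /=; first by rewrite subrr normr0 mul0r.
move=> /andP [/adj_diff - /(_ v) h1 /IH h2].
rewrite -[leLHS](_ : `|(vk v k x - vk v l x) + (vk v l x - vk v (last l q) x)| = _).
  by rewrite (le_trans (ler_normD _ _))// -natr1 mulrDl mul1r addrC lerD.
by congr `|_|; ring.
Qed.

Let star_diff v x k l : celem k x -> celem l x ->
  `|vk v k x - vk v l x| <= n%:R * rho v x.
Proof.
move=> ck cl; have /connectP [q0 pq0 ->] := star_connected unitB convO disj conf ck cl.
(* A chain without repetition is no longer than the number of elements at [x], which bounds the
   number of jumps collected. *)
case/shortenP: pq0 => q pq uq _.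
apply: le_trans (path_diff v pq) _; apply: ler_wpM2r; first exact: sqrtr_ge0.
rewrite ler_nat; apply: leq_trans (card_star d0 Csr1 Cqu1 unitB disj inball quasi x).
apply: leq_trans (leqnSn _) _; rewrite -[(size q).+1]/(size (k :: q)) -(card_uniqP uq).
apply: subset_leq_card; apply/fintype.subsetP => m.
have [->|mk] := eqVneq m k; first by move=> _; rewrite finset.inE; exact/asboolP.
rewrite in_cons (negbTE mk) /= => mq; rewrite inE; apply/asboolP.
elim: q k pq {ck uq mk} mq => //= a q IH k /andP [/asboolP [_ ca _] pq].
by rewrite in_cons => /orP [/eqP ->//|]; exact: IH pq.
Qed.

(* Elements sharing a point are joined by a chain of at most [n] facet crossings, so
   their nodal values differ by at most [n] jumps at that point. *)
Lemma nodeval_diff v k x : celem k x ->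
  (vk v k x - nodeval v x) ^+ 2 <= (n.+1)%:R ^+ 2 * \sum_l pointjumps v l x.
Proof.
move=> ck; have r0 : 0 <= rho v x := sqrtr_ge0 _.
suff h : `|vk v k x - nodeval v x| <= n.+1%:R * rho v x.
  rewrite -[X in _ * X]sqr_sqrtr; last by apply: sumr_ge0 => l _; exact: pointjumps_ge0.
  by rewrite -exprMn -real_normK ?num_real// lerXn2r// nnegrE ?mulr_ge0.
rewrite /nodeval; case: ifP => [/asboolP bx|_].
  rewrite subr0; have [l cl [j [b [hb fx]]]] := bdry_exit unitB convO disj conf bx ck.
  have h1 : `|vk v l x| <= rho v x.
    apply: (rho_ge cl fx); rewrite /facejumps hb lerDr; apply: sumr_ge0 => m _; exact: sqr_ge0.
  rewrite -[vk v k x](subrK (vk v l x)) (le_trans (ler_normD _ _))// -natr1 mulrDl mul1r.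
  by rewrite lerD// star_diff.
rewrite card_starE; set S := [set l | _]%SET.
have kS : k \in S by rewrite inE; apply/asboolP.
have cS : 0 < #|S|%:R :> R by rewrite ltr0n; apply/card_gt0P; exists k.
have -> : \sum_(l | `[< celem l x >]) vk v l x = \sum_(l in S) vk v l x.
  by apply: eq_bigl => l; rewrite inE.
have -> : vk v k x - (\sum_(l in S) vk v l x) / #|S|%:R =
    #|S|%:R^-1 * \sum_(l in S) (vk v k x - vk v l x).
  by rewrite sumrB sumr_const -mulr_natr mulrBr; field; exact: lt0r_neq0.
rewrite normrM gtr0_norm ?invr_gt0// ler_pdivrMl//.
apply: le_trans (ler_norm_sum _ _ _) _.
apply: le_trans (ler_sum _ (_ : forall l, l \in S -> _ <= n.+1%:R * rho v x)) _.
  move=> l; rewrite inE => /asboolP cl; apply: le_trans (star_diff v ck cl) _.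
  by apply: ler_wpM2r => //; rewrite ler_nat.
by rewrite sumr_const [leRHS]mulr_natl.
Qed.

Variables (s : seq R) (w : R -> R).
Hypothesis Hs : lobatto_rule p s w.
Local Notation node := (@gnode R d p s).
Local Notation W := (gweight s w).

(** Double counting: a contribution of [l] seen at a node of [k] is moved to the matching node of
    [l], which has the same weight. Each node of [l] is charged by at most [n] elements, and [Kd]
    compares their determinants. *)
Lemma node_exchange (phi : 'I_N -> pt -> R) : (forall l x, 0 <= phi l x) ->
  (forall l x, ~ celem l x -> phi l x = 0) ->
  \sum_(k < N) det k * \sum_(a : midx d p) W a * \sum_(l < N) phi l (Fmap k (node a)) <=
  n%:R * Kd * \sum_(l < N) det l * \sum_(a : midx d p) W a * phi l (Fmap l (node a)).
Proof.
move=> phi0 phiN.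
have W0 (a : midx d p) : 0 <= W a by exact: gweight_ge0 Hs _.
pose G k l (a : midx d p) := if `[< celem k (Fmap l (node a)) >] then W a * phi l (Fmap l (node a)) else 0.
have G0 k l a : 0 <= G k l a by rewrite /G; case: ifP => // _; rewrite mulr_ge0.
have step k l : \sum_(a : midx d p) W a * phi l (Fmap k (node a)) <= \sum_a G k l a.
  have [T [h [TE _ hi hE hW]]] := match_nodes unitB conf Hs k l.
  apply: (ler_sum_inj hi) => // a.
  have [ca|na] := pselect (celem l (Fmap k (node a))); last by rewrite phiN// mulr0.
  have ck : celem k (Fmap k (node a)) by exists (node a) => //; exact: (ccube_gnode Hs).
  have E : Fmap l (node (h a)) = Fmap k (node a).
    by rewrite hE -TE ?FinvK//; exact: (ccube_gnode Hs).
  by rewrite /G E ifT ?hW//; apply/asboolP.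
apply: (@le_trans _ _ (\sum_k det k * \sum_l \sum_a G k l a)).
  apply: ler_sum => k _; apply: ler_wpM2l => //.
  under eq_bigr => a _ do rewrite mulr_sumr.
  by rewrite exchange_big; apply: ler_sum => l _; exact: step.
under eq_bigr => k _ do rewrite mulr_sumr.
rewrite exchange_big mulr_sumr; apply: ler_sum => l _.
under eq_bigr => k _ do rewrite mulr_sumr.
rewrite exchange_big mulrA mulr_sumr; apply: ler_sum => a _.
rewrite /G (bigID (fun k => `[< celem k (Fmap l (node a)) >])) /= [X in _ + X]big1 ?addr0; last first.
  by move=> k /negbTE ->; rewrite mulr0.
set t := W a * _; have t0 : 0 <= t by rewrite mulr_ge0.
rewrite (eq_bigr (fun k => det k * t)); last by move=> k ->.
rewrite -mulr_suml; apply: ler_wpM2r => //.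
apply: (@le_trans _ _ (\sum_(k in [set k | `[< celem k (Fmap l (node a)) >]]%SET) Kd * det l)).
  rewrite [leRHS](eq_bigl (fun k => `[< celem k (Fmap l (node a)) >])); last by move=> k; rewrite inE.
  by apply: ler_sum => k _; exact: det_compare.
rewrite sumr_const -[leLHS]mulr_natl mulrA; apply: ler_wpM2r => //.
apply: ler_wpM2r; first exact: Kdet_ge0.
by rewrite ler_nat card_star.
Qed.

End NodalEstimate.

(** * Calculus of facet integrals *)

Section FacePolynomials.
Variables (R : realType) (d p : nat) (M : mesh R d).
Local Notation pt := 'rV[R]_d.
Local Notation N := (nel M).
Local Notation dgfun := (dgfun M p).
Hypotheses (d0 : (0 < d)%N) (p0 : (0 < p)%N).
Hypothesis unitB : forall k : 'I_N, mB k \in unitmx.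
Hypothesis conf : forall k l : 'I_N, k != l -> setI (celem k) (celem l) = set0 \/
  exists sig tau, setI (celem k) (celem l) = Fmap k @` rface sig /\
                  setI (celem k) (celem l) = Fmap l @` rface tau.
Implicit Types (k l : 'I_N) (v : dgfun) (x y : pt) (j : 'I_d) (b : bool) (f g : pt -> R).

(** Only the trace is required to be polynomial, in the reference coordinates of [k]: the function
    of a neighbour is accessible through the matching map on the common face alone. *)
Definition fpoly n k j b f :=
  exists2 q, tpoly n q & forall x, rface (facet j b) x -> f (Fmap k x) = q x.

Lemma fpolyD n k j b f g : fpoly n k j b f -> fpoly n k j b g ->
  fpoly n k j b (fun x => f x + g x).
Proof.
move=> [q hq qE] [r hr rE]; exists (fun x => q x + r x); first exact: tpolyD.
by move=> x fx; rewrite qE ?rE.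
Qed.

Lemma fpolyZ n k j b (c : R) f : fpoly n k j b f -> fpoly n k j b (fun x => c * f x).
Proof.
move=> [q hq qE]; exists (fun x => c * q x); first exact: tpolyZ.
by move=> x fx; rewrite qE.
Qed.

Lemma fpolyB n k j b f g : fpoly n k j b f -> fpoly n k j b g ->
  fpoly n k j b (fun x => f x - g x).
Proof.
move=> [q hq qE] [r hr rE]; exists (fun x => q x - r x); first exact: tpolyB.
by move=> x fx; rewrite qE ?rE.
Qed.

Lemma fpoly_sum n k j b (I : Type) (r : seq I) (F : I -> pt -> R) :
  (forall i, fpoly n k j b (F i)) -> fpoly n k j b (fun x => \sum_(i <- r) F i x).
Proof.
move=> H; elim: r => [|i r [q hq qE]].
  by exists (fun=> 0) => [|x _]; [exact: tpoly0|rewrite big_nil].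
have [q' hq' qE'] := H i; exists (fun x => q' x + q x); first exact: tpolyD.
by move=> x fx; rewrite big_cons qE ?qE'.
Qed.

Lemma fpolyM n m k j b f g : fpoly n k j b f -> fpoly m k j b g ->
  fpoly (n + m) k j b (fun x => f x * g x).
Proof.
move=> [q hq qE] [r hr rE]; exists (fun x => q x * r x); first exact: tpolyM.
by move=> x fx; rewrite qE ?rE.
Qed.

Lemma fpolyM2 k j b f g : fpoly p.+1 k j b f -> fpoly p.+1 k j b g ->
  fpoly (2 * p.+1) k j b (fun x => f x * g x).
Proof. by move=> hf hg; rewrite mul2n -addnn; exact: fpolyM. Qed.

Lemma fpoly_ext n k j b f g : f =1 g -> fpoly n k j b f -> fpoly n k j b g.
Proof. by move=> /funext ->. Qed.

Lemma fpoly_sqr k j b f : fpoly p.+1 k j b f -> fpoly (2 * p.+1) k j b (fun x => f x ^+ 2).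
Proof. by move=> hf; apply: fpoly_ext (fpolyM2 hf hf) => x; rewrite expr2. Qed.

Lemma fpoly_own v k j b : fpoly p.+1 k j b (vk v k).
Proof. by exists (qeval (v k)) => [|x _]; [exact: tpoly_qeval|exact: vk_Fmap]. Qed.

Lemma fpoly_nbr v k j b l : nbr k j b l -> fpoly p.+1 k j b (vk v l).
Proof.
move=> /asboolP [_ kl]; have [s [w Hs]] := lobatto_ruleP R p0.
have [T [_ [TE Tc _ _ _]]] := match_nodes unitB conf Hs k l.
have [c cE] := Tc (v l); exists (qeval c); first exact: tpoly_qeval.
move=> x fx; have cl : celem l (Fmap k x) by apply: kl; exists x.
by rewrite /vk TE ?cE//; case: fx.
Qed.

Lemma fpoly_jump v k j b l : nbr k j b l -> fpoly p.+1 k j b (fun x => vk v k x - vk v l x).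
Proof. by move=> kl; apply: fpolyB; [exact: fpoly_own|exact: fpoly_nbr]. Qed.

Section Quadrature.
Variables (I : finType) (y : I -> pt) (u : I -> R).
Hypothesis u0 : forall i, 0 <= u i.
Hypothesis hy : forall i, ccube (y i).
Hypothesis rule : forall f, tpoly (2 * p.+1) f -> refint f = \sum_i u i * f (y i).

Definition fquad k j b f : R := \sum_i u i * f (Fmap k (upd (y i) j (sgn R b))).

Lemma reffaceint_rule k j b f : fpoly (2 * p.+1) k j b f ->
  reffaceint j b (fun x => f (Fmap k x)) = 2^-1 * fquad k j b f.
Proof.
move=> [q hq qE]; rewrite (reffaceint_refint d0 qE hq) rule; last exact: tpoly_upd.
by congr (_ * _); apply: eq_bigr => i _; rewrite qE//; exact: rface_upd.
Qed.

Definition fscale k j : R := `|\det (mB k)| * enorm (nvec k j) / 2.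

Lemma fscale_ge0 k j : 0 <= fscale k j.
Proof. by rewrite !mulr_ge0 ?enorm_ge0. Qed.

Lemma faceint_rule k j b f : fpoly (2 * p.+1) k j b f ->
  faceint k j b f = fscale k j * fquad k j b f.
Proof. by move=> /reffaceint_rule E; rewrite /faceint E mulrA. Qed.

Lemma fquad_le k j b f g : (forall x, (Fmap k @` rface (facet j b)) x -> f x <= g x) ->
  fquad k j b f <= fquad k j b g.
Proof.
move=> fg; apply: ler_sum => i _; apply: ler_wpM2l => //; apply: fg.
by exists (upd (y i) j (sgn R b)) => //; exact: rface_upd.
Qed.

Lemma fquadD k j b f g : fquad k j b (fun x => f x + g x) = fquad k j b f + fquad k j b g.
Proof. by rewrite -big_split; apply: eq_bigr => i _; rewrite /= mulrDr. Qed.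

Lemma fquadZ k j b (c : R) f : fquad k j b (fun x => c * f x) = c * fquad k j b f.
Proof. by rewrite mulr_sumr; apply: eq_bigr => i _; rewrite mulrCA. Qed.

End Quadrature.

Lemma faceint_le k j b f g : fpoly (2 * p.+1) k j b f -> fpoly (2 * p.+1) k j b g ->
  (forall x, (Fmap k @` rface (facet j b)) x -> f x <= g x) -> faceint k j b f <= faceint k j b g.
Proof.
have [I [y [u [u0 hy rule]]]] := @cube_rule R d p.
move=> hf hg fg; rewrite !(faceint_rule hy rule)//; apply: ler_wpM2l; first exact: fscale_ge0.
exact: fquad_le.
Qed.

Lemma faceintD k j b f g : fpoly (2 * p.+1) k j b f -> fpoly (2 * p.+1) k j b g ->
  faceint k j b (fun x => f x + g x) = faceint k j b f + faceint k j b g.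
Proof.
have [I [y [u [_ hy rule]]]] := @cube_rule R d p.
move=> hf hg; rewrite !(faceint_rule hy rule)//; last exact: fpolyD.
by rewrite fquadD mulrDr.
Qed.

Lemma faceintZ k j b (c : R) f : fpoly (2 * p.+1) k j b f ->
  faceint k j b (fun x => c * f x) = c * faceint k j b f.
Proof.
have [I [y [u [_ hy rule]]]] := @cube_rule R d p.
move=> hf; rewrite !(faceint_rule hy rule)//; last exact: fpolyZ.
by rewrite fquadZ mulrCA.
Qed.

Lemma faceint_ge0 k j b f : fpoly (2 * p.+1) k j b f ->
  (forall x, (Fmap k @` rface (facet j b)) x -> 0 <= f x) -> 0 <= faceint k j b f.
Proof.
move=> hf f0; have [I [y [u [u0 hy rule]]]] := @cube_rule R d p.
rewrite (faceint_rule hy rule)// mulr_ge0 ?fscale_ge0//; apply: sumr_ge0 => i _.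
by apply: mulr_ge0 => //; apply: f0; exists (upd (y i) j (sgn R b)) => //; exact: rface_upd.
Qed.

(** Common shape of [penalty], [lift_rhs] and the jump sums; an interior face occurs once from each
    side. *)
Definition facesum (X : 'I_N -> 'I_d -> bool -> 'I_N -> R) (Y : 'I_N -> 'I_d -> bool -> R) : R :=
  \sum_k \sum_j \sum_(b : bool)
    (\sum_(l | nbr k j b l) X k j b l + (if isbdry k j b then Y k j b else 0)).

Lemma facesum_le X X' Y Y' : (forall k j b l, nbr k j b l -> X k j b l <= X' k j b l) ->
  (forall k j b, isbdry k j b -> Y k j b <= Y' k j b) -> facesum X Y <= facesum X' Y'.
Proof.
move=> h h'; apply: ler_sum => k _; apply: ler_sum => j _; apply: ler_sum => b _.
by apply: lerD; [apply: ler_sum => l kl; exact: h|case: ifP => // /h'].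
Qed.

Lemma facesumZ c X Y : facesum (fun k j b l => c * X k j b l) (fun k j b => c * Y k j b) =
  c * facesum X Y.
Proof.
rewrite mulr_sumr; apply: eq_bigr => k _; rewrite mulr_sumr; apply: eq_bigr => j _.
rewrite mulr_sumr; apply: eq_bigr => b _; rewrite mulrDr mulr_sumr; congr (_ + _).
by case: ifP; rewrite ?mulr0.
Qed.

Lemma facesumD X Y X' Y' :
  facesum (fun k j b l => X k j b l + X' k j b l) (fun k j b => Y k j b + Y' k j b) =
  facesum X Y + facesum X' Y'.
Proof.
rewrite -big_split; apply: eq_bigr => k _; rewrite -big_split; apply: eq_bigr => j _.
rewrite -big_split; apply: eq_bigr => b _; rewrite big_split /= addrACA; congr (_ + _).
by case: ifP; rewrite ?addr0.
Qed.

Lemma facesum_ext X X' Y Y' : (forall k j b l, nbr k j b l -> X k j b l = X' k j b l) ->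
  (forall k j b, isbdry k j b -> Y k j b = Y' k j b) -> facesum X Y = facesum X' Y'.
Proof.
move=> h h'; apply: eq_bigr => k _; apply: eq_bigr => j _; apply: eq_bigr => b _.
by congr (_ + _); [apply: eq_bigr => l kl; exact: h|case: ifP => // /h'].
Qed.

Definition jumpsum v : R := facesum
  (fun k j b l => faceint k j b (fun x => (vk v k x - vk v l x) ^+ 2))
  (fun k j b => faceint k j b (fun x => vk v k x ^+ 2)).

End FacePolynomials.

(** * Gradients and calculus of element integrals *)

Section VolumeIntegrals.
Variables (R : realType) (d p : nat) (M : mesh R d).
Local Notation pt := 'rV[R]_d.
Local Notation N := (nel M).
Local Notation coef := (coef R d p).
Local Notation dgfun := (dgfun M p).
Hypothesis unitB : forall k : 'I_N, mB k \in unitmx.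
Implicit Types (k l : 'I_N) (v : dgfun) (x y : pt) (i : 'I_d) (f g : pt -> R).

Lemma gradkE v k x i :
  gradk v k (Fmap k x) 0 i = \sum_j invmx (mB k) i j * dqeval (v k) j x.
Proof.
rewrite mxE; pose z : pt := ecoord R i *m invmx (mB k).
rewrite (_ : (fun t => _) = fun t : R => qeval (v k) (x + t *: z)); last first.
  apply/funext => t; rewrite /vk; congr qeval.
  by rewrite /Finv /Fmap addrAC addrK mulmxDl mulmxK// -scalemxAl.
rewrite derive1_qeval_line; apply: eq_bigr => j _; congr (_ * _).
by rewrite /z /ecoord -rowE mxE.
Qed.

Lemma tpoly_gradk v k i : tpoly p.+1 (fun x => gradk v k (Fmap k x) 0 i).
Proof.
apply: tpoly_ext (fun x => esym (gradkE v k x i)) _; apply: tpoly_sum => j.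
by apply: tpolyZ; exact: tpoly_dqeval.
Qed.

Lemma tpolyM2 f g : tpoly p.+1 f -> tpoly p.+1 g -> tpoly (2 * p.+1) (fun x : pt => f x * g x).
Proof. by move=> hf hg; rewrite mul2n -addnn; exact: tpolyM. Qed.

Lemma refint_le f g : tpoly (2 * p.+1) f -> tpoly (2 * p.+1) g ->
  (forall x, ccube x -> f x <= g x) -> refint f <= refint g.
Proof.
move=> hf hg fg; have [I [y [u [u0 hy rule]]]] := @cube_rule R d p.
by rewrite !rule//; apply: ler_sum => i _; apply: ler_wpM2l => //; exact: fg.
Qed.

Lemma refintZ c f : tpoly (2 * p.+1) f -> refint (fun x => c * f x) = c * refint f.
Proof.
move=> hf; have [I [y [u [u0 hy rule]]]] := @cube_rule R d p.
by rewrite !rule//; [rewrite mulr_sumr; apply: eq_bigr => i _; ring|exact: tpolyZ].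
Qed.

Lemma refint_sum (J : finType) (F : J -> pt -> R) : (forall j, tpoly (2 * p.+1) (F j)) ->
  refint (fun x => \sum_j F j x) = \sum_j refint (F j).
Proof.
move=> hF; have [I [y [u [u0 hy rule]]]] := @cube_rule R d p.
rewrite rule; last exact: tpoly_sum.
under [RHS]eq_bigr => j _ do rewrite rule//.
by rewrite exchange_big; apply: eq_bigr => i _; rewrite mulr_sumr.
Qed.

End VolumeIntegrals.

(** * The averaging error in the broken gradient norm *)

Section OswaldEstimate.
Variables (R : realType) (d p : nat) (M : mesh R d) (Csr Cqu : R).
Local Notation pt := 'rV[R]_d.
Local Notation N := (nel M).
Local Notation coef := (coef R d p).
Local Notation dgfun := (dgfun M p).
Hypotheses (d0 : (0 < d)%N) (p0 : (0 < p)%N) (N0 : (0 < N)%N).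
Hypotheses (Csr1 : 1 <= Csr) (Cqu1 : 1 <= Cqu).
Hypothesis unitB : forall k : 'I_N, mB k \in unitmx.
Hypothesis convO : Defs.convex_set (Omega M).
Hypothesis disj : forall k l : 'I_N, k != l -> setI (elem k) (elem l) = set0.
Hypothesis conf : forall k l : 'I_N, k != l -> setI (celem k) (celem l) = set0 \/
  exists sig tau, setI (celem k) (celem l) = Fmap k @` rface sig /\
                  setI (celem k) (celem l) = Fmap l @` rface tau.
Hypothesis inball : forall k : 'I_N, exists c : pt, forall y, enorm (y - c) < diam k / Csr -> elem k y.
Hypothesis quasi : forall k : 'I_N, hmax M <= Cqu * diam k.
Implicit Types (k l : 'I_N) (v : dgfun) (x y : pt) (j : 'I_d) (b : bool).
Local Notation n := (maxstar d Csr Cqu).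
Local Notation Kd := (Kdet d Csr Cqu).
Local Notation Ki := (Kinv Csr Cqu).
Local Notation det k := (`|\det (mB k)|).
Local Notation h := (hmax M).

Lemma penaltyE alpha v : penalty alpha v v = alpha * penalty 1 v v.
Proof.
rewrite /penalty -facesumZ; apply: facesum_ext => k j b => [l kl|_].
  have hJ := fpoly_sqr (fpoly_jump p0 unitB conf v kl).
  have E c : faceint k j b (fun x => c * p%:R ^+ 2 / Num.min (diam k) (diam l)
      * (vk v k x - vk v l x) * (vk v k x - vk v l x)) =
      (c * p%:R ^+ 2 / Num.min (diam k) (diam l)) * faceint k j b (fun x => (vk v k x - vk v l x) ^+ 2).
    by rewrite -(faceintZ d0 _ hJ); congr (faceint _ _ _ _); apply/funext => x; ring.
  by rewrite !E; ring.
have hv := fpoly_sqr (fpoly_own unitB v k j b).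
have E c : faceint k j b (fun x => c * p%:R ^+ 2 / diam k * vk v k x * vk v k x) =
    (c * p%:R ^+ 2 / diam k) * faceint k j b (fun x => vk v k x ^+ 2).
  by rewrite -(faceintZ d0 _ hv); congr (faceint _ _ _ _); apply/funext => x; ring.
by rewrite !E; ring.
Qed.

Let h0 : 0 < h.
Proof. exact (hmax_gt0 d0 unitB (Ordinal N0)). Qed.

(** The 2 in the denominator compensates the weight 1/2 that [penalty] gives to each side of an
    interior face and that [jumpsum] omits; diameters are replaced by their upper bound [h]. *)
Lemma jumpsum_penalty v : p%:R ^+ 2 / (2 * h) * jumpsum v <= penalty 1 v v.
Proof.
rewrite /jumpsum -facesumZ; apply: facesum_le => k j b => [l kl|_].
  have hJ := fpoly_sqr (fpoly_jump p0 unitB conf v kl).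
  set D := Num.min (diam k) (diam l).
  have D0 : 0 < D by rewrite lt_min !diam_gt0.
  have Dh : D <= h by rewrite ge_min diam_le_hmax.
  rewrite [X in _ <= _ * faceint _ _ _ X](_ : _ = fun x => (p%:R ^+ 2 / D) * (vk v k x - vk v l x) ^+ 2); last first.
    by apply/funext => x; ring.
  rewrite (faceintZ d0 _ hJ) mulrA; apply: ler_wpM2r; first by apply: (faceint_ge0 d0) => [|x _]; [eassumption|exact: sqr_ge0].
  rewrite invfM mulrCA; apply: ler_wpM2l => //; apply: ler_wpM2l; first exact: sqr_ge0.
  by rewrite lef_pV2 ?posrE ?h0 ?D0.
have hv := fpoly_sqr (fpoly_own unitB v k j b).
rewrite [X in _ <= faceint _ _ _ X](_ : _ = fun x => (p%:R ^+ 2 / diam k) * vk v k x ^+ 2); last first.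
  by apply/funext => x; ring.
rewrite (faceintZ d0 _ hv); apply: ler_wpM2r; first by apply: (faceint_ge0 d0) => [|x _]; [eassumption|exact: sqr_ge0].
apply: ler_wpM2l; first exact: sqr_ge0.
rewrite lef_pV2 ?posrE ?diam_gt0 ?mulr_gt0 ?h0//; have := diam_le_hmax k.
by have := h0; lra.
Qed.

Variables (s : seq R) (w : R -> R).
Hypothesis Hs : lobatto_rule p s w.
Local Notation node := (@gnode R d p s).
Local Notation W := (gweight s w).

Let face_nodes k j b f : fpoly p.+1 k j b f ->
  det k * \sum_(a : midx d p | node a 0 j == sgn R b) W a * f (Fmap k (node a)) ^+ 2 <=
  2 * 3 ^+ d / (p * p.+1)%:R * h * faceint k j b (fun x => f x ^+ 2).
Proof.
move=> [q hq qE]; have [c cE] := tpoly_coef hq.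
have fE x : rface (facet j b) x -> f (Fmap k x) ^+ 2 = qeval c x ^+ 2.
  by move=> /qE ->; rewrite cE.
have := trace_nodes d0 p0 Hs (f := fun x => f (Fmap k x) ^+ 2) fE.
rewrite (eq_bigr (fun a => W a * f (Fmap k (node a)) ^+ 2)); last first.
  move=> a /eqP fa; rewrite fE//; split; first exact: (ccube_gnode Hs).
  by move=> i; rewrite /facet; case: eqP => // ->.
set C := _ / _; rewrite /faceint; set F := reffaceint _ _ _ => H.
have C0 : 0 <= C by rewrite !mulr_ge0// ?exprn_ge0// invr_ge0.
have CF0 : 0 <= C * F.
  by apply: le_trans H; apply: sumr_ge0 => a _; rewrite mulr_ge0 ?sqr_ge0// (gweight_ge0 Hs).
apply: le_trans (ler_wpM2l _ H) _ => //.
(* Trades the volume factor [det] for the facet scale at the cost of one power of [h]. *)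
have nh : 1 <= h * enorm (nvec k j) 
  by rewrite -(mulfV (lt0r_neq0 h0)); apply: ler_wpM2l; [exact: ltW|exact: nvec_ge].
rewrite [leRHS](_ : _ = (det k * (C * F)) * (h * enorm (nvec k j))); last by ring.
by rewrite ler_peMr// mulr_ge0.
Qed.

Lemma oswald_nodes v :
  \sum_k det k * \sum_(a : midx d p) W a * (vk (dgsub v (Qh v)) k (Fmap k (node a))) ^+ 2 <=
  n.+1%:R ^+ 2 * (n%:R * Kd * (2 * 3 ^+ d / (p * p.+1)%:R * h * jumpsum v)).
Proof.
have W0 (a : midx d p) : 0 <= W a by exact: gweight_ge0 Hs _.
apply: (@le_trans _ _ (\sum_(k < N) det k *
    \sum_(a : midx d p) W a * \sum_(l < N) (n.+1%:R ^+ 2 * pointjumps v l (Fmap k (node a))))).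
  apply: ler_sum => k _; apply: ler_wpM2l => //; apply: ler_sum => a _; apply: ler_wpM2l => //.
  rewrite -mulr_sumr (vkB v) (Qh_spec unitB Hs); last exact: (refnode_gnode Hs).
  apply: (nodeval_diff d0 Csr1 Cqu1 unitB convO disj conf inball quasi).
  by exists (node a) => //; exact: (ccube_gnode Hs).
apply: le_trans (node_exchange d0 Csr1 Cqu1 unitB disj conf inball quasi Hs (phi := fun l x => n.+1%:R ^+ 2 * pointjumps v l x) _ _) _.
- by move=> l x; rewrite mulr_ge0 ?sqr_ge0// pointjumps_ge0.
- move=> l x nl; rewrite /pointjumps big1 ?mulr0// => j _; rewrite big1// => b _.
  by rewrite ifF//; apply/negbTE/negP => /asboolP [].
rewrite [leRHS]mulrCA; apply: ler_wpM2l; first by rewrite mulr_ge0// Kdet_ge0.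
under eq_bigr => l _ do under eq_bigr => a _ do rewrite mulrCA.
under eq_bigr => l _ do rewrite -mulr_sumr mulrCA.
rewrite -mulr_sumr; apply: ler_wpM2l; first exact: sqr_ge0.
rewrite /jumpsum -facesumZ; apply: ler_sum => k _.
under eq_bigr => a _ do rewrite mulr_sumr.
rewrite exchange_big mulr_sumr; apply: ler_sum => j _.
under eq_bigr => a _ do rewrite mulr_sumr.
rewrite exchange_big mulr_sumr; apply: ler_sum => b _.
rewrite (eq_bigr (fun a => if node a 0 j == sgn R b then W a * facejumps v k j b (Fmap k (node a)) else 0)); last first.
  move=> a _; rewrite FmapK//; case: eqP => [E|nE].
    by rewrite ifT//; apply/asboolP; split=> //; exists (node a) => //; exact: (ccube_gnode Hs).
  by rewrite ifF ?mulr0//; apply/negbTE/negP => /asboolP [].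
rewrite -big_mkcond /=; under eq_bigr => a _ do rewrite mulrDr.
rewrite big_split mulrDr; apply: lerD.
  under eq_bigr => a _ do rewrite mulr_sumr.
  rewrite exchange_big mulr_sumr; apply: ler_sum => l kl.
  exact: face_nodes (fpoly_jump p0 unitB conf v kl).
case: ifP => _; last by rewrite big1 ?mulr0// => a _; rewrite mulr0.
exact: face_nodes (fpoly_own unitB v k j b).
Qed.

(** Of the three factors [d], one counts the components of the gradient, one comes from
    Cauchy-Schwarz in the chain rule, and one counts the reference derivatives to which the inverse
    inequality is applied. *)
Lemma grad_nodes v k :
  elint k (fun x => dot (gradk v k x) (gradk v k x)) <=
  d%:R ^+ 3 * (Ki / h) ^+ 2 * p.+1%:R ^+ 4 *
  (det k * \sum_(a : midx d p) W a * vk v k (Fmap k (node a)) ^+ 2).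
Proof.
pose D x : R := \sum_(j < d) dqeval (v k) j x ^+ 2.
have Ki0 : 0 <= Ki / h by rewrite divr_ge0 ?(ltW h0)// (le_trans ler01)// Kinv_ge1.
have hD : tpoly (2 * p.+1) D by apply: tpoly_sum => j; apply: tpoly_sqr; exact: tpoly_dqeval.
have hG : tpoly (2 * p.+1) (fun x => dot (gradk v k (Fmap k x)) (gradk v k (Fmap k x))).
  by apply: tpoly_sum => i; apply: tpolyM2; exact: tpoly_gradk.
have G_le x : dot (gradk v k (Fmap k x)) (gradk v k (Fmap k x)) <= d%:R ^+ 2 * (Ki / h) ^+ 2 * D x.
  apply: (@le_trans _ _ (\sum_(i < d) d%:R * (Ki / h) ^+ 2 * D x)); last first.
    by rewrite sumr_const card_ord -[leLHS]mulr_natl !mulrA -expr2.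
  apply: ler_sum => i _; rewrite -expr2 gradkE//.
  have := @sum_CauchySchwarz _ _ (fun=> 1 : R) (fun j => invmx (mB k) i j) (fun j => dqeval (v k) j x) (fun=> ler01).
  under eq_bigr => j _ do rewrite mul1r.
  move=> /le_trans; apply.
  have -> : \sum_(j < d) 1 * dqeval (v k) j x ^+ 2 = D x.
    by apply: eq_bigr => j _; rewrite mul1r.
  apply: ler_wpM2r; first by apply: sumr_ge0 => j _; exact: sqr_ge0.
  rewrite -[d in d%:R]card_ord mulr_natl -sumr_const; apply: ler_sum => j _; rewrite mul1r.
  rewrite -real_normK ?num_real// lerXn2r ?nnegrE//.
  exact: invB_le.
rewrite /elint [leRHS]mulrCA; apply: ler_wpM2l => //.
apply: (@le_trans _ _ (refint (fun x => d%:R ^+ 2 * (Ki / h) ^+ 2 * D x))).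
  by apply: (refint_le (p := p)) => //; exact: tpolyZ.
rewrite (refintZ _ hD); set S := \sum_(a : midx d p) _.
rewrite [leRHS](_ : _ = d%:R ^+ 2 * (Ki / h) ^+ 2 * (d%:R * (p.+1%:R ^+ 4 * S))); last by ring.
apply: ler_wpM2l; first by rewrite mulr_ge0 ?sqr_ge0.
rewrite (refint_sum (p := p)) => [|j]; last by apply: tpoly_sqr; exact: tpoly_dqeval.
rewrite -[d in d%:R]card_ord mulr_natl -sumr_const; apply: ler_sum => j _.
apply: le_trans (refint_dqeval _ _) _; apply: ler_wpM2l; first exact: exprn_ge0.
apply: le_trans (refint_nodes Hs (v k)) _; rewrite le_eqVlt; apply/orP; left; apply/eqP.
by apply: eq_bigr => a _; rewrite vk_Fmap.
Qed.

(** The 32 is [2^3 * 4]: the powers of [p] combine to the cube of [(p + 1) / p], at most 2; one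
    factor 2 comes from the nodal trace bound and one from [jumpsum_penalty]. *)
Definition Cosw : R :=
  d%:R ^+ 3 * Ki ^+ 2 * n.+1%:R ^+ 2 * n%:R * Kd * 3 ^+ d * 32.

Lemma oswald_grad v :
  \sum_k elint k (fun x => dot (gradk (dgsub v (Qh v)) k x) (gradk (dgsub v (Qh v)) k x)) <= Cosw * penalty 1 v v.
Proof.
apply: le_trans (ler_sum _ (fun k _ => grad_nodes (dgsub v (Qh v)) k)) _.
rewrite -mulr_sumr.
have Ki0 : 0 <= Ki := le_trans ler01 (Kinv_ge1 Csr1 Cqu1).
have p0' : 0 < p%:R :> R by rewrite ltr0n.
have c0 : 0 <= d%:R ^+ 3 * (Ki / h) ^+ 2 * p.+1%:R ^+ 4 :> R.
  by apply: mulr_ge0 (exprn_ge0 _ _) => //; apply: mulr_ge0 (sqr_ge0 _); exact: exprn_ge0.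
apply: le_trans (ler_wpM2l c0 (oswald_nodes v)) _.
have J0 : 0 <= jumpsum v.
  apply: sumr_ge0 => k _; apply: sumr_ge0 => j _; apply: sumr_ge0 => b _; apply: addr_ge0.
    apply: sumr_ge0 => l kl; apply: (faceint_ge0 d0) => [|x _]; last exact: sqr_ge0.
    exact: fpoly_sqr (fpoly_jump p0 unitB conf v kl).
  case: ifP => // _; apply: (faceint_ge0 d0) => [|x _]; last exact: sqr_ge0.
  exact: fpoly_sqr (fpoly_own unitB v k j b).
have jp : jumpsum v <= 2 * h / p%:R ^+ 2 * penalty 1 v v.
  rewrite -[jumpsum v](mulKf (x := p%:R ^+ 2 / (2 * h))); last first.
    by rewrite mulf_neq0 ?expf_neq0 ?invr_neq0 ?mulf_neq0 ?gt_eqF ?h0 ?p0'.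
  rewrite invf_div; apply: ler_wpM2l; last exact: jumpsum_penalty.
  by rewrite divr_ge0 ?sqr_ge0 ?mulr_ge0 ?(ltW h0).
have pen0 : 0 <= penalty 1 v v.
  by apply: le_trans (jumpsum_penalty v); rewrite mulr_ge0// divr_ge0 ?sqr_ge0 ?mulr_ge0 ?(ltW h0).
have pp : p.+1%:R <= 2 * p%:R :> R by rewrite -natrM ler_nat mul2n -addnn -addn1 leq_add2l.
have Kd0 : 0 <= Kd := Kdet_ge0 d Csr1 Cqu1.
set A := d%:R ^+ 3 * Ki ^+ 2 * n.+1%:R ^+ 2 * n%:R * Kd * 3 ^+ d.
have A0 : 0 <= A.
  by rewrite /A; move: (Kd) (Ki) Kd0 Ki0 => x y x0 y0; rewrite !mulr_ge0 ?exprn_ge0.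
rewrite natrM; have hh := lt0r_neq0 h0; have hp := lt0r_neq0 p0'.
have hq : p.+1%:R != 0 :> R by rewrite pnatr_eq0.
rewrite [leLHS](_ : _ = A * (p.+1%:R ^+ 3 / p%:R * 2 / h * jumpsum v)); last first.
  by rewrite /A; move: (p.+1%:R : R) hq => q q0; field; rewrite q0 hp hh.
rewrite [leRHS](_ : _ = A * (32 * penalty 1 v v)); last by rewrite /Cosw -/A mulrA.
apply: ler_wpM2l => //.
have c1 : 0 <= p.+1%:R ^+ 3 / p%:R * 2 / h :> R.
  by rewrite !mulr_ge0 ?exprn_ge0 ?invr_ge0 ?(ltW h0)//.
apply: le_trans (ler_wpM2l c1 jp) _; rewrite mulrA; apply: ler_wpM2r => //.
rewrite [leLHS](_ : _ = (p.+1%:R / p%:R) ^+ 3 * 4); last first.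
  by move: (p.+1%:R : R) => q; field; rewrite hp hh.
rewrite [leRHS](_ : _ = 2 ^+ 3 * 4); last by ring.
apply: ler_wpM2r => //; rewrite lerXn2r ?nnegrE ?divr_ge0//.
by rewrite ler_pdivrMr.
Qed.

End OswaldEstimate.

(** * The lifting operator *)

Section RieszCube.
Variables (R : realType) (d p : nat).
Local Notation pt := 'rV[R]_d.
Local Notation coef := (coef R d p).
Local Notation midx := (midx d p).
Hypotheses (p0 : (0 < p)%N).
Variables (s : seq R) (w : R -> R).
Hypothesis Hs : lobatto_rule p s w.
Local Notation node := (@gnode R d p s).
Implicit Types (c : coef) (a : midx).

(** On the Lagrange polynomial of a node the rule returns the weight of that node, and [lob_lower]
    bounds it below by the positive integral of the square. *)
Lemma gweight_gt0 a : 0 < gweight s w a.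
Proof.
apply: prodr_gt0 => i _; rewrite gnodeE.
have ms : nth 0 s (a i) \in s by rewrite mem_nth// (lob_size Hs).
set z := nth 0 s (a i) in ms *; pose l := lagrange_poly s z.
have sl : (size l <= p.+1)%N by rewrite -(lob_size Hs) size_lagrange_poly ?(lob_uniq Hs).
have := lob_lower Hs sl; rewrite (bigD1_seq z)//= ?(lob_uniq Hs)// lagrange_polyE// eqxx expr1n mulr1.
rewrite big1_seq ?addr0 => [|b /andP [bz bs]]; last first.
  by rewrite lagrange_polyE// eq_sym (negbTE bz) expr0n mulr0.
apply: lt_le_trans; rewrite lt_neqAle pint_ge0 ?andbT => [|x _]; last by rewrite horner_exp sqr_ge0.
apply/eqP => E; have l0 : l ^+ 2 = 0.
  by apply: pint_eq0 => // x _; rewrite horner_exp sqr_ge0.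
have := lagrange_polyE z ms; rewrite -/l eqxx => l1.
by have := congr1 (fun q : {poly R} => q.[z]) l0; rewrite horner_exp l1 horner0 expr1n; apply/eqP; exact: oner_neq0.
Qed.

Lemma refint_bilinear (I J : finType) (t : I -> R) (r : J -> R) (F : I -> pt -> R) (G : J -> pt -> R) :
  (forall i, tpoly p.+1 (F i)) -> (forall j, tpoly p.+1 (G j)) ->
  refint (fun x => (\sum_i t i * F i x) * (\sum_j r j * G j x)) =
  \sum_i \sum_j t i * r j * refint (fun x => F i x * G j x).
Proof.
move=> hF hG; have [K [y [u [_ _ rule]]]] := @cube_rule R d p.
have hFG i j : tpoly (2 * p.+1) (fun x => F i x * G j x).
  by rewrite mul2n -addnn; apply: tpolyM.
rewrite rule; last first.
  by apply: tpolyM2; apply: tpoly_sum => i; exact: tpolyZ.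
under [RHS]eq_bigr => i _ do under eq_bigr => j _ do rewrite rule// mulr_sumr.
under [RHS]eq_bigr => i _ do rewrite exchange_big.
rewrite [RHS]exchange_big; apply: eq_bigr => q _ /=.
rewrite mulr_suml mulr_sumr; apply: eq_bigr => i _.
by rewrite !mulr_sumr; apply: eq_bigr => j _; ring.
Qed.

(** The Gram matrix of the cardinal functions is invertible: a kernel vector has vanishing norm, so
    by norm equivalence and positive weights all its nodal values, which are its entries, vanish. *)
Lemma riesz_cube (lam : midx -> R) : exists c, forall c',
  refint (fun x => qeval c x * qeval c' x) = \sum_a lam a * qeval c' (node a).
Proof.
have [C CE] := choice (fun a => cardinal_coef Hs a).
pose e (i : 'I_#|{: midx}|) : midx := enum_val i.
have sumE (F : midx -> R) : \sum_a F a = \sum_i F (e i).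
  by rewrite (reindex e)//; exists enum_rank => i _; [exact: enum_valK|exact: enum_rankK].
have hC a : tpoly p.+1 (cardinal s a) by apply: tpoly_ext (tpoly_qeval (C a)) => x; rewrite CE.
pose G : 'M[R]_#|{: midx}| := \matrix_(i, j) refint (fun x : pt => cardinal s (e i) x * cardinal s (e j) x).
pose comb (u : 'rV[R]_#|{: midx}|) : coef := [ffun b => \sum_i u 0 i * C (e i) b].
have combE u x : qeval (comb u) x = \sum_i u 0 i * cardinal s (e i) x.
  by rewrite qeval_sum; apply: eq_bigr => i _; rewrite CE.
have pair u c : refint (fun x => qeval (comb u) x * qeval c x) =
    \sum_j (u *m G) 0 j * qeval c (node (e j)).
  rewrite (_ : (fun x => _) = fun x => (\sum_i u 0 i * cardinal s (e i) x) *
      \sum_j qeval c (node (e j)) * cardinal s (e j) x); last first.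
    by apply/funext => x; rewrite combE [X in _ * X = _](qeval_interp Hs) sumE.
  rewrite refint_bilinear//= exchange_big; apply: eq_bigr => j _.
  by rewrite mxE mulr_suml; apply: eq_bigr => i _; rewrite mxE; ring.
have nodeE u i : qeval (comb u) (node (e i)) = u 0 i.
  rewrite combE (bigD1 i)//= (cardinal_node Hs) eqxx mulr1 big1 ?addr0// => j ji.
  by rewrite (cardinal_node Hs) (inj_eq enum_val_inj) (negbTE ji) mulr0.
have ker (u : 'rV_#|{: midx}|) : u *m G = 0 -> u = 0.
  move=> uG; have := nodes_refint Hs (comb u).
  rewrite [X in _ * refint X](_ : _ = fun x => qeval (comb u) x * qeval (comb u) x); last first.
    by apply/funext => x; rewrite expr2.
  rewrite pair uG [X in _ * X]big1 => [|j _]; last by rewrite mxE mul0r.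
  rewrite mulr0 => h; apply/rowP => i; rewrite mxE -nodeE.
  have t0 a : 0 <= gweight s w a * qeval (comb u) (node a) ^+ 2.
    by rewrite mulr_ge0 ?sqr_ge0// ltW// gweight_gt0.
  have : gweight s w (e i) * qeval (comb u) (node (e i)) ^+ 2 = 0.
    by apply/eqP; rewrite eq_le t0 andbT; apply: le_trans h; exact: ler_sum_term.
  by move/eqP; rewrite mulf_eq0 (gt_eqF (gweight_gt0 _)) /= sqrf_eq0 => /eqP.
have uG : G \in unitmx.
  rewrite -row_free_unit -kermx_eq0; apply/eqP/row_matrixP => i; rewrite row0.
  by apply: ker; rewrite -row_mul mulmx_ker row0.
exists (comb ((\row_i lam (e i)) *m invmx G)) => c'.
by rewrite pair mulmxKV// sumE; apply: eq_bigr => j _; rewrite mxE.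
Qed.

End RieszCube.

(** * Existence of the lifting *)

Section LiftingExists.
Variables (R : realType) (d p : nat) (M : mesh R d).
Local Notation pt := 'rV[R]_d.
Local Notation N := (nel M).
Local Notation coef := (coef R d p).
Local Notation midx := (midx d p).
Local Notation dgfun := (dgfun M p).
Local Notation vdg := (vdg M p).
Hypotheses (d0 : (0 < d)%N) (p0 : (0 < p)%N).
Hypothesis unitB : forall k : 'I_N, mB k \in unitmx.
Hypothesis conf : forall k l : 'I_N, k != l -> setI (celem k) (celem l) = set0 \/
  exists sig tau, setI (celem k) (celem l) = Fmap k @` rface sig /\
                  setI (celem k) (celem l) = Fmap l @` rface tau.
Variables (s : seq R) (w : R -> R).
Hypothesis Hs : lobatto_rule p s w.
Local Notation node := (@gnode R d p s).
Implicit Types (k l : 'I_N) (u : dgfun) (eta : vdg) (x : pt) (j : 'I_d) (b : bool) (ell : vdg -> R).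

(** Linearity is encoded by coefficients on nodal values: the form that [riesz_cube] represents, and
    one stable under the operations building [lift_rhs]. *)
Definition nodal_functional ell := exists lam : 'I_d -> 'I_N -> midx -> R,
  forall eta, ell eta = \sum_i \sum_k \sum_a lam i k a * qeval (eta i k) (node a).

Lemma nodal_functional0 : nodal_functional (fun=> 0).
Proof.
exists (fun _ _ _ => 0) => eta; rewrite big1// => i _; rewrite big1// => k _.
by rewrite big1// => a _; rewrite mul0r.
Qed.

Lemma nodal_functionalD ell ell' : nodal_functional ell -> nodal_functional ell' ->
  nodal_functional (fun eta => ell eta + ell' eta).
Proof.
move=> [L LE] [L' LE']; exists (fun i k a => L i k a + L' i k a) => eta; rewrite LE LE' -big_split.
apply: eq_bigr => i _; rewrite -big_split; apply: eq_bigr => k _.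
by rewrite -big_split; apply: eq_bigr => a _; rewrite /= mulrDl.
Qed.

Lemma nodal_functionalZ c ell : nodal_functional ell -> nodal_functional (fun eta => c * ell eta).
Proof.
move=> [L LE]; exists (fun i k a => c * L i k a) => eta; rewrite LE.
rewrite mulr_sumr; apply: eq_bigr => i _; rewrite mulr_sumr; apply: eq_bigr => k _.
by rewrite mulr_sumr; apply: eq_bigr => a _; rewrite mulrA.
Qed.

Lemma nodal_functional_sum (I : finType) (P : pred I) (F : I -> vdg -> R) :
  (forall i, P i -> nodal_functional (F i)) -> nodal_functional (fun eta => \sum_(i | P i) F i eta).
Proof.
move=> H; have : exists L : I -> 'I_d -> 'I_N -> midx -> R, forall i, P i ->
    forall eta, F i eta = \sum_j \sum_k \sum_a L i j k a * qeval (eta j k) (node a).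
  have /choice [L LE] : forall i, exists L : 'I_d -> 'I_N -> midx -> R, P i ->
      forall eta, F i eta = \sum_j \sum_k \sum_a L j k a * qeval (eta j k) (node a).
    move=> i; have [/H [L LE]|nP] := boolP (P i); first by exists L.
    by exists (fun _ _ _ => 0).
  by exists L.
move=> [L LE]; exists (fun j k a => \sum_(i | P i) L i j k a) => eta.
rewrite (eq_bigr _ (fun i Pi => LE i Pi eta)) exchange_big; apply: eq_bigr => j _.
rewrite exchange_big; apply: eq_bigr => k _; rewrite exchange_big; apply: eq_bigr => a _.
by rewrite mulr_suml.
Qed.

Lemma nodal_functional_eval i k x : nodal_functional (fun eta => vk (eta i) k x).
Proof.
exists (fun i' k' a => (i' == i)%:R * (k' == k)%:R * cardinal s a (Finv k x)) => eta.
rewrite (bigD1 i)//= (bigD1 k)//= !eqxx !mul1r [X in _ = _ + X + _]big1 => [|l lk]; last first.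
  by rewrite big1// => a _; rewrite (negbTE lk) mulr0 !mul0r.
rewrite [X in _ = _ + X]big1 => [|l lk]; last first.
  by rewrite big1// => m _; rewrite big1// => a _; rewrite (negbTE lk) !mul0r.
by rewrite !addr0 /vk (qeval_interp Hs); apply: eq_bigr => a _; rewrite mul1r mulrC.
Qed.

Lemma nodal_functional_dot (t : pt) (F : 'I_d -> vdg -> R) : (forall i, nodal_functional (F i)) ->
  nodal_functional (fun eta => dot t (\row_i F i eta)).
Proof.
move=> H; have := nodal_functional_sum (P := xpredT) (fun i _ => nodal_functionalZ (t 0 i) (H i)).
move=> [L LE]; exists L => eta; rewrite -LE /dot; apply: eq_bigr => i _.
by rewrite mxE.
Qed.

Lemma nodal_functional_ext ell ell' : ell =1 ell' -> nodal_functional ell -> nodal_functional ell'.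
Proof. by move=> /funext ->. Qed.

Lemma nodal_functional_fquad (I : finType) (y : I -> pt) (q : I -> R) k j b (f : vdg -> pt -> R) :
  (forall x, nodal_functional (fun eta => f eta x)) ->
  nodal_functional (fun eta => fquad y q k j b (f eta)).
Proof. by move=> H; apply: nodal_functional_sum => i _; apply: nodal_functionalZ. Qed.

Lemma dotC (x y : pt) : dot x y = dot y x.
Proof. by apply: eq_bigr => i _; rewrite mulrC. Qed.

Lemma fpoly_dot k j b (F : 'I_d -> pt -> R) (t : pt) : (forall i, fpoly p.+1 k j b (F i)) ->
  fpoly p.+1 k j b (fun x => dot t (\row_i F i x)).
Proof.
move=> H; apply: fpoly_ext (fpoly_sum (index_enum 'I_d) (fun i => fpolyZ (t 0 i) (H i))) => x.
by apply: eq_bigr => i _; rewrite mxE.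
Qed.

Lemma fpoly_average eta k j b l : nbr k j b l ->
  fpoly p.+1 k j b (fun x => dot (nrm k j b) (2^-1 *: (gk eta k x + gk eta l x))).
Proof.
move=> kl; apply: fpoly_ext (@fpoly_dot k j b (fun i x => 2^-1 * (vk (eta i) k x + vk (eta i) l x)) _ _).
  by move=> x; congr dot; apply/rowP => i; rewrite !mxE.
by move=> i; apply: fpolyZ; apply: fpolyD; [exact: fpoly_own|exact: fpoly_nbr].
Qed.

Lemma fpoly_difference eta k j b l : nbr k j b l ->
  fpoly p.+1 k j b (fun x => dot (gk eta k x - gk eta l x) (nrm k j b)).
Proof.
move=> kl; apply: fpoly_ext (@fpoly_dot k j b (fun i x => vk (eta i) k x - vk (eta i) l x) (nrm k j b) _).
  by move=> x; rewrite dotC; congr dot; apply/rowP => i; rewrite !mxE.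
by move=> i; apply: fpolyB; [exact: fpoly_own|exact: fpoly_nbr].
Qed.

Lemma fpoly_normal eta k j b : fpoly p.+1 k j b (fun x => dot (nrm k j b) (gk eta k x)).
Proof. by apply: (@fpoly_dot k j b (fun i => vk (eta i) k)) => i; exact: fpoly_own. Qed.

(** By the exact facet rule every face integral is a finite combination of point values of [eta],
    which are nodal functionals by interpolation. *)
Lemma lift_rhs_nodal beta u : nodal_functional (lift_rhs beta u).
Proof.
have [I [y [q [_ hy rule]]]] := @cube_rule R d p.
apply: nodal_functional_ext (fun eta => mulN1r _) _; apply: nodal_functionalZ.
apply: nodal_functional_sum => k _; apply: nodal_functional_sum => j _.
apply: nodal_functional_sum => b _; apply: nodal_functionalD; last first.
  case: (isbdry k j b); last exact: nodal_functional0.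
  apply: nodal_functional_ext (fun eta => esym (faceint_rule d0 hy rule _)) _ => [eta|].
    exact: fpolyM2 (fpoly_own unitB _ _ _ _) (fpoly_normal _ _ _ _).
  apply/nodal_functionalZ/nodal_functional_fquad => x; apply: nodal_functionalZ.
  by apply: (@nodal_functional_dot _ (fun i eta => vk (eta i) k x)) => i; exact: nodal_functional_eval.
apply: nodal_functional_sum => l kl; apply: nodal_functionalD; apply: nodal_functionalZ.
  apply: nodal_functional_ext (fun eta => esym (faceint_rule d0 hy rule _)) _ => [eta|].
    exact: fpolyM2 (fpoly_jump p0 unitB conf u kl) (fpoly_average _ kl).
  apply/nodal_functionalZ/nodal_functional_fquad => x; apply: nodal_functionalZ.
  apply: nodal_functional_ext (@nodal_functional_dot (nrm k j b) (fun i eta => 2^-1 * (vk (eta i) k x + vk (eta i) l x)) _).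
    by move=> eta; congr dot; apply/rowP => i; rewrite !mxE.
  by move=> i; apply/nodal_functionalZ/nodal_functionalD; exact: nodal_functional_eval.
apply: nodal_functional_ext (fun eta => esym (faceint_rule d0 hy rule _)) _ => [eta|].
  by apply: fpolyM2 (fpoly_difference _ kl); apply: fpolyZ; exact: fpoly_jump.
apply/nodal_functionalZ/nodal_functional_fquad => x; apply: nodal_functionalZ.
apply: nodal_functional_ext (@nodal_functional_dot (nrm k j b) (fun i eta => vk (eta i) k x + -1 * vk (eta i) l x) _).
  by move=> eta; rewrite dotC; congr dot; apply/rowP => i; rewrite !mxE mulN1r.
move=> i; apply: nodal_functionalD; first exact: nodal_functional_eval.
by apply: nodal_functionalZ; exact: nodal_functional_eval.
Qed.

Lemma L2vvE (f g : vdg) : L2vv f g =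
  \sum_i \sum_k `|\det (mB k)| * refint (fun x => qeval (f i k) x * qeval (g i k) x).
Proof.
rewrite exchange_big; apply: eq_bigr => k _; rewrite /elint -mulr_sumr; congr (_ * _).
rewrite -(refint_sum (p := p)) => [|i]; last by apply: tpolyM2; exact: tpoly_qeval.
by congr refint; apply/funext => x; apply: eq_bigr => i _; rewrite !mxE !vk_Fmap.
Qed.

(** The choice defining [Gop] is legitimate because a representer exists: [L2vv] decouples into
    elements and components, and each block is solved by [riesz_cube]. *)
Lemma Gop_spec beta u eta : L2vv (Gop beta u) eta = lift_rhs beta u eta.
Proof.
move: eta; apply: (ClassicalEpsilon.epsilon_spec (inhabits (fun _ _ => 0 : coef)) (fun g : vdg => forall eta : vdg, L2vv g eta = lift_rhs beta u eta)).
have [L LE] := lift_rhs_nodal beta u.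
have H : forall ik : 'I_d * 'I_N, exists c : coef, forall c' : coef,
    `|\det (mB ik.2)| * refint (fun x => qeval c x * qeval c' x) =
    \sum_a L ik.1 ik.2 a * qeval c' (node a).
  move=> [i k] /=; have dk : `|\det (mB k)| != 0 :> R.
    by rewrite normr_eq0 -unitfE -unitmxE.
  have [c cE] := riesz_cube Hs (fun a => `|\det (mB k)|^-1 * L i k a); exists c => c'.
  rewrite cE mulr_sumr; apply: eq_bigr => a _.
  by rewrite mulrA mulVKf.
have [g gE] := choice H.
exists (fun i k => g (i, k)) => eta; rewrite L2vvE LE.
by apply: eq_bigr => i _; apply: eq_bigr => k _; exact: (gE (i, k)).
Qed.

End LiftingExists.

(** * Bound of the lifting by the penalty *)

Section LiftingBound.
Variables (R : realType) (d p : nat) (M : mesh R d) (Csr Cqu : R).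
Local Notation pt := 'rV[R]_d.
Local Notation N := (nel M).
Local Notation coef := (coef R d p).
Local Notation dgfun := (dgfun M p).
Local Notation vdg := (vdg M p).
Hypotheses (d0 : (0 < d)%N) (p0 : (0 < p)%N) (N0 : (0 < N)%N).
Hypotheses (Csr1 : 1 <= Csr) (Cqu1 : 1 <= Cqu).
Hypothesis unitB : forall k : 'I_N, mB k \in unitmx.
Hypothesis disj : forall k l : 'I_N, k != l -> setI (elem k) (elem l) = set0.
Hypothesis conf : forall k l : 'I_N, k != l -> setI (celem k) (celem l) = set0 \/
  exists sig tau, setI (celem k) (celem l) = Fmap k @` rface sig /\
                  setI (celem k) (celem l) = Fmap l @` rface tau.
Hypothesis inball : forall k : 'I_N, exists c : pt, forall y, enorm (y - c) < diam k / Csr -> elem k y.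
Hypothesis quasi : forall k : 'I_N, hmax M <= Cqu * diam k.
Implicit Types (k l : 'I_N) (u v : dgfun) (eta : vdg) (x : pt) (j : 'I_d) (b : bool).
Local Notation n := (maxstar d Csr Cqu).
Local Notation Kd := (Kdet d Csr Cqu).
Local Notation Ki := (Kinv Csr Cqu).
Local Notation det k := (`|\det (mB k)|).
Local Notation h := (hmax M).

Let h0 : 0 < h.
Proof. exact (hmax_gt0 d0 unitB (Ordinal N0)). Qed.

Let Ki0 : 0 <= Ki.
Proof. exact: le_trans ler01 (Kinv_ge1 Csr1 Cqu1). Qed.

Let Kd0 : 0 <= Kd := Kdet_ge0 d Csr1 Cqu1.

Let C0 : 0 <= (d%:R * Ki * 3 ^+ d) * (p%:R ^+ 2 / h).
Proof.
by move: (Ki) Ki0 => t t0; rewrite mulr_ge0 ?divr_ge0 ?sqr_ge0 ?(ltW h0)// !mulr_ge0 ?exprn_ge0.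
Qed.

Let sum_const_face (t : R) : \sum_(j < d) \sum_(b : bool) t = 2 * d%:R * t.
Proof. by rewrite !sumr_const card_bool card_ord -mulrnA -[LHS]mulr_natl natrM. Qed.

Lemma scaled_trace (c : coef) k j b (f : pt -> R) :
  (forall x, rface (facet j b) x -> f (Fmap k x) = qeval c x ^+ 2) ->
  faceint k j b f <=
  (d%:R * Ki * 3 ^+ d) * (p%:R ^+ 2 / h) * (det k * refint (fun x => qeval c x ^+ 2)).
Proof.
move=> fE; have [s [w Hs]] := lobatto_ruleP R p0.
have := trace_refint d0 p0 Hs (f := fun x => f (Fmap k x)) fE; rewrite /faceint; set F := reffaceint _ _ _; set T := refint _ => H.
have T0 : 0 <= T.
  apply: (refint_ge0 (p := p)) => [|x _]; last exact: sqr_ge0.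
  by apply: tpoly_sqr; exact: tpoly_qeval.
have pp : (p * p.+1)%:R / 2 <= p%:R ^+ 2 :> R.
  rewrite ler_pdivrMr// -natrX -natrM ler_nat; move: p0; clear; nia.
have {}H : F <= p%:R ^+ 2 * 3 ^+ d * T.
  by apply: le_trans H _; rewrite mulrA; apply: ler_wpM2r => //; apply: ler_wpM2r => //; exact: exprn_ge0.
have nv := nvec_le d0 Csr1 unitB inball quasi k j.
have nv0 := nvec_gt0 d0 unitB k j.
apply: le_trans (ler_wpM2l _ H) _; first by rewrite mulr_ge0// ltW.
rewrite [leLHS](_ : _ = (det k * (p%:R ^+ 2 * 3 ^+ d * T)) * enorm (nvec k j)); last by ring.
rewrite [leRHS](_ : _ = (det k * (p%:R ^+ 2 * 3 ^+ d * T)) * (d%:R * Ki / h)); last by ring.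
by apply: ler_wpM2l => //; rewrite mulr_ge0// mulr_ge0// mulr_ge0 ?sqr_ge0 ?exprn_ge0.
Qed.

(** The face integral is taken in the coordinates of [k]. The pulled-back polynomial has the nodal
    values of [v] on [l] with equal weights, so its norm grows by at most [3 ^+ d], and [Kd]
    accounts for the change of determinant. *)
Lemma scaled_trace_nbr v k j b l : nbr k j b l ->
  faceint k j b (fun x => vk v l x ^+ 2) <=
  (d%:R * Ki * 3 ^+ d) * (p%:R ^+ 2 / h) *
    (Kd * 3 ^+ d * (det l * refint (fun x => qeval (v l) x ^+ 2))).
Proof.
move=> /asboolP [_ kl]; have [s [w Hs]] := lobatto_ruleP R p0.
have [T [t [TE Tc ti tE tW]]] := match_nodes unitB conf Hs k l.
have [c cE] := Tc (v l).
have fE x : rface (facet j b) x -> vk v l (Fmap k x) ^+ 2 = qeval c x ^+ 2.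
  by move=> fx; rewrite /vk TE ?cE//; [case: fx|apply: kl; exists x].
apply: le_trans (scaled_trace (f := fun x => vk v l x ^+ 2) fE) _.
apply: ler_wpM2l => //.
set A := refint _; set B := refint _.
have AB : A <= 3 ^+ d * B.
  apply: le_trans (refint_nodes Hs c) _; apply: le_trans (nodes_refint Hs (v l)).
  apply: (ler_sum_inj ti) => a.
    by rewrite mulr_ge0 ?sqr_ge0// (gweight_ge0 Hs).
  by rewrite tW tE cE.
have B0 : 0 <= B.
  apply: (refint_ge0 (p := p)) => [|x _]; last exact: sqr_ge0.
  by apply: tpoly_sqr; exact: tpoly_qeval.
apply: le_trans (ler_wpM2l _ AB) _ => //.
rewrite [leRHS](_ : _ = (Kd * det l) * (3 ^+ d * B)); last by ring.
apply: ler_wpM2r; first by rewrite mulr_ge0 ?exprn_ge0.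
exact: det_compare.
Qed.

Definition energy eta k : R := \sum_i det k * refint (fun x => qeval (eta i k) x ^+ 2).

Lemma energy_ge0 eta k : 0 <= energy eta k.
Proof.
apply: sumr_ge0 => i _; rewrite mulr_ge0//; apply: (refint_ge0 (p := p)) => [|x _]; last exact: sqr_ge0.
by apply: tpoly_sqr; exact: tpoly_qeval.
Qed.

Lemma L2vv_energy eta : L2vv eta eta = \sum_k energy eta k.
Proof.
rewrite L2vvE// exchange_big; apply: eq_bigr => k _; apply: eq_bigr => i _.
by congr (_ * refint _); apply/funext => x; rewrite expr2.
Qed.

Lemma dot_gk eta k x : dot (gk eta k x) (gk eta k x) = \sum_i vk (eta i) k x ^+ 2.
Proof. by apply: eq_bigr => i _; rewrite !mxE expr2. Qed.

Lemma fpoly_normsq k j b m eta : (forall v, fpoly p.+1 k j b (vk v m)) ->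
  fpoly (2 * p.+1) k j b (fun x => dot (gk eta m x) (gk eta m x)).
Proof.
move=> H; apply: fpoly_ext (fpoly_sum (index_enum 'I_d) (fun i => fpoly_sqr (H (eta i)))) => x.
by rewrite dot_gk.
Qed.

Lemma faceint_sum k j b (I : finType) (F : I -> pt -> R) : (forall i, fpoly (2 * p.+1) k j b (F i)) ->
  faceint k j b (fun x => \sum_i F i x) = \sum_i faceint k j b (F i).
Proof.
have [I' [y [q [_ hy rule]]]] := @cube_rule R d p.
move=> H; rewrite (faceint_rule d0 hy rule); last exact: fpoly_sum.
under [RHS]eq_bigr => i _ do rewrite (faceint_rule d0 hy rule)//.
rewrite -mulr_sumr; congr (_ * _); rewrite /fquad exchange_big; apply: eq_bigr => a _.
by rewrite mulr_sumr.
Qed.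

Lemma faceint_normsq eta k j b m : (forall v, fpoly p.+1 k j b (vk v m)) ->
  faceint k j b (fun x => dot (gk eta m x) (gk eta m x)) =
  \sum_i faceint k j b (fun x => vk (eta i) m x ^+ 2).
Proof.
move=> H; rewrite -faceint_sum => [|i]; last exact: fpoly_sqr.
by congr faceint; apply/funext => x; rewrite dot_gk.
Qed.

Local Notation Ct := (d%:R * Ki * 3 ^+ d).

Lemma trace_own eta k j b : faceint k j b (fun x => dot (gk eta k x) (gk eta k x)) <=
  Ct * (p%:R ^+ 2 / h) * energy eta k.
Proof.
rewrite faceint_normsq => [|v]; last exact: fpoly_own.
rewrite mulr_sumr; apply: ler_sum => i _; apply: scaled_trace => x _.
by rewrite vk_Fmap.
Qed.

Lemma trace_nbr eta k j b l : nbr k j b l ->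
  faceint k j b (fun x => dot (gk eta l x) (gk eta l x)) <=
  Ct * (p%:R ^+ 2 / h) * (Kd * 3 ^+ d * energy eta l).
Proof.
move=> kl; rewrite faceint_normsq => [|v]; last exact: fpoly_nbr.
by rewrite !mulr_sumr; apply: ler_sum => i _; exact: scaled_trace_nbr.
Qed.

Lemma card_nbr k j b : (#|[set l | nbr k j b l]%SET| <= n)%N.
Proof.
apply: leq_trans (card_star d0 Csr1 Cqu1 unitB disj inball quasi (Fmap k (upd 0 j (sgn R b)))).
apply: subset_leq_card; apply/fintype.subsetP => l; rewrite !finset.inE => /asboolP [_ kl].
apply/asboolP/kl; exists (upd 0 j (sgn R b)) => //; apply: rface_upd => i.
by rewrite mxE lerN10 ler01.
Qed.

Let vtx l (z : {ffun 'I_d -> bool}) : pt := Fmap l (\row_i sgn R (z i)).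

Let nbr_vertex k j b l : nbr k j b l -> exists z, celem k (vtx l z).
Proof.
move=> /asboolP [lk kl]; rewrite eq_sym in lk.
pose x : pt := upd 0 j (sgn R b).
have fx : rface (facet j b) x by apply: rface_upd => i; rewrite mxE lerN10 ler01.
have I : (celem k `&` celem l) (Fmap k x).
  by split; [exists x => //; case: fx|apply: kl; exists x].
have [E|[sig [tau [_ E]]]] := conf lk; first by rewrite E in I.
(* A vertex of the common face as seen from [l]; the coordinates left free by the face are set to
   1. *)
exists [ffun i => if tau i is Some c then c else true].
suff : (celem k `&` celem l) (vtx l [ffun i => if tau i is Some c then c else true]) by case.
rewrite E; exists (\row_i sgn R ([ffun i => if tau i is Some c then c else true] i)) => //.
split=> [i|i]; last by rewrite mxE ffunE; case: (tau i).
by rewrite mxE; case: (_ i); rewrite /sgn; apply/andP; split; lra.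
Qed.

Lemma facesum_own eta : facesum (fun k _ _ _ => energy eta k) (fun k _ _ => energy eta k) <=
  2 * d%:R * (n%:R + 1) * \sum_k energy eta k.
Proof.
rewrite mulr_sumr; apply: ler_sum => k _; have e0 := energy_ge0 eta k.
apply: (@le_trans _ _ (\sum_(j < d) \sum_(b : bool) (n%:R + 1) * energy eta k)); last first.
  by rewrite sum_const_face le_eqVlt; apply/orP; left; apply/eqP; ring.
apply: ler_sum => j _; apply: ler_sum => b _; rewrite mulrDl mul1r; apply: lerD; last by case: ifP.
rewrite (eq_bigl (mem [set l | nbr k j b l]%SET)); last by move=> l; rewrite !inE.
by rewrite sumr_const -[leLHS]mulr_natl; apply: ler_wpM2r => //; rewrite ler_nat card_nbr.
Qed.

(** This counts the elements that have [l] as neighbour. Each contains a vertex of [l], there are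
    [2 ^ d] vertices, and each lies in at most [n] closed elements. *)
Lemma facesum_nbr eta : facesum (fun _ _ _ l => energy eta l) (fun _ _ _ => 0) <=
  2 * d%:R * (2 ^+ d * n%:R) * \sum_k energy eta k.
Proof.
have e0 l := energy_ge0 eta l.
apply: (@le_trans _ _ (\sum_(k < N) \sum_(j < d) \sum_(b : bool)
    \sum_l \sum_z if `[< celem k (vtx l z) >] then energy eta l else 0)).
  apply: ler_sum => k _; apply: ler_sum => j _; apply: ler_sum => b _.
  rewrite (_ : (if _ then _ else _) = 0) ?addr0; last by case: ifP.
  rewrite big_mkcond; apply: ler_sum => l _; case: ifP => [/nbr_vertex [z cz]|_]; last first.
    by apply: sumr_ge0 => z _; case: ifP.
  apply: le_trans (ler_sum_term (i := z) _ _) => //; last by move=> z' _; case: ifP.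
  by rewrite ifT//; apply/asboolP.
rewrite [leLHS](_ : _ = 2 * d%:R * \sum_(k < N) \sum_l \sum_z if `[< celem k (vtx l z) >] then energy eta l else 0); last first.
  rewrite mulr_sumr; apply: eq_bigr => k _.
  exact: sum_const_face.
rewrite -[leRHS]mulrA; apply: ler_wpM2l; first by rewrite mulr_ge0.
rewrite exchange_big mulr_sumr; apply: ler_sum => l _; rewrite exchange_big /=.
apply: (@le_trans _ _ (\sum_(z : {ffun 'I_d -> bool}) n%:R * energy eta l)).
  apply: ler_sum => z _; rewrite -big_mkcond.
  rewrite (eq_bigl (mem [set k | `[< celem k (vtx l z) >]]%SET)); last by move=> k; rewrite !inE.
  by rewrite sumr_const -[leLHS]mulr_natl; apply: ler_wpM2r => //; rewrite ler_nat card_star.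
rewrite sumr_const card_ffun card_bool card_ord -[leLHS]mulr_natl natrX mulrA.
by [].
Qed.

Definition Ctrace : R :=
  Ct * (2 * d%:R * (n%:R + 1) + Kd * 3 ^+ d * (2 * d%:R * (2 ^+ d * n%:R))).

Definition facenormsq eta : R := facesum
  (fun k j b l => faceint k j b (fun x => dot (gk eta k x) (gk eta k x)) +
                  faceint k j b (fun x => dot (gk eta l x) (gk eta l x)))
  (fun k j b => faceint k j b (fun x => dot (gk eta k x) (gk eta k x))).

Lemma facenormsq_le eta : facenormsq eta <= Ctrace * (p%:R ^+ 2 / h) * L2vv eta eta.
Proof.
apply: (@le_trans _ _ (facesum (fun k j b l => Ct * (p%:R ^+ 2 / h) * (energy eta k + Kd * 3 ^+ d * energy eta l))
    (fun k j b => Ct * (p%:R ^+ 2 / h) * (energy eta k + Kd * 3 ^+ d * 0)))).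
  apply: facesum_le => k j b => [l kl|_]; rewrite mulrDr.
    by apply: lerD; [exact: trace_own|exact: trace_nbr].
  by rewrite !mulr0 addr0; exact: trace_own.
rewrite facesumZ (facesumD (fun k _ _ _ => energy eta k) (fun k _ _ => energy eta k)) facesumZ.
rewrite L2vv_energy /Ctrace; set S := \sum_k _.
rewrite [leRHS](_ : _ = Ct * (p%:R ^+ 2 / h) * (2 * d%:R * (n%:R + 1) * S + Kd * 3 ^+ d * (2 * d%:R * (2 ^+ d * n%:R) * S))); last by ring.
apply: ler_wpM2l => //; apply: lerD; first exact: facesum_own.
by apply: ler_wpM2l; [rewrite mulr_ge0 ?exprn_ge0|exact: facesum_nbr].
Qed.

Let young (tau r t e K : R) : 0 < tau -> t ^+ 2 <= K * e ->
  - (r * t) <= tau / 2 * r ^+ 2 + K / (2 * tau) * e.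
Proof.
move=> t0 te; apply: (@le_trans _ _ (tau / 2 * r ^+ 2 + t ^+ 2 / (2 * tau))); last first.
  by rewrite lerD2l [leRHS]mulrAC; apply: ler_wpM2r => //; rewrite invr_ge0 mulr_ge0 ?ltW.
rewrite -subr_ge0 (_ : _ - _ = (tau * r + t) ^+ 2 / (2 * tau)); last by field; exact: lt0r_neq0.
by rewrite divr_ge0 ?sqr_ge0 ?mulr_ge0 ?ltW.
Qed.

Let dot_half (x y : pt) :
  dot (2^-1 *: (x + y)) (2^-1 *: (x + y)) <= 2^-1 * (dot x x + dot y y).
Proof.
rewrite /dot -big_split mulr_sumr; apply: ler_sum => i _ /=; rewrite !mxE -subr_ge0.
by rewrite (_ : _ - _ = (x 0 i - y 0 i) ^+ 2 / 4) ?divr_ge0 ?sqr_ge0//; field.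
Qed.

Let dot_sub (x y : pt) : dot (x - y) (x - y) <= 2 * (dot x x + dot y y).
Proof.
rewrite /dot -big_split mulr_sumr; apply: ler_sum => i _ /=; rewrite !mxE -subr_ge0.
by rewrite (_ : _ - _ = (x 0 i + y 0 i) ^+ 2) ?sqr_ge0//; ring.
Qed.

Let nrm1 k j b : dot (nrm k j b) (nrm k j b) = 1.
Proof. by rewrite -enorm_sqr enorm_nrm// expr1n. Qed.

Variables (beta : pt) (Cbeta : R).
Hypothesis hbeta : enorm beta <= Cbeta.
Local Notation K := (1 + Cbeta ^+ 2).

(** The halves are the face weight of [lift_rhs]. The square is at most [(a^2 + c^2 t^2) / 2], with
    [a^2 <= e / 2], [t^2 <= 2 e] and [c^2 <= Cbeta^2]. *)
Let flux_bound k j b (x y : pt) :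
  (2^-1 * dot (nrm k j b) (2^-1 *: (x + y)) + 2^-1 * (dot beta (nrm k j b) * dot (x - y) (nrm k j b))) ^+ 2
  <= K * (dot x x + dot y y).
Proof.
set a := dot (nrm _ _ _) _; set c := dot beta _; set t := dot (x - y) _.
set e := dot x x + dot y y.
have e0 : 0 <= e by rewrite addr_ge0 ?dot_ge0.
have ha : a ^+ 2 <= 2^-1 * e.
  by apply: le_trans (dot_sqr_le _ _) _; rewrite nrm1 mul1r dot_half.
have ht : t ^+ 2 <= 2 * e.
  by apply: le_trans (dot_sqr_le _ _) _; rewrite nrm1 mulr1 dot_sub.
have hc : c ^+ 2 <= Cbeta ^+ 2.
  apply: le_trans (dot_sqr_le _ _) _; rewrite nrm1 mulr1 -enorm_sqr lerXn2r// nnegrE.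
    exact: enorm_ge0.
  exact: le_trans (enorm_ge0 _) hbeta.
have hct : (c * t) ^+ 2 <= Cbeta ^+ 2 * (2 * e).
  by rewrite exprMn; apply: ler_pM => //; exact: sqr_ge0.
have := sqr_ge0 (a - c * t); move: ha hct; rewrite sqrrB sqrrD !exprMn.
by move: (Cbeta ^+ 2 * e) (mulrCA (Cbeta ^+ 2) 2 e) => ce ->; nra.
Qed.

(** Pointwise Young inequality on each face between jump and flux; [tau] stays free so that the flux
    part can later be absorbed. *)
Lemma lift_rhs_le tau u eta : 0 < tau ->
  lift_rhs beta u eta <= tau / 2 * jumpsum u + K / (2 * tau) * facenormsq eta.
Proof.
move=> t0; rewrite /jumpsum /facenormsq -!facesumZ -facesumD /lift_rhs -mulN1r -facesumZ.
apply: facesum_le => k j b => [l kl|_].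
  have fJ := fpoly_jump p0 unitB conf u kl.
  have fA := fpoly_average p0 unitB conf eta kl.
  have fD := fpoly_difference p0 unitB conf eta kl.
  have f1 := fpolyM2 fJ fA.
  have f2 := fpolyM2 (fpolyZ (dot beta (nrm k j b)) fJ) fD.
  have n1 := fpoly_normsq eta (fun v => fpoly_own unitB v k j b).
  have n2 := fpoly_normsq eta (fun v => fpoly_nbr p0 unitB conf v kl).
  have fJ2 := fpoly_sqr fJ.
  rewrite -(faceintD d0 n1 n2) -(faceintZ d0 _ (fpolyD n1 n2)) -(faceintZ d0 _ fJ2).
  rewrite -(faceintD d0 (fpolyZ _ fJ2) (fpolyZ _ (fpolyD n1 n2))).
  rewrite -(faceintZ d0 _ f1) -(faceintZ d0 _ f2) -(faceintD d0 (fpolyZ _ f1) (fpolyZ _ f2)).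
  rewrite -(faceintZ d0 _ (fpolyD (fpolyZ _ f1) (fpolyZ _ f2))).
  apply: (@faceint_le R d p M d0).
  - by apply: fpolyZ; apply: fpolyD; exact: fpolyZ.
  - by apply: fpolyD; apply: fpolyZ => //; exact: fpolyD.
  move=> x _; apply: le_trans (young (vk u k x - vk u l x) t0 (flux_bound k j b (gk eta k x) (gk eta l x))).
  by rewrite le_eqVlt; apply/orP; left; apply/eqP; ring.
have fv := fpoly_own unitB u k j b.
have f1 := fpolyM2 fv (fpoly_normal unitB eta k j b).
have n1 := fpoly_normsq eta (fun v => fpoly_own unitB v k j b).
have f2 := fpoly_sqr fv.
rewrite -!(faceintZ d0 _ n1) -(faceintZ d0 _ f2) -(faceintZ d0 _ f1) -(faceintD d0 (fpolyZ _ f2) (fpolyZ _ n1)).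
apply: (@faceint_le R d p M d0); [exact: fpolyZ|by apply: fpolyD; exact: fpolyZ|].
move=> x _; rewrite mulN1r; apply: young => //.
apply: le_trans (dot_sqr_le _ _) _; rewrite nrm1; apply: ler_wpM2r; first exact: dot_ge0.
by rewrite lerDl sqr_ge0.
Qed.

Definition Clift : R := 2 * (K * Ctrace + 1).

(** Test with [G(u)] itself and take [tau = T p^2 / h], where [T = K * Ctrace + 1]. By the trace
    inequality the flux part is then at most half of the left side and is absorbed; the jump part is
    at most [T] times the penalty. *)
Lemma Gop_bound u : L2vv (Gop beta u) (Gop beta u) <= Clift * penalty 1 u u.
Proof.
have [s [w Hs]] := lobatto_ruleP R p0.
set g := Gop beta u; set L := L2vv g g; set P := penalty 1 u u.
have Ct0 : 0 <= Ctrace.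
  rewrite /Ctrace; move: (Ki) (Kd) Ki0 Kd0 => t t' t0 t0'.
  by rewrite mulr_ge0 ?addr_ge0 ?mulr_ge0 ?addr_ge0 ?exprn_ge0.
set T := K * Ctrace + 1; have T0 : 0 < T.
  by rewrite ltr_wpDl// mulr_ge0// addr_ge0 ?sqr_ge0.
have q0 : 0 < p%:R ^+ 2 / h by rewrite divr_gt0 ?exprn_gt0 ?ltr0n.
have L0 : 0 <= L by rewrite /L L2vv_energy; apply: sumr_ge0 => k _; exact: energy_ge0.
have L_le : L <= T * (p%:R ^+ 2 / h) / 2 * jumpsum u + K / (2 * (T * (p%:R ^+ 2 / h))) * facenormsq g.
  by rewrite /L (Gop_spec d0 p0 unitB conf Hs); apply: lift_rhs_le; rewrite mulr_gt0.
have hJ : p%:R ^+ 2 / h / 2 * jumpsum u <= P.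
  have := jumpsum_penalty d0 p0 N0 unitB conf u; rewrite -/P.
  by rewrite -[_ / h / 2]mulrA -invfM [h * 2]mulrC.
have hF := facenormsq_le g; rewrite -/L in hF.
have : L <= T * P + 2^-1 * L.
  apply: le_trans L_le _; apply: lerD.
    rewrite (_ : _ * _ = T * (p%:R ^+ 2 / h / 2 * jumpsum u)); last by ring.
    by apply: ler_wpM2l => //; exact: ltW.
  have c0 : 0 <= K / (2 * (T * (p%:R ^+ 2 / h))).
    apply: divr_ge0; first by rewrite addr_ge0 ?sqr_ge0.
    by apply: mulr_ge0 => //; apply: mulr_ge0; exact: ltW.
  apply: le_trans (ler_wpM2l c0 hF) _.
  have qn := lt0r_neq0 q0; have Tn := lt0r_neq0 T0.
  rewrite [leLHS](_ : _ = K * Ctrace / T * (2^-1 * L)); last first.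
    by move: (p%:R ^+ 2 / h) qn => q qn; field; rewrite qn Tn.
  apply: ler_piMl; first by rewrite mulr_ge0.
  by rewrite ler_pdivrMr// mul1r /T lerDl.
by rewrite /Clift -/T -mulrA; move: (T * P) => z hz; lra.
Qed.

End LiftingBound.

(** * Stability *)

Section Stability.
Variables (R : realType) (d p : nat) (M : mesh R d) (Csr Cqu : R).
Local Notation pt := 'rV[R]_d.
Local Notation N := (nel M).
Local Notation coef := (coef R d p).
Local Notation dgfun := (dgfun M p).
Local Notation vdg := (vdg M p).
Hypotheses (d0 : (0 < d)%N) (p0 : (0 < p)%N) (N0 : (0 < N)%N).
Hypotheses (Csr1 : 1 <= Csr) (Cqu1 : 1 <= Cqu).
Hypothesis unitB : forall k : 'I_N, mB k \in unitmx.
Hypothesis convO : Defs.convex_set (Omega M).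
Hypothesis disj : forall k l : 'I_N, k != l -> setI (elem k) (elem l) = set0.
Hypothesis conf : forall k l : 'I_N, k != l -> setI (celem k) (celem l) = set0 \/
  exists sig tau, setI (celem k) (celem l) = Fmap k @` rface sig /\
                  setI (celem k) (celem l) = Fmap l @` rface tau.
Hypothesis inball : forall k : 'I_N, exists c : pt, forall y, enorm (y - c) < diam k / Csr -> elem k y.
Hypothesis quasi : forall k : 'I_N, hmax M <= Cqu * diam k.
Implicit Types (k l : 'I_N) (u v : dgfun) (g : vdg) (x : pt) (j : 'I_d) (b : bool).

Definition dirichlet v : R := \sum_k elint k (fun x => dot (gradk v k x) (gradk v k x)).
Definition crossgrad v g : R := \sum_k elint k (fun x => dot (gradk v k x) (gk g k x)).

Let tpoly_gk g k i : tpoly p.+1 (fun x => gk g k (Fmap k x) 0 i).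
Proof. by apply: tpoly_ext (tpoly_qeval (g i k)) => x; rewrite mxE vk_Fmap. Qed.

Let tpoly_dot (F G : pt -> pt) : (forall i, tpoly p.+1 (fun x => F x 0 i)) ->
  (forall i, tpoly p.+1 (fun x => G x 0 i)) -> tpoly (2 * p.+1) (fun x => dot (F x) (G x)).
Proof. by move=> hF hG; apply: tpoly_sum => i; exact: tpolyM2. Qed.

(** Expansion of the squared norm of [grad v + t g]. The values -1, 1 and 2 of [t] give every bound
    of the cross term used below. *)
Lemma dirichlet_quad v g (t : R) :
  0 <= dirichlet v + 2 * t * crossgrad v g + t ^+ 2 * L2vv g g.
Proof.
have [I [y [q [q0 hy rule]]]] := @cube_rule R d p.
rewrite /dirichlet /crossgrad /L2vv !mulr_sumr -!big_split; apply: sumr_ge0 => k _.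
rewrite /elint !rule; try by apply: tpoly_dot => i; [exact: tpoly_gradk|exact: tpoly_gradk].
2,3: by apply: tpoly_dot => i; [exact: tpoly_gradk || exact: tpoly_gk|exact: tpoly_gk].
rewrite [X in 0 <= X](_ : _ = `|\det (mB k)| * \sum_i q i *
    dot (gradk v k (Fmap k (y i)) + t *: gk g k (Fmap k (y i)))
        (gradk v k (Fmap k (y i)) + t *: gk g k (Fmap k (y i)))).
  by rewrite mulr_ge0//; apply: sumr_ge0 => i _; rewrite mulr_ge0 ?dot_ge0.
rewrite /= ![_ * (`|_| * _)]mulrCA -!mulrDr; congr (_ * _).
rewrite !mulr_sumr -!big_split; apply: eq_bigr => i _ /=.
set X := gradk _ _ _; set G := gk _ _ _.
have -> : dot (X + t *: G) (X + t *: G) = dot X X + 2 * t * dot X G + t ^+ 2 * dot G G.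
  rewrite /dot !mulr_sumr -!big_split; apply: eq_bigr => j _.
  by rewrite !mxE /=; ring.
by ring.
Qed.

Lemma dirichlet_sub u v : dirichlet (dgsub u v) <= 2 * dirichlet u + 2 * dirichlet v.
Proof.
have [I [y [q [q0 hy rule]]]] := @cube_rule R d p.
rewrite /dirichlet !mulr_sumr -big_split; apply: ler_sum => k _ /=.
rewrite /elint !rule; try by apply: tpoly_dot => i; exact: tpoly_gradk.
rewrite ![2 * (`|_| * _)]mulrCA -mulrDr; apply: ler_wpM2l => //.
rewrite !mulr_sumr -big_split; apply: ler_sum => i _ /=.
rewrite ![2 * (q i * _)]mulrCA -mulrDr; apply: ler_wpM2l => //.
rewrite /dot !mulr_sumr -big_split; apply: ler_sum => j _ /=; rewrite !gradkE//.
set A := \sum_j _; set B := \sum_j _; set D := \sum_j _.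
have -> : A = B - D.
  rewrite -sumrB; apply: eq_bigr => m _; rewrite -mulrBr; congr (_ * _).
  by rewrite -sumrB; apply: eq_bigr => a _; rewrite !ffunE mulrBl.
rewrite -subr_ge0 (_ : _ - _ = (B + D) ^+ 2) ?sqr_ge0//; ring.
Qed.

Let on_facet k j b x : (Fmap k @` rface (facet j b)) x -> celem k x /\ Finv k x 0 j = sgn R b.
Proof.
move=> [y [hy fy] <-]; split; first by exists y.
by rewrite FmapK//; have := fy j; rewrite /facet eqxx.
Qed.

Variables (s : seq R) (w : R -> R).
Hypothesis Hs : lobatto_rule p s w.

(** Stated with a factor [t] to serve twice: [t = 0] for the averaged function, whose jumps vanish,
    and [t = 1] for the error, whose jumps are those of [v]. *)
Lemma penalty_le_scale t u v :
  (forall k j b l x, nbr k j b l -> (Fmap k @` rface (facet j b)) x ->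
    vk u k x - vk u l x = t * (vk v k x - vk v l x)) ->
  (forall k j b x, isbdry k j b -> (Fmap k @` rface (facet j b)) x -> vk u k x = t * vk v k x) ->
  penalty 1 u u <= t ^+ 2 * penalty 1 v v.
Proof.
move=> hJ hB; rewrite /penalty -facesumZ; apply: facesum_le => k j b => [l kl|bk].
  have fu := fpoly_jump p0 unitB conf u kl; have fv := fpoly_jump p0 unitB conf v kl.
  rewrite [leRHS]mulrCA; apply: ler_wpM2l; first by rewrite invr_ge0.
  rewrite -(faceintZ d0 _ (fpolyM2 (fpolyZ _ fv) fv)); apply: (@faceint_le R d p M d0).
  - exact: fpolyM2 (fpolyZ _ fu) fu.
  - exact: fpolyZ (fpolyM2 (fpolyZ _ fv) fv).
  by move=> x fx; rewrite (hJ k j b l x)// le_eqVlt; apply/orP; left; apply/eqP; ring.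
have fu := fpoly_own unitB u k j b; have fv := fpoly_own unitB v k j b.
rewrite -(faceintZ d0 _ (fpolyM2 (fpolyZ _ fv) fv)); apply: (@faceint_le R d p M d0).
- exact: fpolyM2 (fpolyZ _ fu) fu.
- exact: fpolyZ (fpolyM2 (fpolyZ _ fv) fv).
by move=> x fx; rewrite (hB k j b x)// le_eqVlt; apply/orP; left; apply/eqP; ring.
Qed.

Let Qh_jump v k j b l x : nbr k j b l -> (Fmap k @` rface (facet j b)) x ->
  vk (Qh v) k x = vk (Qh v) l x.
Proof.
move=> /asboolP [_ kl] fx; have [ck _] := on_facet fx.
exact: (Qh_continuous unitB conf Hs v ck (kl x fx)).
Qed.

Let Qh_isbdry v k j b x : isbdry k j b -> (Fmap k @` rface (facet j b)) x -> vk (Qh v) k x = 0.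
Proof.
move=> bk fx; have [ck xj] := on_facet fx.
exact: (Qh_bdry unitB convO Hs v (isbdry_bdry unitB convO disj conf bk ck xj) ck).
Qed.

Lemma penalty_Qh v : penalty 1 (Qh v) (Qh v) <= 0.
Proof.
suff : penalty 1 (Qh v) (Qh v) <= 0 ^+ 2 * penalty 1 v v by rewrite expr0n mul0r.
apply: penalty_le_scale => [k j b l x kl fx|k j b x bk fx].
  by rewrite (Qh_jump v kl fx) subrr mul0r.
by rewrite (Qh_isbdry v bk fx) mul0r.
Qed.

Lemma penalty_dgsub_Qh v : penalty 1 (dgsub v (Qh v)) (dgsub v (Qh v)) <= penalty 1 v v.
Proof.
suff : penalty 1 (dgsub v (Qh v)) (dgsub v (Qh v)) <= 1 ^+ 2 * penalty 1 v v.
  by rewrite expr1n mul1r.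
apply: penalty_le_scale => [k j b l x kl fx|k j b x bk fx].
  by rewrite !vkB (Qh_jump v kl fx); ring.
by rewrite vkB (Qh_isbdry v bk fx) subr0 mul1r.
Qed.

Variables (Cbeta : R) (beta : pt) (sipg : bool) (alpha : R).
Local Notation Cl := (Clift d Csr Cqu Cbeta).
Local Notation Co := (Cosw d Csr Cqu).
Hypotheses (hbeta : enorm beta <= Cbeta) (alpha1 : 1 <= alpha) (alpha0 : sipg -> 4 * Cl <= alpha).
Local Notation A := (Aform M p alpha beta (if sipg then 0 else 1)).

Lemma Clift_gt0 : 0 < Cl.
Proof.
rewrite /Clift mulr_gt0// ltr_wpDl// mulr_ge0// ?addr_ge0 ?sqr_ge0//.
have := Kinv_ge1 Csr1 Cqu1; have := Kdet_ge0 d Csr1 Cqu1; rewrite /Ctrace.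
move: (Kinv _ _) (Kdet _ _ _) => t t' t'0 t1; have t0 : 0 <= t := le_trans ler01 t1.
by rewrite mulr_ge0 ?addr_ge0 ?mulr_ge0 ?addr_ge0 ?exprn_ge0.
Qed.

Lemma Cosw_ge0 : 0 <= Co.
Proof.
rewrite /Cosw; have := Kinv_ge1 Csr1 Cqu1; have := Kdet_ge0 d Csr1 Cqu1.
move: (Kinv _ _) (Kdet _ _ _) => t t' t'0 t1; have t0 : 0 <= t := le_trans ler01 t1.
by rewrite !mulr_ge0 ?exprn_ge0.
Qed.

Lemma dirichlet_ge0 v : 0 <= dirichlet v.
Proof. by have := dirichlet_quad v (fun _ _ => 0) 0; rewrite mulr0 mul0r expr0n mul0r !addr0. Qed.

Lemma Aform_diag v : A v v = dirichlet v + 2 * crossgrad v (Gop beta v) + alpha * penalty 1 v v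
  + (if sipg then 0 else 1) * L2vv (Gop beta v) (Gop beta v).
Proof.
rewrite /Aform penaltyE// -/(dirichlet v) -/(crossgrad v (Gop beta v)).
have -> : \sum_k elint k (fun x => dot (gk (Gop beta v) k x) (gradk v k x)) = crossgrad v (Gop beta v).
  by apply: eq_bigr => k _; congr elint; apply/funext => x; exact: dotC.
by rewrite [2 * _]mulrDl mul1r !addrA.
Qed.

Let L2vv_ge0 g : 0 <= L2vv g g.
Proof. by rewrite (L2vv_energy unitB); apply: sumr_ge0 => k _; exact: energy_ge0. Qed.

Let lift_le v : L2vv (Gop beta v) (Gop beta v) <= Cl * penalty 1 v v.
Proof. exact: Gop_bound. Qed.

Lemma penalty_ge0 v : 0 <= penalty 1 v v.
Proof.
by rewrite -(pmulr_rge0 _ Clift_gt0); apply: le_trans (lift_le v); exact: L2vv_ge0.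
Qed.

Lemma Aform_le v : A v v <= 2 * dirichlet v + (2 * Cl + 1) * (alpha * penalty 1 v v).
Proof.
rewrite Aform_diag.
have := dirichlet_quad v (Gop beta v) (-1); have := L2vv_ge0 (Gop beta v); have := lift_le v.
have := penalty_ge0 v; have := ltW Clift_gt0; have := alpha1.
move: (dirichlet v) (crossgrad _ _) (L2vv _ _) (penalty _ _ _) Cl alpha => a b g P C al.
move=> al1 C0 P0 gP g0 q.
have CP : C * P <= C * (al * P) by apply: ler_wpM2l => //; rewrite ler_peMl.
rewrite [leRHS](_ : _ = 2 * a + 2 * (C * (al * P)) + al * P); last by ring.
move: q; rewrite sqrrN expr1n mulrN1 mul1r => q.
by case: sipg; lra.
Qed.

(** For SIPG, [t = 2] bounds the cross term below by minus half the gradient norm minus twice the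
    lifting, and [4 * Cl <= alpha] lets half the penalty absorb the latter. For LDG the form is the
    squared norm [e] of [grad v + G(v)] plus the penalty; the gradient is recovered from [e] and the
    lifting bound. *)
Lemma Aform_coercive v : dirichlet v + alpha * penalty 1 v v <= (2 * Cl + 2) * A v v.
Proof.
rewrite Aform_diag.
have := dirichlet_quad v (Gop beta v) 1.
have := dirichlet_quad v (Gop beta v) 2; have := L2vv_ge0 (Gop beta v); have := lift_le v.
have := penalty_ge0 v; have := ltW Clift_gt0; have := alpha1; have := alpha0; have := dirichlet_ge0 v.
move: (dirichlet v) (crossgrad _ _) (L2vv _ _) (penalty _ _ _) Cl alpha => a b g P C al.
move=> a0 alC al1 C0 P0 gP g0 q q1.
have CP : C * P <= C * (al * P) by apply: ler_wpM2l => //; rewrite ler_peMl.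
have aP : 0 <= al * P by rewrite mulr_ge0// (le_trans ler01 al1).
case: sipg alC => [/(_ isT) alC|_].
  have h : 4 * C * P <= al * P by apply: ler_wpM2r.
  set S := _ + _ * g; have S0 : a + al * P <= 2 * S.
    by rewrite /S; nra.
  apply: (le_trans S0); apply: ler_wpM2r; last by rewrite lerDr mulr_ge0.
  by have := le_trans (addr_ge0 a0 aP) S0; rewrite pmulr_rge0.
set e := a + 2 * b + g; have e0 : 0 <= e by move: q1; rewrite /e expr1n mulr1 mul1r.
have Ce : 0 <= C * e by rewrite mulr_ge0.
rewrite [leRHS](_ : _ = 2 * (C * e) + 2 * (C * (al * P)) + 2 * e + 2 * (al * P)); last by rewrite /e; ring.
have ae : a <= 2 * e + 2 * g by rewrite /e; lra.
move: e e0 Ce ae => {}e e0; move: (C * e) (C * P) (C * (al * P)) gP CP => t t' t'' gP CP t0 ae.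
lra.
Qed.

(** With [e = v - Q v] and [Q v = v - e], the two forms contain at most 6 gradient norms of [e] and
    4 of [v], plus [2 * Cl + 1] penalties of [v]. The oswald bound turns the 6 into [6 * Co], and
    [1 <= alpha] replaces [P(v)] by [alpha * P(v)], keeping the constant free of [alpha]. *)
Lemma oswald_stable v :
  A (dgsub v (Qh v)) (dgsub v (Qh v)) + A (Qh v) (Qh v) <=
  (6 * Co + 2 * Cl + 5) * (2 * Cl + 2) * A v v.
Proof.
set e := dgsub v (Qh v).
have Qe : Qh v = dgsub v e.
  by apply/funext => k; rewrite /e /dgsub opprB addrC subrK.
have he := Aform_le e; have hQ := Aform_le (Qh v); have hv := Aform_coercive v.
have sp := dirichlet_sub v e; rewrite -Qe in sp.
have og : dirichlet e <= Co * penalty 1 v v := oswald_grad d0 p0 N0 Csr1 Cqu1 unitB convO disj conf inball quasi Hs v.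
have pe := penalty_dgsub_Qh v; rewrite -/e in pe; have pQ := penalty_Qh v.
have al0 : 0 <= alpha := le_trans ler01 alpha1.
have Co0 := Cosw_ge0; have Cl0 := ltW Clift_gt0.
have c1 : 0 <= 2 * Cl + 1 by move: (Cl) Cl0 => x ?; rewrite addr_ge0 ?mulr_ge0.
have P0 := penalty_ge0 v.
have ape : alpha * penalty 1 e e <= alpha * penalty 1 v v by apply: ler_wpM2l.
have apQ : (2 * Cl + 1) * (alpha * penalty 1 (Qh v) (Qh v)) <= 0.
  by apply: mulr_ge0_le0 => //; exact: mulr_ge0_le0.
have cpe : (2 * Cl + 1) * (alpha * penalty 1 e e) <= (2 * Cl + 1) * (alpha * penalty 1 v v).
  by apply: ler_wpM2l.
have aP : penalty 1 v v <= alpha * penalty 1 v v by rewrite ler_peMl.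
have CaP : Co * penalty 1 v v <= Co * (alpha * penalty 1 v v) by apply: ler_wpM2l.
have a0 := dirichlet_ge0 v.
have ap0 : 0 <= alpha * penalty 1 v v by rewrite mulr_ge0.
set B := dirichlet v + _ in hv.
apply: (@le_trans _ _ ((6 * Co + 2 * Cl + 5) * B)); last first.
  rewrite -mulrA; apply: ler_wpM2l => //.
  by move: (Co) (Cl) Co0 Cl0 => x y ? ?; rewrite !addr_ge0 ?mulr_ge0.
rewrite [leRHS](_ : _ = (6 * Co + 2 * Cl) * dirichlet v + 6 * (Co * (alpha * penalty 1 v v)) +
    (2 * Cl + 1) * (alpha * penalty 1 v v) + 4 * (alpha * penalty 1 v v) + 5 * dirichlet v); last by rewrite /B; ring.
have c0 : 0 <= (6 * Co + 2 * Cl) * dirichlet v.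
  by apply: mulr_ge0 => //; move: (Co) (Cl) Co0 Cl0 => x y ? ?; rewrite addr_ge0 ?mulr_ge0.
lra.
Qed.

Lemma Aform_ge0 v : 0 <= A v v.
Proof.
have C0 : 0 < 2 * Cl + 2 by rewrite addr_gt0// mulr_gt0// Clift_gt0.
rewrite -(pmulr_rge0 _ C0); apply: le_trans (Aform_coercive v).
by rewrite addr_ge0 ?dirichlet_ge0// mulr_ge0 ?penalty_ge0// (le_trans ler01 alpha1).
Qed.

(** Coercivity makes the values non-negative, so the set is bounded below and [inf] does not exceed
    the value of the Oswald splitting. *)
Lemma splitting_inf v :
  inf [set r | exists vB vC : dgfun, VB vB /\ VC vC /\ dgadd vB vC = v /\ r = A vB vB + A vC vC] <=
  A (dgsub v (Qh v)) (dgsub v (Qh v)) + A (Qh v) (Qh v).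
Proof.
apply: ge_inf; first by exists 0 => _ [vB [vC [_ [_ [_ ->]]]]]; rewrite addr_ge0 ?Aform_ge0.
exists (dgsub v (Qh v)), (Qh v); split; first exact: (VB_Oswald unitB disj Hs v).
split; first exact: (VC_Oswald unitB convO conf Hs v).
by split=> //; apply/funext => k; rewrite /dgadd /dgsub subrK.
Qed.

End Stability.

Theorem theorem4p3 (R : realType) (d : nat) (Csr Cqu Cbeta : R) :
  (d = 2%N \/ d = 3%N) -> 1 <= Csr -> 1 <= Cqu -> 0 <= Cbeta ->
  exists alpha0 C : R, 1 <= alpha0 /\ 0 < C /\
  forall (M : mesh R d) (p : nat) (sipg : bool) (alpha : R) (beta : 'rV[R]_d),
    admissible_mesh M Csr Cqu ->
    (2 <= p)%N ->
    1 <= alpha ->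
    (sipg -> alpha0 <= alpha) ->
    (if sipg then beta = 0 else enorm beta <= Cbeta) ->
    let A := Aform M p alpha beta (if sipg then 0 else 1) in
    forall v : dgfun M p,
      A (dgsub (v) (Qh v)) (dgsub v (Qh v)) + A (Qh v) (Qh v) <= C * A v v /\
      inf [set r | exists vB vC : dgfun M p,
                     VB vB /\ VC vC /\ dgadd vB vC = v /\
                     r = A vB vB + A vC vC] <= C * A v v.
Proof.
move=> d23 Csr1 Cqu1 Cb0; have d0 : (0 < d)%N by case: d23 => ->.
pose Cl := Clift d Csr Cqu Cbeta; pose Co := Cosw d Csr Cqu.
have Cl0 : 0 < Cl by exact: Clift_gt0.
have Co0 : 0 <= Co by exact: Cosw_ge0.
(* Both constants are fixed from [d], [Csr], [Cqu] and [Cbeta] before mesh, degree and penalty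
   coefficient are introduced; this expresses the claimed independence. *)
exists (Num.max 1 (4 * Cl)), ((6 * Co + 2 * Cl + 5) * (2 * Cl + 2)).
split; first by rewrite le_max lexx.
split.
  by apply: mulr_gt0; move: (Cl) (Co) Cl0 Co0 => x y ? ?; lra.
move=> M p sipg alpha beta [N0 [unitB [convO [disj [conf [inball quasi]]]]]] p2 al1 al0 hb A v.
have p0 : (0 < p)%N by exact: ltn_trans p2.
have hbeta : enorm beta <= Cbeta.
  by case: sipg hb {al0 A} => [->|//]; rewrite /enorm /dot big1 ?sqrtr0// => i _; rewrite mxE mul0r.
have al4 : sipg -> 4 * Cl <= alpha by move=> /al0; apply: le_trans; rewrite le_max lexx orbT.
have [s [w Hs]] := lobatto_ruleP R p0.
have S := oswald_stable d0 p0 N0 Csr1 Cqu1 unitB convO disj conf inball quasi Hs hbeta al1 al4 v.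
split=> //; apply: le_trans S.
exact: (splitting_inf d0 p0 N0 Csr1 Cqu1 unitB convO disj conf inball quasi Hs hbeta al1 al4 v).
Qed.
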